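(* For every $\varepsilon>0$ there exists $d_0=d_0(\varepsilon)\ge1$ such that for any $d\ge d_0$ and any $0<\beta\le(1-\varepsilon)\beta_c(d)$ the following holds. For $\mathbf G=\mathbf G(n,d/n)$ and $\mathcal J=\{J_e:e\in E(\mathbf G)\}$ a family of i.i.d. standard Gaussians, $$\Pr\big[(\mathbf G,\mathcal J,\beta)\in\mathcal G(d,\varepsilon)\big]\ge 1-n^{-1/4}.$$
   Context: $\mathbf{G}(n,d/n)$: random graph on $n$ vertices, each edge present independently with probability $d/n$; $\beta_c(k)=\sqrt{2\pi}/k$. For a graph $G=(V,E)$ on $n$ vertices, couplings $\mathcal J=\{J_e\in\mathbb R:e\in E\}$ and $\beta>0$: the influence of edge $e$ is $\Gamma_e=\frac{|1-\exp(\beta J_e)|}{1+\exp(\beta J_e)}$; the aggregate influence of $u$ is $\mathcal A(u)=\sum_{w\sim u}\Gamma_{\{u,w\}}$. The $(d,\varepsilon)$ vertex weight is $M(u)=1-\varepsilon/4$ if $\mathcal A(u)\le 1-\varepsilon/2$ and $M(u)=d\cdot\mathcal A(u)$ otherwise. A path $P=(w_0,\dots,w_\ell)$ (distinct vertices, consecutive ones adjacent; its length is $\ell$) has weight $M(P)=\prod_{i=0}^\ell M(w_i)$. A vertex $u$ is a $(d,\varepsilon)$-block vertex if every path of length at most $\log n$ starting at $u$ has $M(P)<1$. For $B\subseteq V$, $\partial_{\rm out}B$ is the set of vertices outside $B$ having a neighbour in $B$. A partition $\mathcal B=\{B_1,\dots,B_N\}$ of $V$ is a $(d,\varepsilon)$-block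 partition if for every $B\in\mathcal B$: (1) the subgraph induced by $B$ is a tree with at most one extra edge; (2) if $|B|\ge2$: (a) every $w\in\partial_{\rm out}B$ is a $(d,\varepsilon)$-block vertex, (b) every $w\in\partial_{\rm out}B$ has exactly one neighbour in $B$, (c) if $B$ contains a cycle, its length is at most $4\log n/\log^4 d$, (d) the distance of this cycle from the boundary of $B$ is at least $\log^5 d$; (3) if $|B|=1$ its vertex is a $(d,\varepsilon)$-block vertex. For a path $P$ in $G$ let $\Upsilon(P)=\beta\sum_e|J_e|+\sum_{v\in P}\log\deg(v)$, the first sum over all edges of $G$ with at least one endpoint in $P$. For $d,\varepsilon>0$ and $0<\beta\le(1-\varepsilon)\beta_c(d)$, $\mathcal G(d,\varepsilon)$ is the set of triplets $(G,\mathcal J,\beta)$ such that: (i) $G$ admits a $(d,\varepsilon)$-block partition; (ii) every path $P$ of $G$ of length at most $\log n/\log^4 d$ satisfies $\Upsilon(P)\le \log n/\log^2 d$; (iii) every edge $e$ satisfies $n^{-7/3}\le|J_e|\le10\sqrt{\log n}$.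
   Formalization: The bound is stated for all n at least some n_0 depending only on ε and d (uniformly in β); for n comparable to d, e.g. n = 2d, condition (ii) already fails on one-vertex paths, so the claim cannot hold for every n. *)

(* Defs.v *)
From HB Require Import structures.
From mathcomp Require Import all_boot all_order all_algebra.
From mathcomp Require Import all_classical all_reals all_analysis.

Set Implicit Arguments.
Unset Strict Implicit.
Unset Printing Implicit Defensive.

Import Order.TTheory GRing.Theory Num.Theory.

Local Open Scope ring_scope.

(* Potential edges of a simple graph on 'I_n; a graph is its set of edges. *)
Definition edge (n : nat) : Type := {e : {set 'I_n} | #|e| == 2%N}.

Notation graph n := {set edge n}.

Section Graph.
Variables (n : nat) (g : graph n).

Definition adj : rel 'I_n := fun u v => [exists e in g, val e == [set u; v]%SET].

Definition deg (v : 'I_n) : nat := #|[set w | adj v w]%SET|.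

(* The path (u, p_1, ..., p_l) has length l = size p. *)
Definition is_path (u : 'I_n) (p : seq 'I_n) : bool :=
  path adj u p && uniq (u :: p).

(* The closing edge is implicit, so the length of the cycle is size c. *)
Definition is_cycle (c : seq 'I_n) : bool :=
  [&& (2 < size c)%N, uniq c & cycle adj c].

Definition induced_edges (B : {set 'I_n}) : graph n :=
  [set e in g | val e \subset B]%SET.

Definition outer_boundary (B : {set 'I_n}) : {set 'I_n} :=
  [set w | (w \notin B) && [exists u in B, adj w u]]%SET.

End Graph.

Definition tree_on (n : nat) (t : graph n) (B : {set 'I_n}) : Prop :=
  [/\ B != finset.set0,
      forall e, e \in t -> val e \subset B,
      {in B &, forall u v, connect (adj t) u v}
    & forall c, ~~ is_cycle t c].

Definition tree_plus_one_on (n : nat) (h : graph n) (B : {set 'I_n}) : Prop :=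
  exists t f : graph n,
    [/\ tree_on t B, (#|f| <= 1)%N & h = (t :|: f)%SET].

Section SpinGlass.
Variable R : realType.

Definition beta_c (k : R) : R := Num.sqrt (2 * pi) / k.

Section Instance.
(* Couplings are total functions on potential edges; every definition below
   reads J only on edges of g. *)
Variables (n : nat) (g : graph n) (J : edge n -> R) (beta : R).

Definition influence (e : edge n) : R :=
  `|1 - expR (beta * J e)| / (1 + expR (beta * J e)).

(* Neighbours w of u correspond to the edges {u, w} of g containing u. *)
Definition agg_influence (u : 'I_n) : R :=
  \sum_(e in g | u \in val e) influence e.

Definition upsilon (u : 'I_n) (p : seq 'I_n) : R :=
  beta * (\sum_(e in g | has (mem (val e)) (u :: p)) `|J e|)
  + \sum_(v <- u :: p) ln (deg g v)%:R.

Variables d eps : R.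

Definition vertex_weight (u : 'I_n) : R :=
  if agg_influence u <= 1 - eps / 2 then 1 - eps / 4 else d * agg_influence u.

Definition path_weight (u : 'I_n) (p : seq 'I_n) : R :=
  \prod_(v <- u :: p) vertex_weight v.

Definition block_vertex (u : 'I_n) : Prop :=
  forall p : seq 'I_n, is_path g u p -> (size p)%:R <= ln n%:R :> R ->
    path_weight u p < 1.

(* The last conjunct says that the graph distance between the cycle and the
   outer boundary of B is at least (ln d) ^+ 5; the distance is infinite when
   no walk joins them. *)
Definition large_block (B : {set 'I_n}) : Prop :=
  [/\ forall w, w \in outer_boundary g B -> block_vertex w,
      forall w, w \in outer_boundary g B -> #|[set u in B | adj g w u]%SET| = 1%N,
      forall c, is_cycle (induced_edges g B) c ->
        (size c)%:R <= 4 * ln n%:R / ln d ^+ 4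
    & forall c, is_cycle (induced_edges g B) c ->
        forall (x : 'I_n) (p : seq 'I_n), x \in c -> path (adj g) x p ->
          last x p \in outer_boundary g B -> ln d ^+ 5 <= (size p)%:R].

Definition block_partition (Bs : {set {set 'I_n}}) : Prop :=
  finset.partition Bs [set: 'I_n]%SET /\
  forall B, B \in Bs ->
    [/\ tree_plus_one_on (induced_edges g B) B,
        (2 <= #|B|)%N -> large_block B
      & #|B| = 1%N -> forall u, u \in B -> block_vertex u].

(* The set of triplets G(d, eps).  In the second condition an isolated vertex
   contributes ln 0 = 0 rather than -oo; it only occurs in paths of length 0,
   for which the inequality holds under either convention when n >= 1. *)
Definition good_instance : Prop :=
  [/\ 0 < beta <= (1 - eps) * beta_c d,
      exists Bs, block_partition Bs,
      forall (u : 'I_n) (p : seq 'I_n), is_path g u p ->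
        (size p)%:R <= ln n%:R / ln d ^+ 4 ->
        upsilon u p <= ln n%:R / ln d ^+ 2
    & forall e, e \in g ->
        n%:R `^ (- (7 / 3)) <= `|J e| <= 10 * Num.sqrt (ln n%:R)].

End Instance.
End SpinGlass.

Local Open Scope classical_set_scope.
Local Open Scope ereal_scope.

Section Random.
Variables (R : realType) (disp : measure_display) (T : measurableType disp).
Variable P : probability T R.

Definition mutually_independent_events (I : finType) (E : I -> set T) : Prop :=
  forall A : {set I},
    P (\bigcap_(i in [set i | i \in A]) E i) = \prod_(i in A) P (E i).

Definition erdos_renyi (n : nat) (p : R) (G : T -> graph n) : Prop :=
  [/\ forall e, measurable [set w | e \in G w],
      forall e, P [set w | e \in G w] = p%:E
    & mutually_independent_events (fun e => [set w | e \in G w])].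

(* Conditionally on G = g, the variables J e for e in g are i.i.d. N(0,1);
   nothing is assumed about J e off the edges of G. *)
Definition gaussian_couplings (n : nat) (G : T -> graph n)
    (J : edge n -> {RV P >-> R}) : Prop :=
  forall (g : graph n) (A : edge n -> set R), (forall e, measurable (A e)) ->
    P ([set w | G w = g] `&` \bigcap_(e in [set e | e \in g]) (J e @^-1` A e))
    = P [set w | G w = g] * \prod_(e in g) normal_prob 0 1 (A e).

End Random.

(* Main.v *)
(** Call a path heavy if its length is at most ln n and its weight is at least 1.
    The core is the union of all heavy paths and of the balls of radius about
    (ln d)^5 around the cycles of length at most 4m, where m is about
    ln n / (ln d)^4. The blocks are the connected components of the core together
    with the remaining single vertices. A minimal chain of overlapping heavy paths
    covers every vertex at most twice, so its union is a connected set carrying an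
    atypically large total influence, and such a set has at most m vertices. Hence
    the blocks are locally small, and as no set of at most 36m vertices spans more
    edges than vertices, every block has at most one cycle, with boundary vertices attached
    by a single edge.

    Probabilistically one needs first-moment bounds for three events: a small set
    spans too many edges; a set A containing |A|-1 edges (as every connected set
    does) has a subset U whose incident edges have too large a sum of |J_e|, or of
    ones; some coupling lies outside the required range. The second event is
    controlled by exponential moments, where E|J_e| = sqrt(2/pi) and
    |tanh(x/2)| <= |x|/2 make beta_c the threshold for the aggregate influence. *)

Require Import Defs.
From mathcomp Require Import all_boot all_order all_algebra zify.
Set Implicit Arguments.
Unset Strict Implicit.
Unset Printing Implicit Defensive.
Import Order.TTheory GRing.Theory Num.Theory.

(** * Connected sets and cycles *)

Section GraphBasics.
Variables (n : nat) (g : graph n).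
Implicit Types (A B T X Y : {set 'I_n}) (u v w x y : 'I_n) (c p : seq 'I_n).

(** The delicate point is that the aggregate influence has to be compared with its mean at the exact
    critical constant, although the union bound over connected sets [A] costs about [ln d] per
    vertex. The comparison is therefore made on the subset [U] of vertices of large influence alone.
    The edges of a spanning tree of [A] are forced and pay a bounded factor each; the other edges at
    [U] have exponential moment at most [expR (a * mu * d * #|U|)], with [mu] only a factor
    [1 + eps / 4] above the mean of [|J e|]. As [(1 - eps) * (1 + eps / 4) <= 1 - 3 * eps / 4], this
    term is cancelled by the amount subtracted in [mass]. What remains, about [ln d] per vertex of
    [A] plus [3 * ln n], is beaten for large [d] by [kap], which is of order [d / ln d] per vertex.
    The graph part sees the randomness only through the smallness of heavy connected sets and the
    lack of excess edges on few vertices. A ball around a short cycle may be large, so connections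
    through it use just the cycle and two paths to it. The bound [36 * m] has to cover four
    connecting sets of [8 * m] vertices. *)

Lemma adjP (h : graph n) u v :
  reflect (exists2 e, e \in h & val e = [set u; v]) (adj h u v).
Proof.
apply: (iffP existsP) => [[e /andP[eh /eqP ev]]|[e eh ev]]; exists e => //.
by rewrite eh ev eqxx.
Qed.

Lemma adj_sym (h : graph n) : symmetric (adj h).
Proof. by move=> u v; rewrite /adj setUC. Qed.

Lemma adj_irr (h : graph n) u : adj h u u = false.
Proof.
by apply/adjP => -[e _ ev]; have := valP e; rewrite /= ev setUid cards1.
Qed.

Lemma edge_ends (e : edge n) : exists u v, u != v /\ val e = [set u; v].
Proof. by have /cards2P[u [v [uv ev]]] := valP e; exists u, v. Qed.

Lemma adj_induced B u v :
  adj (induced_edges g B) u v = [&& adj g u v, u \in B & v \in B].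
Proof.
apply/adjP/and3P => [[e]|[/adjP[e eg ev] uB vB]].
  rewrite inE => /andP[eg] /[swap] ev; rewrite ev subUset !sub1set => /andP[-> ->].
  by split=> //; apply/adjP; exists e.
by exists e; rewrite // inE eg ev subUset !sub1set uB vB.
Qed.

Lemma adj_mono (h h' : graph n) u v : h \subset h' -> adj h u v -> adj h' u v.
Proof. by move=> /subsetP hh' /adjP[e /hh' eh' ev]; apply/adjP; exists e. Qed.

Lemma induced_mono A B : A \subset B -> induced_edges g A \subset induced_edges g B.
Proof.
move=> AB; apply/subsetP => e; rewrite !inE => /andP[-> eA] /=.
exact: subset_trans eA AB.
Qed.

Lemma connect_mono (h h' : graph n) u v :
  h \subset h' -> connect (adj h) u v -> connect (adj h') u v.
Proof. by move=> hh'; apply: connect_sub => a b /(adj_mono hh') /connect1. Qed.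

Lemma connect_adj_sym (h : graph n) : connect_sym (adj h).
Proof. by apply: sym_connect_sym; apply: adj_sym. Qed.

Definition conn T :=
  {in T &, forall u v, connect (adj (induced_edges g T)) u v}.

(** Adjacency counts as touching, so that even disjoint members of one component of the core are
    linked by a chain. *)
Definition touch A B := [exists a in A, exists b in B, (a == b) || adj g a b].

Lemma touchP A B :
  reflect (exists a b, [/\ a \in A, b \in B & a = b \/ adj g a b]) (touch A B).
Proof.
apply: (iffP existsP) => [[a /andP[aA /existsP[b /andP[bB /orP ab]]]]|[a [b [aA bB ab]]]].
  by exists a, b; split=> //; case: ab => [/eqP|]; [left|right].
exists a; rewrite aA; apply/existsP; exists b; rewrite bB /=.
by apply/orP; case: ab => [/eqP|]; [left|right].
Qed.

Lemma touch_sym : symmetric touch.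
Proof.
by move=> A B; apply/touchP/touchP => -[a [b [aA bB [ab|ab]]]]; exists b, a;
  split=> //; [left|right; rewrite adj_sym|left|right; rewrite adj_sym].
Qed.

Lemma touch_common A B x : x \in A -> x \in B -> touch A B.
Proof. by move=> xA xB; apply/touchP; exists x, x; split=> //; left. Qed.

Lemma touchW A B A' B' : A \subset A' -> B \subset B' -> touch A B -> touch A' B'.
Proof.
move=> /subsetP AA' /subsetP BB' /touchP[a [b [aA bB ab]]].
by apply/touchP; exists a, b; split; auto.
Qed.

Lemma conn1 x : conn [set x].
Proof. by move=> u v /set1P-> /set1P->. Qed.

Lemma conn_join A B : conn A -> conn B -> touch A B -> conn (A :|: B).
Proof.
move=> cA cB /touchP[a [b [aA bB ab]]].
have sA := connect_mono (induced_mono (subsetUl A B)).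
have sB := connect_mono (induced_mono (subsetUr A B)).
have cab : connect (adj (induced_edges g (A :|: B))) a b.
  case: ab => [->|ab]; first exact: connect0.
  by apply: connect1; rewrite adj_induced ab !inE aA bB orbT.
have toa x : x \in A :|: B -> connect (adj (induced_edges g (A :|: B))) a x.
  case/setUP => [xA|xB]; first exact/sA/cA.
  by apply: connect_trans cab _; apply/sB/cB.
move=> x y /toa xa /toa; apply: connect_trans.
by rewrite connect_adj_sym.
Qed.

Lemma conn_path u p : path (adj g) u p -> conn [set x in u :: p].
Proof.
elim: p u => [|v p IH] u /=.
  by move=> _; rewrite set_cons set_nil setU0; exact: conn1.
case/andP=> uv /IH vp; rewrite set_cons.
apply: conn_join => //; first exact: conn1.
by apply/touchP; exists u, v; rewrite !inE !eqxx; split=> //; right.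
Qed.

Lemma connect_uniq_path (h : graph n) x y : connect (adj h) x y ->
  exists p, [/\ path (adj h) x p, uniq (x :: p) & last x p = y].
Proof.
by case/connectP=> p xp ->; case: (shortenP xp) => q xq uq _; exists q.
Qed.

Lemma path_induced T x p : path (adj (induced_edges g T)) x p ->
  path (adj g) x p /\ {subset p <= T}.
Proof.
elim: p x => //= y p IH x; rewrite adj_induced => /andP[/and3P[-> _ yT] /IH[-> pT]].
by split=> // z; rewrite inE => /predU1P[->|/pT].
Qed.

Lemma path_in_induced T x p : x \in T -> {subset p <= T} -> path (adj g) x p ->
  path (adj (induced_edges g T)) x p.
Proof.
elim: p x => //= y p IH x xT pT /andP[xy yp].
rewrite adj_induced xy xT pT ?mem_head ?IH ?pT ?mem_head//.
by move=> z zp; rewrite pT// inE zp orbT.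
Qed.

Lemma card_seq_le T p : {subset p <= T} -> uniq p -> (size p <= #|T|)%N.
Proof.
by move=> pT up; rewrite cardE; apply: uniq_leq_size => // z /pT; rewrite mem_enum.
Qed.

Lemma conn_uniq_path T x y : conn T -> x \in T -> y \in T ->
  exists p, [/\ path (adj (induced_edges g T)) x p, uniq (x :: p), last x p = y
    & (size p < #|T|)%N].
Proof.
move=> cT xT yT; have [p [xp up yp]] := connect_uniq_path (cT _ _ xT yT).
exists p; split=> //; have [_ pT] := path_induced xp.
by apply: (@card_seq_le T (x :: p)) => // z; rewrite inE => /predU1P[->|/pT].
Qed.

Lemma cycle_rot_to (h : graph n) c v : is_cycle h c -> v \in c ->
  exists x s, [/\ is_cycle h (v :: x :: s), v :: x :: s =i c,
    x != last x s, adj h v x & adj h v (last x s)].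
Proof.
case/and3P=> sc uc cc vc; have [i s def] := rot_to vc.
have cyc : is_cycle h (v :: s).
  by rewrite /is_cycle -def size_rot sc rot_uniq uc rot_cycle.
have me : v :: s =i c by move=> z; rewrite -def mem_rot.
case: s {def} cyc me => [|x [|y s]] cyc me; [by []|by []|].
exists x, (y :: s); case/and3P: (cyc) => _ uv cv; split=> //.
- move: uv; rewrite !cons_uniq => /and3P[_ xys _].
  by apply: contraNneq xys => -> /=; exact: mem_last.
- by case/andP: cv.
- by move: cv; rewrite /= rcons_path => /and4P[_ _ _]; rewrite adj_sym.
Qed.

Lemma cycle_induced c : is_cycle g c -> is_cycle (induced_edges g [set x in c]) c.
Proof.
case/and3P=> sc uc cc; apply/and3P; split=> //.
case: c sc uc cc => //= x p _ _ xp; apply: path_in_induced => //.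
  by rewrite inE mem_head.
by move=> z; rewrite inE mem_rcons.
Qed.

Lemma cycle_mono (h h' : graph n) c : h \subset h' -> is_cycle h c -> is_cycle h' c.
Proof.
move=> hh' /and3P[sc uc cc]; apply/and3P; split=> //.
by apply: sub_cycle cc => a b; apply: adj_mono.
Qed.

Lemma conn_cycle c : is_cycle g c -> conn [set x in c].
Proof.
case/and3P; case: c => //= x p _ _; rewrite rcons_path => /andP[xp _].
exact: conn_path.
Qed.

Lemma cycle_inducedE T c : is_cycle (induced_edges g T) c ->
  is_cycle g c /\ {subset c <= T}.
Proof.
move=> cc; split.
  by apply: cycle_mono cc; apply/subsetP => e; rewrite inE => /andP[].
case/and3P: cc; case: c => //= x p _ _ /path_induced[_ sT] z zp.
by apply: sT; rewrite mem_rcons.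
Qed.

End GraphBasics.

(** * Distance balls and breadth-first forests *)

Section Balls.
Variables (n : nat) (e : rel 'I_n).
Implicit Types (X : {set 'I_n}).

Definition gball X k : {set 'I_n} :=
  iter k (fun Y => Y :|: [set v | [exists u in Y, e u v]]) X.

Lemma gball_step X k u v : u \in gball X k -> e u v -> v \in gball X k.+1.
Proof.
by move=> uX uv; rewrite /= inE [X in _ || X]inE; apply/orP; right; apply/existsP; exists u; rewrite uX.
Qed.

Lemma gballS X k u : u \in gball X k -> u \in gball X k.+1.
Proof. by move=> uX; rewrite /= inE uX. Qed.

Lemma gball_le X j k u : (j <= k)%N -> u \in gball X j -> u \in gball X k.
Proof.
by move=> jk; rewrite -(subnK jk); elim: (_ - _) => // i IH /IH /gballS.
Qed.

Lemma gballP X k v : reflect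
  (exists u p, [/\ u \in X, path e u p, last u p = v & (size p <= k)%N])
  (v \in gball X k).
Proof.
apply: (iffP idP) => [|[u [p [uX up <- pk]]]].
  elim: k v => [|k IH] v; first by exists v, [::].
  rewrite /= inE => /orP[/IH[u [p [uX up uv pk]]]|].
    by exists u, p; split=> //; exact: leqW.
  rewrite inE => /existsP[w /andP[/IH[u [p [uX up uv pk]]] wv]].
  exists u, (rcons p v); rewrite rcons_path up uv last_rcons size_rcons.
  by split.
apply: gball_le pk _; elim/last_ind: p up => //= p w IH; rewrite rcons_path => /andP[/IH uv pv].
by rewrite last_rcons size_rcons; apply: gball_step uv pv.
Qed.

End Balls.

Section Bfs.
Variables (n : nat) (g : graph n).
Implicit Types (A B T X Y : {set 'I_n}) (u v w x y : 'I_n) (c p : seq 'I_n).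

(** The growth of [dep] along [par] excludes closed parent chains. The roots form an arbitrary set
    [A], so that a forest can be grown from a vertex or around a whole cycle. *)
Definition bfs_forest A B (par : 'I_n -> 'I_n) (dep : 'I_n -> nat) :=
  forall v, v \in B -> v \notin A ->
    [/\ par v \in B, adj g v (par v) & dep v = (dep (par v)).+1].

Lemma bfs_exists A B : A \subset B ->
  (forall v, v \in B -> exists2 a, a \in A & connect (adj (induced_edges g B)) a v) ->
  exists par dep, bfs_forest A B par dep /\
   (forall a p, a \in A -> path (adj (induced_edges g B)) a p ->
     (dep (last a p) <= size p)%N).
Proof.
move=> AB conB; pose e := adj (induced_edges g B).
have reach v : v \in B -> exists k, v \in gball e A k.
  move=> /conB[a aA /connectP[p ap ->]]; exists (size p).
  by apply/gballP; exists a, p.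
(* A reachable vertex is reached by a repetition-free path, hence in fewer than [n] steps, so the
   search over [iota 0 n] finds its distance to [A]; the value 0 is a default for unreachable
   vertices. *)
pose dep v := if pickP (fun k : 'I_n => v \in gball e A k) is Pick k _
  then find (fun k => v \in gball e A k) (iota 0 n) else 0%N.
have depP v k : v \in gball e A k -> v \in gball e A (dep v) /\ (dep v <= k)%N.
  case/gballP => a [p [aA ap pv pk]].
  have [q [aq uq qv]] : exists q, [/\ path e a q, uniq (a :: q) & last a q = v].
    by apply: connect_uniq_path; apply/connectP; exists p.
  have qp : exists2 j, (j < n)%N & v \in gball e A j /\ (j <= k)%N.
    case: (shortenP ap) pv => p' ap' up' sp' pv'; exists (size p').
      have := @card_seq_le n setT (a :: p') (fun _ _ => in_setT _) up'.
      by rewrite cardsT card_ord.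
    split; first by apply/gballP; exists a, p'.
    apply: leq_trans pk; apply: uniq_leq_size => //.
    by case/andP: up'.
  case: qp => j jn [vj jk]; rewrite /dep.
  case: pickP => [i _|/(_ (Ordinal jn))]; last by rewrite /= vj.
  have hs : has (fun k => v \in gball e A k) (iota 0 n).
    by apply/hasP; exists j; rewrite ?mem_iota.
  have fn : (find (fun k => v \in gball e A k) (iota 0 n) < n)%N.
    by move: hs; rewrite has_find size_iota.
  split; first by have := nth_find 0 hs; rewrite nth_iota.
  rewrite leqNgt; apply/negP => kf; have := before_find 0 (leq_ltn_trans jk kf).
  by rewrite nth_iota // add0n vj.
pose par v := odflt v [pick u | e u v && (dep v == (dep u).+1)].
exists par, dep; split => [v vB vA|a p aA ap]; last first.
  by have /depP[] : last a p \in gball e A (size p); first by apply/gballP; exists a, p.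
rewrite /par; case: pickP => [u /andP[]|no].
  by rewrite /e adj_induced => /and3P[uv uB _] /eqP dv; rewrite adj_sym; split.
have [k /depP[vd _]] := reach v vB.
case dv: (dep v) vd => [|m]; first by rewrite /= (negbTE vA).
rewrite /= inE => /orP[/depP[_]|]; first by rewrite dv ltnn.
rewrite inE => /existsP[u /andP[um uv]]; have [du dum] := depP _ _ um.
have /depP[_] := gball_step du uv; rewrite dv ltnS => mu.
by have := no u; rewrite /= uv dv eqSS eqn_leq dum mu.
Qed.

Variables (A B : {set 'I_n}) (par : 'I_n -> 'I_n) (dep : 'I_n -> nat).
Hypothesis forestAB : bfs_forest A B par dep.

Definition parent_edges T : graph n :=
  [set e in g | [exists v in T :\: A, val e == [set v; par v]]].

(** Two distinct vertices with the same pair would be parents of each other, which the depths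
    forbid. *)
Lemma parent_pair_inj : {in B :\: A &, injective (fun v => [set v; par v])}.
Proof.
move=> v w /setDP[vB vA] /setDP[wB wA] /= E.
have [_ _ dv] := forestAB vB vA; have [_ _ dw] := forestAB wB wA.
have : v \in [set w; par w] by rewrite -E !inE eqxx.
have : w \in [set v; par v] by rewrite E !inE eqxx.
rewrite !inE => /orP[/eqP->//|/eqP wp] /orP[/eqP//|/eqP vp].
by move: dv dw; rewrite -wp -vp; lia.
Qed.

Lemma card_parent_edges T : T \subset B -> #|parent_edges T| = #|T :\: A|.
Proof.
move=> /subsetP TB; rewrite -(card_imset _ val_inj).
have /card_in_imset <- : {in T :\: A &, injective (fun v => [set v; par v])}.
  by move=> v w /setDP[/TB vB vA] /setDP[/TB wB wA]; apply: parent_pair_inj; apply/setDP.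
apply: eq_card => E; apply/imsetP/imsetP => [[e]|[v vT ->]].
  by rewrite inE => /andP[_ /existsP[v /andP[vT /eqP ev]]] ->; exists v.
have /setDP[vB vA] := vT; have [_ /adjP[e eg ev] _] := forestAB (TB _ vB) vA.
by exists e; rewrite // inE eg; apply/existsP; exists v; rewrite vT ev eqxx.
Qed.

Definition par_closed T := forall v, v \in T -> v \notin A -> par v \in T.

Lemma par_closedB : par_closed B.
Proof. by move=> v vB vA; case: (forestAB vB vA). Qed.

Lemma parent_edges_induced T : par_closed T -> parent_edges T \subset induced_edges g T.
Proof.
move=> pT; apply/subsetP => e; rewrite !inE => /andP[-> /existsP[v /andP[/setDP[vT vA] /eqP->]]] /=.
by rewrite subUset !sub1set vT pT.
Qed.

Lemma parent_edges_mono T T' : T \subset T' -> parent_edges T \subset parent_edges T'.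
Proof.
move=> TT'; apply/subsetP => e; rewrite !inE => /andP[-> /existsP[v /andP[vT ev]]].
by apply/existsP; exists v; rewrite ev andbT; apply: subsetP vT; exact: setSD.
Qed.

Lemma parent_edges_disj T : [disjoint induced_edges g A & parent_edges T].
Proof.
rewrite -setI_eq0; apply/eqP/setP => e; rewrite !inE; apply/negP.
case/andP => /andP[_ eA] /andP[_ /existsP[v /andP[/setDP[vT vA] /eqP ev]]].
by move: eA; rewrite ev subUset sub1set (negbTE vA).
Qed.

(** Every vertex of [B] outside [A] pays for its own parent edge, and no parent edge lies inside
    [A]. *)
Lemma induced_edges_grow : A \subset B ->
  (#|induced_edges g A| + #|B :\: A| <= #|induced_edges g B|)%N.
Proof.
move=> AB; rewrite -(card_parent_edges (subxx B)).
move: (parent_edges_disj B); rewrite -leq_card_setU => /eqP <-.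
apply: subset_leq_card; rewrite subUset induced_mono// parent_edges_induced//.
exact: par_closedB.
Qed.

(* A vertex of a cycle farthest from A would have its parent as both
   neighbours on the cycle. *)
Lemma forest_cycle (h : graph n) c : is_cycle h c ->
  h \subset induced_edges g A :|: parent_edges B -> {subset c <= A}.
Proof.
move=> cc /subsetP hsub x xc; apply: contraT => xA.
have [v /andP[vc vA] vmax] : exists2 v, (v \in c) && (v \notin A) &
    forall w, (w \in c) && (w \notin A) -> (dep w <= dep v)%N.
  have P0 : (x \in c) && (x \notin A) by rewrite xc.
  by case: (arg_maxnP (P := fun w => (w \in c) && (w \notin A)) dep P0) => v Pv vm; exists v.
have nb y : y \in c -> adj h v y -> y = par v.
  move=> yc /adjP[e /hsub + ev]; rewrite !inE ev subUset sub1set (negbTE vA) andbF /=.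
  case/andP => _ /existsP[w /andP[/setDP[wB wA] /eqP E]].
  have [_ _ dw] := forestAB wB wA.
  have vw : v \in [set w; par w] by rewrite -E !inE eqxx.
  have yw : y \in [set w; par w] by rewrite -E !inE eqxx orbT.
  have wv : w \in [set v; y] by rewrite E !inE eqxx.
  have pv : par w \in [set v; y] by rewrite E !inE eqxx orbT.
  move: vw; rewrite !inE => /orP[/eqP vw|/eqP vw].
    move: yw pv; rewrite -vw !inE => /orP[/eqP yv|/eqP//].
    by rewrite yv orbb => /eqP->.
  have wy : w = y.
    by move: wv; rewrite !inE => /orP[/eqP wv|/eqP//]; move: dw => /eqP; rewrite -vw -wv ltn_eqF.
  by have := vmax w; rewrite wA wy yc -wy => /(_ isT); rewrite dw -vw ltnn.
have [y [s [cyc me yl vy vl]]] := cycle_rot_to cc vc.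
have yc : y \in c by rewrite -me !inE eqxx orbT.
have lc : last y s \in c by rewrite -me inE mem_last orbT.
by move/eqP: yl; case; rewrite (nb _ lc vl); apply: nb.
Qed.

(** The line of ancestors is small when the depth is small, and being closed under parents it
    contains all of its own parent edges. *)
Lemma ancestors x : x \in B ->
  exists T, [/\ T \subset B, x \in T, (#|T| <= (dep x).+1)%N & par_closed T].
Proof.
elim: (dep x) {-2}x (leqnn (dep x)) => [|k IH] {}x dx xB.
  exists [set x]; rewrite sub1set xB inE eqxx cards1; split=> //.
  move=> v /set1P-> xA; have [_ _ E] := forestAB xB xA; move: dx; rewrite E; lia.
have [xA|xA] := boolP (x \in A).
  exists [set x]; rewrite sub1set xB inE eqxx cards1; split=> //.
  by move=> v /set1P->; rewrite xA.
have [pB _ E] := forestAB xB xA; have [|T [TB pT sT cT]] := IH (par x) _ pB; first by lia.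
exists (x |: T); rewrite subUset sub1set xB TB !inE eqxx; split=> //.
  by rewrite cardsU1 E; lia.
move=> v; rewrite !inE => /predU1P[->|vT] vA; first by rewrite pT orbT.
by rewrite cT ?orbT.
Qed.

Lemma par_closed_connect T r : T \subset B -> par_closed T -> A = [set r] ->
  forall v, v \in T -> connect (adj (parent_edges T)) v r.
Proof.
move=> TB pT Ar v; elim: (dep v) {-2}v (leqnn (dep v)) => [|k IH] {}v dv vT.
all: have [vA|vA] := boolP (v \in A); first by move: vA; rewrite Ar inE => /eqP->.
all: have [pB pa E] := forestAB (subsetP TB _ vT) vA.
  by move: dv; rewrite E.
apply: connect_trans (IH (par v) _ (pT _ vT vA)); last by lia.
apply: connect1; case/adjP: pa => e eg ev; apply/adjP; exists e => //.
by rewrite inE eg; apply/existsP; exists v; rewrite !inE vA vT ev eqxx.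
Qed.

End Bfs.

(** * Connected sets with few excess edges *)

Section SmallExcess.
Variables (n : nat) (g : graph n).
Implicit Types (A B T X Y : {set 'I_n}) (u v w x y : 'I_n) (c p : seq 'I_n).

Lemma bfs_root B r : conn g B -> r \in B ->
  exists par dep, bfs_forest g [set r] B par dep /\
   (forall p, path (adj (induced_edges g B)) r p -> (dep (last r p) <= size p)%N).
Proof.
move=> cB rB; have [||par [dep [f d]]] := @bfs_exists n g [set r] B.
- by rewrite sub1set.
- by move=> v vB; exists r; rewrite ?inE//; apply: cB.
- by exists par, dep; split=> // p; apply: d; rewrite inE.
Qed.

Lemma conn_edges B : conn g B -> (#|B| <= #|induced_edges g B|.+1)%N.
Proof.
have [->|[r rB] cB] := set_0Vmem B; first by rewrite cards0.
have [par [dep [f _]]] := bfs_root cB rB.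
have := induced_edges_grow f; rewrite sub1set rB => /(_ isT).
by have := cardsD1 r B; rewrite rB; lia.
Qed.

(** With fewer edges a breadth-first tree would exhaust the induced edges, and [forest_cycle] would
    confine the cycle to the root. *)
Lemma cycle_edges c : is_cycle g c -> (#|[set x in c]| <= #|induced_edges g [set x in c]|)%N.
Proof.
move=> cc; set X := [set x in c]; have cX := conn_cycle cc.
have [r rc] : exists r, r \in c by case/and3P: cc; case: c {X cX} => // r c; exists r; rewrite mem_head.
have rX : r \in X by rewrite inE.
have [par [dep [f _]]] := bfs_root cX rX.
rewrite leqNgt; apply/negP => lt.
have pc := card_parent_edges f (subxx X).
have := cardsD1 r X; rewrite rX -pc => cD.
have sub := parent_edges_induced g (par_closedB f).
have E : parent_edges g [set r] par X = induced_edges g X.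
  by apply/eqP; rewrite eqEcard sub /= -ltnS; apply: leq_trans lt _; rewrite cD add1n.
have sr : {subset c <= [set r]}.
  by apply: (forest_cycle f (cycle_induced cc)); rewrite E subsetUr.
have /and3P[sc uc _] := cc.
by have := card_seq_le sr uc; rewrite cards1; lia.
Qed.

Lemma conn_cycle_edges T c : conn g T -> is_cycle g c -> {subset c <= T} ->
  (#|T| <= #|induced_edges g T|)%N.
Proof.
move=> cT cc cTs; have XT : [set x in c] \subset T.
  by apply/subsetP => x; rewrite inE => /cTs.
have [r rc] : exists r, r \in c by case/and3P: cc; case: c {cTs XT} => // r c; exists r; rewrite mem_head.
have [//||par [dep [f _]]] := @bfs_exists n g [set x in c] T.
  by move=> v vT; exists r; [rewrite inE|apply: cT => //; exact: cTs].
apply: leq_trans (induced_edges_grow f XT).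
by rewrite -(cardsID [set x in c] T) (setIidPr XT) leq_add2r; exact: cycle_edges.
Qed.

(** The edges induced on the first cycle and the parent edges of a forest grown around it already
    number at least [#|T|]. They are therefore all the edges of [T], and [forest_cycle] confines any
    other cycle to the first. *)
Lemma cycle_unique T c c' : conn g T -> (#|induced_edges g T| <= #|T|)%N ->
  is_cycle g c -> {subset c <= T} -> is_cycle g c' -> {subset c' <= T} ->
  {subset c' <= c}.
Proof.
move=> cT eT cc cTs cc' cTs'; set X := [set x in c].
have XT : X \subset T by apply/subsetP => x; rewrite inE => /cTs.
have [r rc] : exists r, r \in c by case/and3P: cc; case: c {cTs X XT} => // r c; exists r; rewrite mem_head.
have [//||par [dep [f _]]] := @bfs_exists n g X T.
  by move=> v vT; exists r; [rewrite inE|apply: cT => //; exact: cTs].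
have pc := card_parent_edges f (subxx T).
have Xe := cycle_edges cc; rewrite -/X in Xe.
have cD := cardsID X T; rewrite (setIidPr XT) in cD.
have sub : induced_edges g X :|: parent_edges g X par T \subset induced_edges g T.
  by rewrite subUset induced_mono// (parent_edges_induced g (par_closedB f)).
have cU : #|induced_edges g X :|: parent_edges g X par T| =
    (#|induced_edges g X| + #|parent_edges g X par T|)%N.
  by apply/eqP; rewrite leq_card_setU parent_edges_disj.
have E : induced_edges g X :|: parent_edges g X par T = induced_edges g T.
  by apply/eqP; rewrite eqEcard sub /= cU pc; apply: leq_trans eT _; rewrite -cD leq_add2r.
have X'T : [set x in c'] \subset T by apply/subsetP => x; rewrite inE => /cTs'.
have cT' := cycle_mono (induced_mono g X'T) (cycle_induced cc').
have s : {subset c' <= X} by apply: (forest_cycle f cT'); rewrite E.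
by move=> x /s; rewrite inE.
Qed.

Section Bounded.
Variables (B : {set 'I_n}) (r : 'I_n) (D : nat).
Hypotheses (cB : conn g B) (rB : r \in B).
Hypothesis boundB : forall v, v \in B ->
  exists T, [/\ conn g T, T \subset B, r \in T, v \in T & (#|T| <= D)%N].

Lemma bfs_bounded : exists par dep, bfs_forest g [set r] B par dep /\
  forall v, v \in B -> (dep v < D)%N.
Proof.
have [par [dep [f d]]] := bfs_root cB rB; exists par, dep; split=> // v vB.
have [T [cT TB rT vT TD]] := boundB vB.
have [p [rp _ <- sp]] := conn_uniq_path cT rT vT.
apply: leq_ltn_trans (leq_trans sp TD); apply: d.
have [rp' pT] := path_induced rp; apply: path_in_induced => // x /pT.
exact: (subsetP TB).
Qed.

(** Two edges outside a breadth-first tree are kept together with the ancestor lines of their four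
    endpoints. Each line has at most [D] vertices and brings its tree edges along, so the excess
    survives on [4 * D] vertices. *)
Lemma excess_extract : (#|B| < #|induced_edges g B|)%N ->
  exists T, (#|T| <= 4 * D)%N /\ (#|T| < #|induced_edges g T|)%N.
Proof.
move=> lt; have [par [dep [f d]]] := bfs_bounded.
pose PE := parent_edges g [set r] par.
have sub : PE B \subset induced_edges g B by apply: parent_edges_induced; apply: par_closedB f.
have cPE := card_parent_edges f (subxx B).
have cD := cardsD1 r B; rewrite rB in cD.
have : (1 < #|induced_edges g B :\: PE B|)%N.
  have E := cardsID (PE B) (induced_edges g B); rewrite (setIidPr sub) {1}/PE cPE in E.
  by rewrite -(ltn_add2l #|B :\ r|) E addn1; move: cD; rewrite add1n => <-.
case/card_gt1P => e1 [e2 [e1B e2B e12]].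
have anc (e : edge n) : e \in induced_edges g B :\: PE B ->
    exists T, [/\ T \subset B, val e \subset T, (#|T| <= 2 * D)%N & par_closed [set r] par T].
  rewrite !inE => /and3P[_ _]; have [x [y [_ ->]]] := edge_ends e.
  rewrite subUset !sub1set => /andP[xB yB].
  have [Tx [TxB xT cx px]] := ancestors f xB; have [Ty [TyB yT cy py]] := ancestors f yB.
  exists (Tx :|: Ty); rewrite !subUset !sub1set TxB TyB !inE xT yT orbT; split=> //.
    apply: leq_trans (leq_card_setU Tx Ty) _; rewrite mul2n -addnn leq_add//.
      exact: leq_trans cx (d _ xB).
    exact: leq_trans cy (d _ yB).
  by move=> v /setUP[vT|vT] vA; apply/setUP; [left; exact: px|right; exact: py].
have [T1 [T1B e1T c1 p1]] := anc _ e1B; have [T2 [T2B e2T c2 p2]] := anc _ e2B.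
exists (T1 :|: T2); split.
  apply: leq_trans (leq_card_setU T1 T2) _.
  by rewrite (_ : 4 = 2 + 2)%N// mulnDl leq_add.
set T := T1 :|: T2; have TB : T \subset B by rewrite subUset T1B.
have pT : par_closed [set r] par T.
  by move=> v /setUP[vT|vT] vA; apply/setUP; [left; exact: p1|right; exact: p2].
have cP := card_parent_edges f TB; have cT := cardsD1 r T.
have : [set e1; e2] :|: parent_edges g [set r] par T \subset induced_edges g T.
  rewrite !subUset !sub1set parent_edges_induced// andbT.
  move: e1B e2B; rewrite !inE => /and3P[_ -> _] /and3P[_ -> _] /=.
  by rewrite (subset_trans e1T) ?subsetUl// (subset_trans e2T) ?subsetUr.
move/subset_leq_card; rewrite cardsU cards2 e12.
have -> : [set e1; e2] :&: parent_edges g [set r] par T = set0.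
  apply/setP => e; rewrite in_set0; apply/negP => /setIP[/set2P eE].
  move/(subsetP (parent_edges_mono g [set r] par TB)) => eP.
  by case: eE => E; [case/setDP: e1B|case/setDP: e2B]; rewrite -E /PE eP.
rewrite cards0 subn0 cP => h; apply: leq_trans h; rewrite cT -addSn leq_add2r.
by case: (r \in T).
Qed.

(** An edge outside the breadth-first tree closes the tree path between its ends, which runs inside
    two ancestor lines. *)
Lemma short_cycle_extract c : is_cycle g c -> {subset c <= B} ->
  exists c', [/\ is_cycle g c', {subset c' <= B} & (size c' <= 2 * D)%N].
Proof.
move=> cc cs; have [par [dep [f d]]] := bfs_bounded.
pose PE := parent_edges g [set r] par.
have [sub|nsub] := boolP (induced_edges g B \subset PE B).
  have XB : [set x in c] \subset B by apply/subsetP => x; rewrite inE => /cs.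
  have cB' := cycle_mono (induced_mono g XB) (cycle_induced cc).
  have sr : {subset c <= [set r]}.
    by apply: (forest_cycle f cB'); apply: subset_trans sub (subsetUr _ _).
  have /and3P[sc uc _] := cc.
  by have := card_seq_le sr uc; rewrite cards1; lia.
case/subsetPn: nsub => e eB eP; have [x [y [xy ev]]] := edge_ends e.
move: (eB); rewrite inE ev subUset !sub1set => /and3P[eg xB yB].
have [Tx [TxB xT cx px]] := ancestors f xB; have [Ty [TyB yT cy py]] := ancestors f yB.
pose T := Tx :|: Ty; have TB : T \subset B by rewrite subUset TxB.
have pT : par_closed [set r] par T.
  by move=> v /setUP[vT|vT] vA; apply/setUP; [left; exact: px|right; exact: py].
have toR v : v \in T -> connect (adj (PE T)) v r by apply: (par_closed_connect f TB pT (erefl _)).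
have : connect (adj (PE T)) x y.
  apply: connect_trans (toR x _) _; first by rewrite inE xT.
  by rewrite connect_adj_sym; apply: toR; rewrite inE yT orbT.
case/connect_uniq_path => p [xp up py'].
have xp1 : path (adj (induced_edges g T)) x p.
  by apply: sub_path xp => a b; apply: adj_mono; apply: parent_edges_induced.
have [xp2 pTs] := path_induced xp1.
have xpT : {subset x :: p <= T}.
  by move=> z; rewrite inE => /predU1P[->|/pTs//]; rewrite inE xT.
exists (x :: p); split.
- apply/and3P; split=> //; last first.
    by rewrite /= rcons_path xp2 py'; apply/adjP; exists e; rewrite // ev setUC.
  (* A tree path with a single step would be [e] itself, which is not a parent edge; so the closed
     path has at least three vertices. *)
  case: p xp up py' {xp1 xp2 pTs xpT} => [|z [|//]] /=.
    by move=> _ _ E; rewrite E eqxx in xy.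
  rewrite andbT => /adjP[e' e'P e'v] _ zy.
  have E : e' = e by apply: val_inj; rewrite /= e'v ev zy.
  by case/negP: eP; rewrite -E; exact: (subsetP (parent_edges_mono g [set r] par TB)).
- by move=> z /xpT; apply: (subsetP TB).
- apply: leq_trans (card_seq_le xpT up) _.
  apply: leq_trans (leq_card_setU Tx Ty) _; rewrite mul2n -addnn leq_add//.
    exact: leq_trans cx (d _ xB).
  exact: leq_trans cy (d _ yB).
Qed.

End Bounded.

Lemma conn_tree_plus_one B r : conn g B -> r \in B ->
  (#|induced_edges g B| <= #|B|)%N -> tree_plus_one_on (induced_edges g B) B.
Proof.
move=> cB rB eB; have [par [dep [f d]]] := bfs_root cB rB.
pose PE := parent_edges g [set r] par B.
have pcl := par_closedB f.
have sub : PE \subset induced_edges g B by apply: parent_edges_induced.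
exists PE, (induced_edges g B :\: PE); split.
- split.
  + by apply/set0Pn; exists r.
  + by move=> e /(subsetP sub); rewrite inE => /andP[].
  + move=> u v uB vB; have toR := par_closed_connect f (subxx B) pcl (erefl _).
    by apply: connect_trans (toR u uB) _; rewrite connect_adj_sym; apply: toR.
  + move=> c; apply/negP => cc.
    have sr : {subset c <= [set r]} by apply: (forest_cycle f cc); exact: subsetUr.
    have /and3P[sc uc _] := cc.
    by have := card_seq_le sr uc; rewrite cards1; lia.
- have := cardsID PE (induced_edges g B); rewrite (setIidPr sub) /PE (card_parent_edges f (subxx B)).
  by have := cardsD1 r B; rewrite rB; lia.
- by rewrite -[LHS](setID _ PE) (setIidPr sub).
Qed.

End SmallExcess.

(** * Blocks around heavy paths and short cycles *)

Section Chains.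
Variables (n : nat) (g : graph n).
Implicit Types (A B T X Y : {set 'I_n}) (l : seq {set 'I_n}).
Local Notation touch := (touch g).

(** These are the induced paths of the touching relation, except that the touching of consecutive
    members is recorded separately by [path]. *)
Fixpoint ichain l : bool :=
  if l is A :: l' then all (fun B => ~~ touch A B) (behead l') && ichain l' else true.

Lemma ichain_cat l1 l2 : ichain (l1 ++ l2) -> ichain l1 /\ ichain l2.
Proof.
elim: l1 => //= A [|B l1] IH /andP[h] /IH[-> ->]; split=> //.
by move: h; rewrite /= all_cat => /andP[->].
Qed.

Lemma ichain_count v l : ichain l -> (count (fun A : {set 'I_n} => v \in A) l <= 2)%N.
Proof.
elim: l => //= A [|B l] IH /andP[h /IH c]; first by case: (v \in A).
have [vA|//] := boolP (v \in A); rewrite /= add1n ltnS.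
suff -> : count (fun A : {set 'I_n} => v \in A) l = 0%N by rewrite addn0 leq_b1.
apply/eqP; rewrite -leqn0 leqNgt -has_count; apply/hasPn => C Cl.
by apply: contra (allP h _ Cl) => vC; exact: touch_common vA vC.
Qed.

(** Greedy shortcut: from [A] jump to the last member that touches it, found by searching the
    reversed list, and recurse on the rest. *)
Lemma ichain_exists A l : path touch A l -> uniq (A :: l) ->
  exists l', [/\ subseq l' l, path touch A l', last A l' = last A l & ichain (A :: l')].
Proof.
move: {2}(size l) (leqnn (size l)) => k.
elim: k A l => [|k IH] A l; first by rewrite leqn0 size_eq0 => /eqP-> _ _; exists [::].
move=> lk Al ul.
have [->|l0] := eqVneq l [::]; first by exists [::].
have hasl : has (touch A) (rev l).
  by rewrite has_rev; case: l l0 Al {lk ul} => //= B l _ /andP[->].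
have [B [l1 [l2 [El tB nt]]]] : exists B l1 l2,
    [/\ l = l1 ++ B :: l2, touch A B & all (fun C => ~~ touch A C) l2].
  pose i := find (touch A) (rev l); have iP : (i < size (rev l))%N by rewrite -has_find.
  exists (nth A (rev l) i), (rev (drop i.+1 (rev l))), (rev (take i (rev l))); split.
  - rewrite -rev_rcons -rev_cat cat_rcons -(drop_nth A iP) ?cat_take_drop ?revK//.
  - exact: nth_find.
  - rewrite all_rev; apply/allP => C /(nthP A)[j]; rewrite size_take iP => ji <-.
    by rewrite nth_take// before_find.
have [|||l' [sl' pl' el' il']] := IH B l2.
- by move: lk; rewrite El size_cat /=; lia.
- by move: Al; rewrite El cat_path /= => /and3P[].
- by move: ul; rewrite El -cat_cons cat_uniq => /and3P[].
exists (B :: l'); split.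
- rewrite El; apply: subseq_trans (suffix_subseq _ _).
  by rewrite /= eqxx.
- by rewrite /= tB.
- by rewrite El last_cat /= el'.
- rewrite /= in il' *; rewrite il' andbT; apply/allP => C Cl.
  by apply: (allP nt); exact: (mem_subseq sl').
Qed.

Definition chain_union l : {set 'I_n} := \bigcup_(A <- l) A.

Lemma chain_union_cons A l : chain_union (A :: l) = A :|: chain_union l.
Proof. by rewrite /chain_union big_cons. Qed.

Lemma in_chain_union x A l : A \in l -> x \in A -> x \in chain_union l.
Proof.
elim: l => // B l IH; rewrite inE chain_union_cons => /predU1P[->|/IH h] xA; rewrite inE ?xA//.
by rewrite h ?orbT.
Qed.

Lemma chain_unionP x l : x \in chain_union l -> exists2 A, A \in l & x \in A.
Proof.
elim: l => [|B l IH]; first by rewrite /chain_union big_nil inE.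
rewrite chain_union_cons inE => /orP[xB|/IH[A Al xA]]; first by exists B; rewrite ?mem_head.
by exists A; rewrite // inE Al orbT.
Qed.

Lemma conn_chain_union A l : path touch A l -> {in A :: l, forall C, conn g C} ->
  conn g (chain_union (A :: l)).
Proof.
elim: l A => [|B l IH] A /=.
  by move=> _ h; rewrite /chain_union big_seq1; apply: h; rewrite mem_head.
case/andP=> AB Bl h; rewrite chain_union_cons; apply: conn_join.
- by apply: h; rewrite mem_head.
- by apply: IH => // C Cl; apply: h; rewrite inE Cl orbT.
- by apply: touchW AB => //; rewrite chain_union_cons subsetUl.
Qed.

End Chains.

Section ChainWeight.
Local Open Scope ring_scope.
Variables (F : realFieldType) (n : nat) (g : graph n) (s : 'I_n -> F) (kap : F).
Hypothesis s_ge0 : forall v, 0 <= s v.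
Hypothesis kap_ge0 : 0 <= kap.
Implicit Types (l : seq {set 'I_n}).

(* The factor 2 appears because a vertex lies in at most two members of the chain. *)
Lemma chain_weight l : ichain g l ->
  {in l, forall P : {set 'I_n}, kap * #|P|%:R <= \sum_(v in P) s v} ->
  kap * #|chain_union l|%:R <= 2 * \sum_(v in chain_union l) s v.
Proof.
move=> il hl.
have card_le : (#|chain_union l| <= \sum_(P <- l) #|P|)%N.
  elim: (l) => [|P l' IH]; first by rewrite /chain_union !big_nil cards0.
  rewrite chain_union_cons big_cons; apply: leq_trans (leq_card_setU _ _) _.
  by rewrite leq_add2l.
apply: (@le_trans _ _ (\sum_(P <- l) \sum_(v in P) s v)).
  apply: (@le_trans _ _ (\sum_(P <- l) kap * #|P|%:R)).
    by rewrite -mulr_sumr -natr_sum ler_wpM2l// ler_nat.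
  by rewrite big_seq [leRHS]big_seq; apply: ler_sum.
under eq_bigr do rewrite big_mkcond /=.
rewrite exchange_big mulr_sumr [leRHS]big_mkcond /=; apply: ler_sum => v _.
rewrite -big_mkcond /= big_const_seq iter_addr_0.
have [vl|vl] := boolP (v \in chain_union l).
  by rewrite -[leLHS]mulr_natl ler_wpM2r// ler_nat (ichain_count _ il).
suff -> : count (fun P : {set 'I_n} => v \in P) l = 0%N by rewrite mulr0n.
apply/eqP; rewrite -leqn0 leqNgt -has_count; apply/hasPn => P Pl.
by apply: contra vl; exact: in_chain_union.
Qed.

End ChainWeight.

Lemma split_first (T : Type) (a : pred T) (s : seq T) : ~~ all a s ->
  exists s1 x s2, [/\ s = s1 ++ x :: s2, all a s1 & ~~ a x].
Proof.
elim: s => //= x s IH; have [ax /IH[s1 [y [s2 [-> as1 ay]]]]|ax _] := boolP (a x).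
  by exists (x :: s1), y, s2; rewrite /= ax.
by exists [::], x, s.
Qed.

Lemma cardU_le (T : finType) (A B : {set T}) a b :
  (#|A| <= a -> #|B| <= b -> #|A :|: B| <= a + b)%N.
Proof. by move=> Aa Bb; apply: leq_trans (leq_card_setU A B) _; exact: leq_add. Qed.

Lemma leqS4 k : (0 < k -> k.+1 <= 4 * k)%N. Proof. lia. Qed.
Lemma leqS36 k : (0 < k -> (8 * k).+1 <= 36 * k)%N. Proof. lia. Qed.
Lemma leq32_36 k : (4 * (8 * k) <= 36 * k)%N. Proof. lia. Qed.
Lemma leq_mul8 k : (k <= 8 * k)%N. Proof. lia. Qed.
Lemma leq1_36 k : (0 < k -> 1 <= 36 * k)%N. Proof. lia. Qed.
Lemma leq24 k : (2 * k <= 4 * k)%N. Proof. lia. Qed.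
Lemma leq_two_balls k : (4 * k + k + (k + (k + 4 * k)) <= 36 * k)%N. Proof. lia. Qed.
Lemma leq_one_ball k : (k + k + (4 * k + (k + k)) <= 8 * k)%N. Proof. lia. Qed.

(** * The core and its components *)

Section Blocks.
Local Open Scope ring_scope.
Variables (F : realFieldType) (n : nat) (g : graph n) (s : 'I_n -> F) (kap : F).
Variables (m r : nat) (Ps : {set {set 'I_n}}).
Hypothesis s_ge0 : forall v, 0 <= s v.
Hypothesis kap_ge0 : 0 <= kap.
Hypothesis r_lt : (r < m)%N.
Hypothesis Ps_conn : forall P, P \in Ps -> conn g P.
Hypothesis Ps_ge2 : forall P, P \in Ps -> (1 < #|P|)%N.
Hypothesis Ps_heavy : forall P, P \in Ps -> kap * #|P|%:R <= \sum_(v in P) s v.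
Hypothesis heavy_small : forall T, conn g T -> T != finset.set0 ->
  kap * #|T|%:R <= 2 * \sum_(v in T) s v -> (#|T| <= m)%N.
Hypothesis excess0 : forall T : {set 'I_n}, (#|T| <= 36 * m)%N ->
  (#|induced_edges g T| <= #|T|)%N.

Local Notation touch := (touch g).
Local Notation conn := (conn g).
Implicit Types (A B T X Y W : {set 'I_n}) (l : seq {set 'I_n}) (x y w u v : 'I_n).

(** Tuples make the existence of a cycle decidable; a cycle has no repetition, so its length is the
    size of its vertex set. *)
Definition short_cycle_sets : {set {set 'I_n}} :=
  [set X : {set 'I_n} | (#|X| <= 4 * m)%N &&
    [exists t : #|X|.-tuple 'I_n, is_cycle g t && (X == [set x in t])]].

Lemma short_cycleP X : reflect
  (exists c, [/\ is_cycle g c, X = [set x in c] & (size c <= 4 * m)%N])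
  (X \in short_cycle_sets).
Proof.
rewrite inE; apply: (iffP andP) => [[Xm /existsP[t /andP[ct /eqP E]]]|[c [cc E cm]]].
  by exists t; rewrite size_tuple.
have /and3P[_ uc _] := cc.
have sc : size c == #|X| by rewrite E cardsE (card_uniqP uc).
split; first by rewrite -(eqP sc).
by apply/existsP; exists (Tuple sc); rewrite /= cc -E eqxx.
Qed.

Local Notation ball X := (gball (adj g) X r).

Definition members : {set {set 'I_n}} := Ps :|: [set ball X | X : {set 'I_n} in short_cycle_sets].

Definition core : {set 'I_n} := cover members.

Lemma coreP x : reflect (exists2 A, A \in members & x \in A) (x \in core).
Proof. exact: bigcupP. Qed.

Lemma mem_core A : A \in members -> A \subset core.
Proof. by move=> Am; apply/subsetP => x xA; apply/coreP; exists A. Qed.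

Lemma ball_member X : X \in short_cycle_sets -> ball X \in members.
Proof. by move=> Xs; rewrite inE; apply/orP; right; apply: imset_f. Qed.

Lemma memberP A : A \in members -> A \notin Ps ->
  exists2 X, X \in short_cycle_sets & A = ball X.
Proof. by case/setUP => [->//|/imsetP[X Xs ->] _]; exists X. Qed.

Lemma sub_ball X : X \subset ball X.
Proof. by apply/subsetP => x xX; apply: (@gball_le _ _ X 0). Qed.

Lemma short_conn X : X \in short_cycle_sets -> conn X.
Proof. by case/short_cycleP => c [cc -> _]; exact: conn_cycle. Qed.

Lemma short_neq0 X : X \in short_cycle_sets -> exists x, x \in X.
Proof.
case/short_cycleP => c [/and3P[+ _ _] -> _]; case: c => // x c _.
by exists x; rewrite inE mem_head.
Qed.

(** A walk from [X] to [b] stays in the ball because its prefixes are shorter; it has at most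
    [r.+1 <= m] vertices. *)
Lemma ball_spoke X b : b \in ball X ->
  exists W, [/\ conn W, W \subset ball X, b \in W, (#|W| <= m)%N & touch W X].
Proof.
case/gballP => u [p [uX up pb pr]]; exists [set x in u :: p]; split.
- exact: conn_path.
- apply/subsetP => z; rewrite inE => /splitPl zp; case: zp up pr => p1 p2 <-.
  rewrite cat_path size_cat => /andP[up1 _] pr; apply/gballP; exists u, p1; split=> //.
  by apply: leq_trans pr; exact: leq_addr.
- by rewrite inE -pb mem_last.
- by rewrite cardsE; apply: leq_trans (card_size _) _; apply: leq_trans r_lt.
- by apply: touch_common uX; rewrite inE mem_head.
Qed.

Lemma ball_attach X T : touch T (ball X) ->
  exists W, [/\ conn W, W \subset ball X, (#|W| <= m)%N, touch T W & touch W X].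
Proof.
case/touchP => a [b [aT bB ab]]; have [W [cW WB bW Wm WX]] := ball_spoke bB.
by exists W; split=> //; apply/touchP; exists a, b.
Qed.

Lemma conn_ball X : X \in short_cycle_sets -> conn (ball X).
Proof.
move=> Xs; have [x0 x0X] := short_neq0 Xs.
have to0 b : b \in ball X -> connect (adj (induced_edges g (ball X))) b x0.
  move=> /ball_spoke[W [cW WB bW _ WX]].
  have sub : W :|: X \subset ball X by rewrite subUset WB sub_ball.
  apply: (connect_mono (induced_mono g sub)); apply: conn_join => //.
  - exact: short_conn.
  - by rewrite inE bW.
  - by rewrite inE x0X orbT.
move=> b b' /to0 h /to0 h'; apply: connect_trans h _.
by rewrite connect_adj_sym.
Qed.

Lemma member_conn A : A \in members -> conn A.
Proof. by case/setUP => [/Ps_conn//|/imsetP[X Xs ->]]; exact: conn_ball. Qed.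

Lemma member_ge2 A : A \in members -> (1 < #|A|)%N.
Proof.
case/setUP => [/Ps_ge2//|/imsetP[X Xs ->]].
apply: leq_trans (subset_leq_card (sub_ball X)).
case/short_cycleP: Xs => c [/and3P[sc uc _] -> _].
by rewrite cardsE (card_uniqP uc) ltnW.
Qed.

(** The number of paths in the run is irrelevant: by [chain_weight] the union satisfies the weight
    condition of [heavy_small] as a whole. *)
Lemma segment_small A l : {subset A :: l <= Ps} -> path touch A l -> ichain g (A :: l) ->
  [/\ conn (chain_union (A :: l)), chain_union (A :: l) \subset core & (#|chain_union (A :: l)| <= m)%N].
Proof.
move=> sP pl il; have cU : conn (chain_union (A :: l)).
  by apply: conn_chain_union => // C /sP /Ps_conn.
split=> //.
  apply/subsetP => x /chain_unionP[C /sP CP xC]; apply/coreP; exists C => //.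
  by rewrite inE CP.
apply: heavy_small => //; last by apply: (chain_weight s_ge0 kap_ge0 il) => C /sP /Ps_heavy.
have /Ps_ge2/ltnW/card_gt0P[x xA] : A \in Ps by apply: sP; rewrite mem_head.
by apply/set0Pn; exists x; rewrite chain_union_cons inE xA.
Qed.

(** The two cycles, a spoke from each and [T] form a connected set of at most [11 * m] vertices, so
    [excess0] and [cycle_unique] apply to it. *)
Lemma two_balls X X' T : X \in short_cycle_sets -> X' \in short_cycle_sets ->
  conn T -> (#|T| <= m)%N -> touch T (ball X) -> touch T (ball X') -> X = X'.
Proof.
move=> Xs Xs' cT Tm /ball_attach[W [cW _ Wm TW WX]] /ball_attach[W' [cW' _ Wm' TW' WX']].
have cX := short_conn Xs; have cX' := short_conn Xs'.
pose U := (X :|: W) :|: (T :|: (W' :|: X')).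
have cU : conn U.
  apply: conn_join.
  - by apply: conn_join => //; rewrite touch_sym.
  - apply: conn_join => //; first by apply: conn_join.
    by apply: touchW TW' => //; exact: subsetUl.
  - by rewrite touch_sym; apply: touchW TW; [exact: subsetUl|exact: subsetUr].
have [c [cc Ec cm]] := short_cycleP _ Xs; have [c' [cc' Ec' cm']] := short_cycleP _ Xs'.
have Xm : (#|X| <= 4 * m)%N by move: Xs; rewrite inE => /andP[].
have Xm' : (#|X'| <= 4 * m)%N by move: Xs'; rewrite inE => /andP[].
have Um : (#|U| <= 36 * m)%N.
  apply: leq_trans (cardU_le (cardU_le Xm Wm) (cardU_le Tm (cardU_le Wm' Xm'))) (leq_two_balls m).
have cU1 : {subset c <= U} by move=> x xc; rewrite !inE Ec inE xc.
have cU2 : {subset c' <= U} by move=> x xc; rewrite !inE Ec' inE xc !orbT.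
apply/setP => x; rewrite Ec Ec' !inE; apply/idP/idP.
  exact: (cycle_unique cU (excess0 Um) cc' cU2 cc cU1).
exact: (cycle_unique cU (excess0 Um) cc cU1 cc' cU2).
Qed.

Local Notation econn := (connect (adj (induced_edges g core))).

Lemma chain_link x y A : A \in members -> x \in A -> econn x y ->
  exists l, [/\ path touch A l, {subset A :: l <= members} & y \in last A l].
Proof.
move=> Am xA /connectP[p xp ->]; elim: p x A Am xA xp => [|z p IH] x A Am xA /=.
  by move=> _; exists [::]; split=> // C; rewrite inE => /eqP->.
rewrite adj_induced => /andP[/and3P[xz _ /coreP[C Cm zC]] zp].
have [l [pl sl yl]] := IH z C Cm zC zp.
exists (C :: l); split=> //=.
  by rewrite pl andbT; apply/touchP; exists x, z; split=> //; right.
by move=> D; rewrite inE => /predU1P[->//|/sl].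
Qed.

Lemma chain_link_induced x y : x \in core -> econn x y ->
  exists A l, [/\ path touch A l, {subset A :: l <= members}, x \in A, y \in last A l
    & ichain g (A :: l) /\ uniq (A :: l)].
Proof.
case/coreP => A Am xA /(chain_link Am xA)[l [pl sl yl]]; exists A.
case: (shortenP pl) yl sl => l1 pl1 ul1 sl1 yl sl.
have [l2 [ss pl2 el2 il2]] := ichain_exists pl1 ul1.
exists l2; split=> //.
- move=> C; rewrite inE => /predU1P[->|/(mem_subseq ss)/sl1 Cl]; first by rewrite sl ?mem_head.
  by apply: sl; rewrite inE Cl orbT.
- by rewrite el2.
- split=> //; apply: subseq_uniq ul1.
  by rewrite /= eqxx.
Qed.

(** A reduced chain has at most one ball. Without a ball its union is small by [segment_small]. With
    one, the ball is replaced by its cycle and two spokes, and with the runs of heavy paths on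
    either side this makes [m + m + 4 * m + m + m] vertices. *)
Lemma core_link x y : x \in core -> econn x y ->
  exists T, [/\ conn T, T \subset core, x \in T, y \in T &
    (#|T| <= m)%N \/ ((#|T| <= 8 * m)%N /\ exists2 X, X \in short_cycle_sets & X \subset T)].
Proof.
move=> xS /(chain_link_induced xS)[A [l [pl sl xA yl [il ul]]]].
have [aP|] := boolP (all (mem Ps) (A :: l)).
  have [|||cT TS Tm] := @segment_small A l => //; first by move=> C /(allP aP).
  exists (chain_union (A :: l)); split=> //; last by left.
    by apply: in_chain_union xA; rewrite mem_head.
  by apply: in_chain_union yl; exact: mem_last.
case/split_first => L1 [C [L2 [E aL1 CP]]].
have sE : {subset L1 ++ C :: L2 <= members} by rewrite -E.
have iE : ichain g (L1 ++ C :: L2) by rewrite -E.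
have uE : uniq (L1 ++ C :: L2) by rewrite -E.
have Cm : C \in members by apply: sE; rewrite mem_cat mem_head orbT.
have CS := mem_core Cm.
have [X Xs EC] := memberP Cm CP.
have m0 : (0 < m)%N by exact: leq_ltn_trans r_lt.
have [i1 i2] := ichain_cat iE.
have i3 : ichain g L2 by case/andP: i2.
have p2 : path touch C L2.
  case: L1 E {aL1 sE iE uE i1} => [[<- <-]//|D L1 [_ El]].
  by move: pl; rewrite El cat_path => /and3P[].
(* A second ball after C would bring two short cycles into a connected set of
   at most 36 m vertices. *)
have aL2 : all (mem Ps) L2.
  apply: contraT => /split_first[L3 [C' [L4 [E2 aL3 CP']]]].
  have Cm' : C' \in members by apply: sE; rewrite E2 !(mem_cat, inE) eqxx !orbT.
  have [X' Xs' EC'] := memberP Cm' CP'.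
  suff XX : X = X'.
    have : C \notin L2 by move: uE; rewrite cat_uniq => /and3P[_ _ /andP[]].
    by rewrite E2 mem_cat inE EC EC' XX eqxx orbT.
  case: L3 aL3 E2 => [_|D L3 aL3] E2.
    (* The balls touch each other directly, and a single vertex serves as the linking set. *)
    move: p2; rewrite E2 /= => /andP[+ _]; rewrite EC EC' => /touchP[b [b' [bX bX' bb]]].
    apply: (@two_balls X X' [set b']) => //; first exact: conn1.
    - by rewrite cards1.
    - rewrite touch_sym; apply/touchP; exists b, b'; split=> //; exact: set11.
    - by apply: touch_common bX'; exact: set11.
  have [iD _] : ichain g (D :: L3) /\ ichain g (C' :: L4) by apply: ichain_cat; rewrite -E2.
  move: p2; rewrite E2 cat_path /= => /andP[/andP[CD pD] /andP[DC' _]].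
  have [|||cT _ Tm] := @segment_small D L3 => //; first by move=> Z /(allP aL3).
  apply: (two_balls Xs Xs' cT Tm); rewrite -?EC -?EC'.
    by rewrite touch_sym; apply: touchW CD => //; rewrite chain_union_cons subsetUl.
  apply: touchW DC' => //; apply/subsetP => z zL; apply: in_chain_union zL.
  exact: mem_last.
have [T1 [cT1 T1S xT1 T1m tT1]] : exists T1,
    [/\ conn T1, T1 \subset core, x \in T1, (#|T1| <= m)%N & touch T1 C].
  case: L1 aL1 E i1 {sE iE uE} => [|D L1] aL1 [ED El] i1.
    exists [set x]; rewrite sub1set set11 cards1; split=> //; first exact: conn1.
    by apply: touch_common (set11 x) _; rewrite -ED.
  move: pl; rewrite El cat_path /= => /and3P[pD DC _].
  have [|||cT TS Tm] := @segment_small D L1 => //.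
  - by move=> Z /(allP aL1).
  - by rewrite -ED.
  exists (chain_union (D :: L1)); split=> //; first by rewrite chain_union_cons inE -ED xA.
  apply: touchW DC => //; rewrite ED; apply/subsetP => z zL; apply: in_chain_union zL.
  exact: mem_last.
have yL : y \in last C L2.
  case: L1 E {aL1 sE iE uE i1} => [[EA El]|D L1 [_ El]]; last by move: yl; rewrite El last_cat.
  by rewrite -EA -El.
have [T2 [cT2 T2S yT2 T2m tT2]] : exists T2,
    [/\ conn T2, T2 \subset core, y \in T2, (#|T2| <= m)%N & touch T2 C].
  case: L2 aL2 yL p2 i3 {E sE iE uE i2} => [|D L2] aL2 yL p2 i3.
    exists [set y]; rewrite sub1set set11 cards1; split=> //; first exact: conn1.
      by apply: (subsetP CS).
    exact: touch_common (set11 y) _.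
  case/andP: p2 => CD pD.
  have [|||cT TS Tm] := @segment_small D L2 => //; first by move=> Z /(allP aL2).
  exists (chain_union (D :: L2)); split=> //; first exact: in_chain_union (mem_last D L2) yL.
  by rewrite touch_sym; apply: touchW CD => //; rewrite chain_union_cons subsetUl.
move: tT1 tT2; rewrite EC => /ball_attach[W [cW WB Wm TW WX]] /ball_attach[W' [cW' WB' Wm' TW' WX']].
have cX := short_conn Xs.
have Xm : (#|X| <= 4 * m)%N by move: Xs; rewrite inE => /andP[].
exists ((T1 :|: W) :|: (X :|: (W' :|: T2))); split.
- apply: conn_join.
  + exact: conn_join.
  + apply: conn_join => //.
      by apply: conn_join => //; rewrite touch_sym.
    by rewrite touch_sym; apply: touchW WX' => //; exact: subsetUl.
  + by apply: touchW WX; [exact: subsetUr|exact: subsetUl].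
- rewrite !subUset T1S T2S /= andbT; move: CS; rewrite EC => CS.
  by rewrite !(subset_trans _ CS)// sub_ball.
- by rewrite !inE xT1.
- by rewrite !inE yT2 !orbT.
- right; split; last by exists X => //; apply/subsetP => z zX; rewrite !inE zX !orbT.
  apply: leq_trans (cardU_le (cardU_le T1m Wm) (cardU_le Xm (cardU_le Wm' T2m))) (leq_one_ball m).
Qed.

Definition comp u : {set 'I_n} := [set v | econn u v].

Lemma comp_core u : u \in core -> comp u \subset core.
Proof.
move=> uS; apply/subsetP => v; rewrite inE => /(core_link uS)[T [_ TS _ vT _]].
exact: (subsetP TS).
Qed.

Lemma comp_link u x y : u \in core -> x \in comp u -> y \in comp u ->
  exists T, [/\ conn T, T \subset comp u, x \in T, y \in T &
    (#|T| <= m)%N \/ ((#|T| <= 8 * m)%N /\ exists2 X, X \in short_cycle_sets & X \subset T)].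
Proof.
move=> uS xu yu; have xS := subsetP (comp_core uS) _ xu.
move: xu yu; rewrite !inE => ux uy.
have xy : econn x y by apply: connect_trans uy; rewrite connect_adj_sym.
have [T [cT TS xT yT h]] := core_link xS xy; exists T; split=> //.
apply/subsetP => z zT; rewrite inE; apply: connect_trans ux _.
by apply: (connect_mono (induced_mono g TS)); exact: cT.
Qed.

Lemma comp_conn u : u \in core -> conn (comp u).
Proof.
move=> uS x y xu yu; have [T [cT TC xT yT _]] := comp_link uS xu yu.
by apply: (connect_mono (induced_mono g TC)); exact: cT.
Qed.

Lemma comp_self u : u \in comp u.
Proof. by rewrite inE. Qed.

Lemma m_gt0 : (0 < m)%N.
Proof. exact: leq_ltn_trans r_lt. Qed.

(** Every vertex is linked to [u] by at most [8 * m] vertices, so an excess would already show on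
    [32 * m] vertices, against [excess0]. *)
Lemma comp_edges u : u \in core ->
  (#|induced_edges g (comp u)| <= #|comp u|)%N.
Proof.
move=> uS; rewrite leqNgt; apply/negP => lt.
have [|T [Tm]] := @excess_extract n g (comp u) u (8 * m) (comp_conn uS) (comp_self u) _ lt.
  move=> v vu; have [T [cT TC uT vT h]] := comp_link uS (comp_self u) vu.
  exists T; split=> //; case: h => [Tm|[]//]; exact: leq_trans Tm (leq_mul8 m).
by apply/negP; rewrite -leqNgt; apply: excess0; exact: leq_trans Tm (leq32_36 m).
Qed.

Lemma outer_comp u w : u \in core -> w \in outer_boundary g (comp u) -> w \notin core.
Proof.
move=> uS; rewrite inE => /andP[wC /existsP[a /andP[aC wa]]]; apply: contra wC => wS.
have aS := subsetP (comp_core uS) _ aC; move: aC; rewrite !inE => ua.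
by apply: connect_trans ua _; apply: connect1; rewrite adj_induced adj_sym wa aS wS.
Qed.

Lemma cycle_in_core c x : is_cycle g c -> (size c <= 4 * m)%N -> x \in c -> x \in core.
Proof.
move=> cc cm xc; have Xs : [set z in c] \in short_cycle_sets by apply/short_cycleP; exists c.
apply: (subsetP (mem_core (ball_member Xs))); apply: (subsetP (sub_ball _)).
by rewrite inE.
Qed.

(** Link two supposed neighbours of [w] inside the component. If the link has at most [m] vertices,
    it closes through [w] to a short cycle and [w] would be in the core. Otherwise the link contains
    a cycle, hence at least as many edges as vertices, and adding [w] with two more edges
    contradicts [excess0]. *)
Lemma comp_boundary_nbr u w : u \in core -> w \in outer_boundary g (comp u) ->
  #|[set v in comp u | adj g w v]| = 1%N.
Proof.
move=> uS wB; have wS := outer_comp uS wB.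
move: wB; rewrite inE => /andP[wC /existsP[a /andP[aC wa]]].
apply/eqP; rewrite eqn_leq; apply/andP; split; last first.
  by apply/card_gt0P; exists a; rewrite inE aC.
rewrite leqNgt; apply/negP => /card_gt1P[a1 [b [+ + ab]]].
rewrite in_set => /andP[ua wa1]; rewrite in_set => /andP[ub wb].
have [T [cT TC aT bT h]] := comp_link uS ua ub.
have wT : w \notin T by apply: contra wC; exact: (subsetP TC).
case: h => [Tm|[Tm [X Xs XT]]].
  have [p [ap up pb ps]] := conn_uniq_path cT aT bT.
  have [ap' pT] := path_induced ap.
  case/negP: wS; apply: (@cycle_in_core (w :: a1 :: p)); last exact: mem_head.
    apply/and3P; split.
    - by case: p {ap up ps ap' pT} pb => [/= E|//]; rewrite E eqxx in ab.
    - rewrite cons_uniq up andbT inE negb_or; apply/andP; split.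
        by apply: contraNneq wT => ->.
      by apply: contra wT => /pT.
    - by rewrite /= rcons_path wa1 ap' pb adj_sym.
  by apply: leq_trans (leqS4 m_gt0); rewrite /= ltnS; exact: leq_trans ps Tm.
have [c [cc Ec _]] := short_cycleP _ Xs.
have eT : (#|T| <= #|induced_edges g T|)%N.
  by apply: (conn_cycle_edges cT cc) => z zc; apply: (subsetP XT); rewrite Ec inE.
have [e1 e1g e1v] := adjP _ _ _ wa1; have [e2 e2g e2v] := adjP _ _ _ wb.
have e12 : e1 != e2.
  apply: contra ab => /eqP E; have := set22 w a1; rewrite -e1v E e2v => /set2P[E1|->//].
  by rewrite -E1 aT in wT.
have sub : [set e1; e2] :|: induced_edges g T \subset induced_edges g (w |: T).
  rewrite subUset induced_mono ?subsetUr// andbT; apply/subsetP => e /set2P[]->.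
    by rewrite inE e1g e1v subUset !sub1set !inE eqxx aT orbT.
  by rewrite inE e2g e2v subUset !sub1set !inE eqxx bT orbT.
have dis : [set e1; e2] :&: induced_edges g T = finset.set0.
  apply/setP => e; rewrite in_set0; apply/negP => /setIP[/set2P eE].
  rewrite inE => /andP[_ eT']; case/negP: wT; apply: (subsetP eT').
  by case: eE => ->; rewrite ?e1v ?e2v set21.
have ex : (#|w |: T| <= 36 * m)%N.
  by rewrite cardsU1 wT; apply: leq_trans (leqS36 m_gt0); rewrite add1n ltnS.
have := leq_trans (subset_leq_card sub) (excess0 ex).
by rewrite cardsU dis cards0 subn0 cards2 e12 cardsU1 wT add1n addSn ltnS add1n ltnNge eT.
Qed.

(** If the component contains a short cycle, [cycle_unique] confines [c] to it. If not, all links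
    have at most [m] vertices, and [short_cycle_extract] would produce a cycle of length at most
    [2 * m], a contradiction. *)
Lemma comp_cycle_short u c : u \in core -> is_cycle (induced_edges g (comp u)) c ->
  (size c <= 4 * m)%N.
Proof.
move=> uS /cycle_inducedE[cc cC].
have [/exists_inP[X Xs XC]|no] := boolP [exists X in short_cycle_sets, X \subset comp u].
  have [c0 [cc0 Ec cm]] := short_cycleP _ Xs.
  apply: leq_trans cm; apply: uniq_leq_size; first by case/and3P: cc.
  apply: (cycle_unique (comp_conn uS) (comp_edges uS)) => // z zc.
  by apply: (subsetP XC); rewrite Ec inE.
have noX X : X \in short_cycle_sets -> ~ X \subset comp u.
  by move=> Xs XC; case/negP: no; apply/exists_inP; exists X.
have [|c' [cc' cC' cm']] := @short_cycle_extract n g (comp u) u m (comp_conn uS) (comp_self u) _ c cc cC.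
  move=> v vu; have [T [cT TC uT vT h]] := comp_link uS (comp_self u) vu.
  exists T; split=> //; case: h => [//|[_ [X Xs XT]]].
  by case: (noX X Xs); apply: subset_trans XT TC.
case: (noX [set z in c']); last by apply/subsetP => z; rewrite inE => /cC'.
by apply/short_cycleP; exists c'; split=> //; exact: leq_trans cm' (leq24 m).
Qed.

Lemma block_structure : exists Bs : {set {set 'I_n}},
  finset.partition Bs [set: 'I_n] /\
  forall B, B \in Bs ->
    [/\ tree_plus_one_on (induced_edges g B) B,
        (2 <= #|B|)%N -> [/\ forall w P, w \in outer_boundary g B -> P \in Ps -> w \notin P,
            forall w, w \in outer_boundary g B -> #|[set u in B | adj g w u]| = 1%N,
            forall c, is_cycle (induced_edges g B) c -> (size c <= 4 * m)%N
          & forall c, is_cycle (induced_edges g B) c ->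
              forall x p, x \in c -> path (adj g) x p ->
              last x p \in outer_boundary g B -> (r < size p)%N]
      & #|B| = 1%N -> forall u P, u \in B -> P \in Ps -> u \notin P].
Proof.
have Ps_core P x : P \in Ps -> x \in P -> x \in core.
  by move=> PP xP; apply/coreP; exists P => //; rewrite inE PP.
(* The relation [econn] uses only edges inside the core, so a vertex outside the core is alone in
   its class. *)
exists (equivalence_partition econn [set: 'I_n]); split.
  apply: equivalence_partitionP => x y z _ _ _; split; first exact: connect0.
  by move=> xy; rewrite (same_connect (@connect_adj_sym _ _) xy).
move=> B /imsetP[u _ EB].
have {}EB : B = comp u by rewrite EB; apply/setP => v; rewrite !inE.
have [uS|uS] := boolP (u \in core); last first.
  have EB1 : B = [set u].
    apply/setP => v; rewrite EB !inE; apply/idP/eqP => [|->//].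
    by case/connectP => -[|w p] //=; rewrite adj_induced (negbTE uS) andbF.
  rewrite EB1 cards1; split=> //.
  - apply: (@conn_tree_plus_one _ _ _ u); rewrite ?set11//; first exact: conn1.
    by apply: excess0; rewrite cards1 leq1_36// m_gt0.
  - by move=> _ v P /set1P-> PP; apply: contra uS; exact: Ps_core.
rewrite EB; split.
- by apply: (conn_tree_plus_one (comp_conn uS) (comp_self u)); exact: comp_edges.
- move=> _; split.
  + by move=> w P /(outer_comp uS) wS PP; apply: contra wS; exact: Ps_core.
  + by move=> w; exact: comp_boundary_nbr.
  + by move=> c; exact: comp_cycle_short.
  (* A walk of length at most [r] from the cycle ends in the ball around it, hence in the core,
     which the outer boundary avoids. *)
  + move=> c cc x p xc xp lp; rewrite ltnNge; apply/negP => pr.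
    case/negP: (outer_comp uS lp); have cm := comp_cycle_short uS cc.
    have [cg _] := cycle_inducedE cc.
    have Xs : [set z in c] \in short_cycle_sets by apply/short_cycleP; exists c.
    apply: (subsetP (mem_core (ball_member Xs))); apply/gballP; exists x, p; split=> //.
    by rewrite inE.
(* A class meeting the core contains a whole member, and members have at least two vertices. *)
- move=> /eqP/cards1P[x Ex]; have /coreP[A Am uA] := uS.
  have AC : A \subset comp u.
    apply/subsetP => z zA; rewrite inE.
    by apply: (connect_mono (induced_mono g (mem_core Am))); exact: member_conn.
  by have := leq_trans (member_ge2 Am) (subset_leq_card AC); rewrite Ex cards1.
Qed.

End Blocks.

From mathcomp Require Import all_classical all_reals all_analysis measurable_realfun.
From mathcomp Require Import ring lra.
Import numFieldNormedType.Exports HBNNSimple.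
Local Open Scope classical_set_scope.
Local Open Scope ring_scope.

(** * Random graphs with Gaussian couplings *)

Section Transfer.
Context (d d' : measure_display) (T : measurableType d) (Y : measurableType d') (R : realType).
Variables (P : {measure set T -> \bar R}) (H : T -> R) (X : T -> Y).
Variables (nu : {measure set Y -> \bar R}) (C : R).
Hypotheses (mH : measurable_fun setT H) (H0 : forall w, 0 <= H w).
Hypotheses (mX : measurable_fun setT X) (C0 : 0 <= C).
Hypothesis HA : forall A : set Y, measurable A ->
  (\int[P]_w (H w * \1_A (X w))%:E = C%:E * nu A)%E.

Lemma transfer_nnsfun (f : {nnsfun Y >-> R}) :
  (\int[P]_w (H w * f (X w))%:E = \int[nu]_x (C%:E * (f x)%:E))%E.
Proof.
rewrite ge0_integralZl//; last 2 first.
- exact/measurable_EFinP.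
- by move=> x _; rewrite lee_fin.
under [in RHS]eq_integral do rewrite fimfunE -fsumEFin//.
under eq_integral do rewrite fimfunE mulr_fsumr//= -fsumEFin//.
rewrite !ge0_integral_fsum//=; last 4 first.
- by move=> r; apply/measurable_EFinP; exact: measurable_funM.
- by move=> r w _; exact: nnfun_muleindic_ge0.
- move=> r; apply/measurable_EFinP; apply: measurable_funM => //.
  by apply: measurable_funM => //; apply: measurableT_comp.
- move=> r w _; rewrite lee_fin mulr_ge0//.
  by have := nnfun_muleindic_ge0 f r (X w); rewrite lee_fin.
rewrite ge0_mule_fsumr; last first.
  by move=> r; apply: integral_ge0 => x _; exact: nnfun_muleindic_ge0.
apply: eq_fsbigr => r _.
(* A negative [r] has empty preimage; only nonnegative factors can be moved out of these
   integrals. *)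
have [r0|r0] := ltP r 0.
  have e0 : f @^-1` [set r] = set0 by apply: preimage_nnfun0.
  under eq_integral do rewrite e0 indic0 mulr0 mulr0.
  under [in RHS]eq_integral do rewrite e0 indic0 mulr0.
  by rewrite !integral0 mule0.
under eq_integral do rewrite mulrCA EFinM.
rewrite ge0_integralZl//; last 2 first.
- apply/measurable_EFinP; apply: measurable_funM => //.
  by apply: measurableT_comp.
- by move=> w _; rewrite lee_fin mulr_ge0.
rewrite HA//; under [in RHS]eq_integral do rewrite EFinM.
rewrite ge0_integralZl//; last exact/measurable_EFinP.
by rewrite integral_indic// setIT muleCA.
Qed.

(** By [HA], the law of [X] weighted by [H] is [C] times [nu]. This passes from indicators to simple
    functions, and by monotone convergence to nonnegative ones. *)
Lemma integral_transfer (f : Y -> R) : measurable_fun setT f -> (forall x, 0 <= f x) ->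
  (\int[P]_w (H w * f (X w))%:E = C%:E * \int[nu]_x (f x)%:E)%E.
Proof.
move=> mf f0; have mfE : measurable_fun setT (EFin \o f) by exact/measurable_EFinP.
pose g := nnsfun_approx measurableT mfE.
have cg x : (g n x)%:E @[n --> \oo] --> (f x)%:E.
  by apply: (cvg_nnsfun_approx measurableT mfE) => // y _; rewrite lee_fin.
rewrite -ge0_integralZl//; last by move=> x _; rewrite lee_fin.
transitivity (\int[P]_w (limn (fun n => (H w * g n (X w))%:E)))%E.
  apply: eq_integral => w _; apply/esym/cvg_lim => //.
  under eq_fun do rewrite EFinM; rewrite EFinM.
  exact: cvgeZl.
rewrite monotone_convergence//; last 3 first.
- move=> n; apply/measurable_EFinP; apply: measurable_funM => //.
  exact: measurableT_comp.
- by move=> n w _; rewrite lee_fin mulr_ge0.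
- move=> w _ m n mn; rewrite lee_fin ler_wpM2l//.
  exact/lefP/nd_nnsfun_approx.
transitivity (\int[nu]_x (limn (fun n => C%:E * (g n x)%:E)))%E; last first.
  apply: eq_integral => x _; apply/cvg_lim => //.
  exact: cvgeZl.
rewrite monotone_convergence//; last 3 first.
- by move=> n; apply: measurable_funeM; exact/measurable_EFinP.
- by move=> n w _; rewrite -EFinM lee_fin mulr_ge0.
- move=> w _ m n mn; rewrite -!EFinM lee_fin ler_wpM2l//.
  exact/lefP/nd_nnsfun_approx.
by congr (limn _); apply/funext => n; exact: transfer_nnsfun.
Qed.

End Transfer.

Section FiniteUnions.
Context (d : measure_display) (T : measurableType d) (R : realType).
Variables (P : {measure set T -> \bar R}) (I : finType) (F : I -> set T).

Lemma bigsetUP (r : seq I) (A : pred I) w :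
  (\big[setU/set0]_(i <- r | A i) F i) w <-> exists2 i, (i \in r) && A i & F i w.
Proof.
elim: r => [|i r IH]; first by rewrite big_nil; split=> // -[i].
rewrite big_cons; case: ifPn => Ai; split.
- case=> [Fi|/IH[j /andP[jr Aj] Fj]]; first by exists i; rewrite ?mem_head.
  by exists j; rewrite // inE jr orbT.
- case=> j; rewrite inE => /andP[/predU1P[->|jr] Aj] Fj; first by left.
  by right; apply/IH; exists j; rewrite ?jr.
- by move/IH => [j /andP[jr Aj] Fj]; exists j; rewrite // inE jr orbT.
- case=> j; rewrite inE => /andP[/predU1P[->|jr] Aj] Fj; first by rewrite Aj in Ai.
  by apply/IH; exists j; rewrite ?jr.
Qed.

Lemma union_bound (A : pred I) (b : I -> R) :
  (forall i, A i -> measurable (F i)) -> (forall i, A i -> (P (F i) <= (b i)%:E)%E) ->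
  measurable (\big[setU/set0]_(i | A i) F i) /\
  (P (\big[setU/set0]_(i | A i) F i) <= (\sum_(i | A i) b i)%:E)%E.
Proof.
move=> mF Fb; rewrite -sumEFin.
elim/big_rec2: _ => [|i y S Ai [mS PS]]; first by rewrite measure0.
split; first by apply: measurableU => //; exact: mF.
apply: le_trans (measureU2 _ _ _) _ => //; first exact: mF.
by apply: leeD => //; exact: Fb.
Qed.

Lemma disjoint_sum (A : pred I) : (forall i, measurable (F i)) ->
  (forall i j w, F i w -> F j w -> i = j) ->
  P (\big[setU/set0]_(i | A i) F i) = (\sum_(i | A i) P (F i))%E.
Proof.
move=> mF dF; elim: (index_enum I) (index_enum_uniq I) => [|i r IH] /=.
  by rewrite !big_nil measure0.
case/andP=> ir /IH{}IH; rewrite !big_cons; case: ifPn => // Ai.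
rewrite measureU//; first by congr (_ + _)%E.
- by apply: bigsetU_measurable => j _; exact: mF.
- apply/seteqP; split=> // w [Fi /bigsetUP[j /andP[jr _] Fj]].
  by rewrite (dF _ _ _ Fi Fj) jr in ir.
Qed.

End FiniteUnions.

Section MeasurableBig.
Context (d : measure_display) (T : measurableType d) (R : realType) (I : Type).
Variables (r : seq I) (A : pred I) (h : I -> T -> R).
Hypothesis mh : forall i, A i -> measurable_fun setT (h i).

Lemma measurable_bigprod : measurable_fun setT (fun x => \prod_(i <- r | A i) h i x).
Proof.
elim: r => [|i s IH]; first by under eq_fun do rewrite big_nil; exact: measurable_cst.
have [Ai|/negbTE Ai] := boolP (A i); under eq_fun do rewrite big_cons Ai; last by [].
by apply: measurable_funM => //; exact: mh.
Qed.

Lemma measurable_bigsum : measurable_fun setT (fun x => \sum_(i <- r | A i) h i x).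
Proof.
elim: r => [|i s IH]; first by under eq_fun do rewrite big_nil; exact: measurable_cst.
have [Ai|/negbTE Ai] := boolP (A i); under eq_fun do rewrite big_cons Ai; last by [].
by apply: measurable_funD => //; exact: mh.
Qed.

End MeasurableBig.

(** * Sums over the random graph and integrals over its couplings *)

Section RandomGraph.
Context (R : realType) (disp : measure_display) (T : measurableType disp).
Variables (P : probability T R) (n : nat) (p : R) (G : T -> graph n).
Hypothesis er : erdos_renyi P p G.

Lemma measurable_graph_eq g : measurable [set w | G w = g].
Proof.
have [mE _ _] := er.
have -> : [set w | G w = g] =
    \bigcap_(e in [set: edge n]) (if e \in g then [set w | e \in G w] else ~` [set w | e \in G w]).
  apply/seteqP; split=> w /= => [<- e _|h].
    by case: ifPn => // /negP.
  apply/setP => e; have := h e I; case: ifPn => /= eg; first by move=> ->.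
  by move/negP/negbTE.
apply: fin_bigcap_measurable => [|e _]; first exact: finite_finset.
by case: ifP => _; [exact: mE|apply: measurableC; exact: mE].
Qed.

Definition graph_weight g : R := fine (P [set w | G w = g]).

Lemma graph_weightE g : P [set w | G w = g] = (graph_weight g)%:E.
Proof. by rewrite fineK// fin_num_measure//; exact: measurable_graph_eq. Qed.

Lemma graph_weight_ge0 g : 0 <= graph_weight g.
Proof. by rewrite fine_ge0. Qed.

Lemma prob_subgraph (h : graph n) : P [set w | h \subset G w] = (p ^+ #|h|)%:E.
Proof.
have [_ pE ind] := er.
have -> : [set w | h \subset G w] =
    \bigcap_(e in [set e | e \in h]) [set w | e \in G w].
  apply/seteqP; split=> w /= => [/fintype.subsetP hG e /hG//|hG].
  by apply/fintype.subsetP => e; exact: hG.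
rewrite ind; under eq_bigr do rewrite pE.
by rewrite prodEFin prodr_const.
Qed.

Lemma sum_graph_weight (h : graph n) :
  \sum_(g : graph n | h \subset g) graph_weight g = p ^+ #|h|.
Proof.
apply: EFin_inj; rewrite -prob_subgraph -sumEFin.
under eq_bigr do rewrite -graph_weightE.
rewrite -(disjoint_sum P (F := fun g => [set w | G w = g])) => [|g|g g' w <- //].
  congr (P _); apply/seteqP; split=> w /=.
    by move/bigsetUP => [g /andP[_ hg] Gw]; rewrite Gw.
  by move=> hG; apply/bigsetUP; exists (G w); rewrite ?mem_index_enum.
exact: measurable_graph_eq.
Qed.

Lemma prod1D_sum (I : finType) (y : I -> R) :
  \prod_i (1 + y i) = \sum_(H : {set I}) \prod_(i in H) y i.
Proof.
under eq_bigr do rewrite addrC.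
rewrite bigA_distr; apply: eq_bigr => H _.
by rewrite [RHS]big_mkcond.
Qed.

(** Expanding the product over the subsets [H] of [g :\: h] reduces everything to the inclusion
    probabilities of [h :|: H], which are pure powers of [p]. *)
Lemma sum_graph_weight_prod (h : graph n) (x : edge n -> R) :
  \sum_(g : graph n | h \subset g) graph_weight g * \prod_(e in g) (1 + x e) =
  p ^+ #|h| * \prod_(e in h) (1 + x e) * \prod_(e | e \notin h) (1 + p * x e).
Proof.
transitivity (\prod_(e in h) (1 + x e) *
  \sum_(g : graph n | h \subset g) \sum_(H : graph n | H \subset g :\: h)
     graph_weight g * \prod_(e in H) x e).
  rewrite mulr_sumr; apply: eq_bigr => g hg.
  rewrite (big_setID h) /= (finset.setIidPr hg) mulrCA; congr (_ * _).
  rewrite -mulr_sumr; congr (_ * _).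
  rewrite big_mkcond /=.
  transitivity (\prod_e (1 + if e \in g :\: h then x e else 0)).
    by apply: eq_bigr => e _; case: ifP => // _; rewrite addr0.
  rewrite prod1D_sum [RHS]big_mkcond; apply: eq_bigr => H _; case: ifPn => [sH|].
    by apply: eq_bigr => e eH; rewrite (fintype.subsetP sH _ eH).
  case/fintype.subsetPn => e eH /negbTE eg.
  by rewrite (bigD1 e)//= eg mul0r.
rewrite (exchange_big_dep (fun H : graph n => fintype.disjoint (mem H) (mem h))) /=; last first.
  by move=> g H _; rewrite finset.subsetD => /andP[].
transitivity (\prod_(e in h) (1 + x e) *
   \sum_(H : graph n | fintype.disjoint (mem H) (mem h)) p ^+ #|h| * \prod_(e in H) (p * x e)).
  congr (_ * _); apply: eq_bigr => H dH; rewrite -mulr_suml.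
  rewrite (eq_bigl (fun g : graph n => h :|: H \subset g)); last first.
    by move=> g; rewrite finset.subsetD finset.subUset dH andbT.
  rewrite sum_graph_weight big_split prodr_const /= mulrA; congr (_ * _).
  rewrite -exprD; congr (_ ^+ _); apply/eqP.
  by rewrite finset.leq_card_setU fintype.disjoint_sym.
rewrite -mulr_sumr mulrCA -!mulrA; congr (_ * (_ * _)).
rewrite [RHS]big_mkcond /=.
transitivity (\prod_e (1 + if e \notin h then p * x e else 0)); last first.
  by apply: eq_bigr => e _; case: ifP => // _; rewrite addr0.
rewrite prod1D_sum [LHS]big_mkcond; apply: eq_bigr => H _; case: ifPn => [dH|].
  by apply: eq_bigr => e eH; rewrite (fintype.disjointFr dH eH).
rewrite -finset.setI_eq0 => /finset.set0Pn[e /finset.setIP[eH eh]].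
by rewrite (bigD1 e)//= eh mul0r.
Qed.

Variable J : edge n -> {RV P >-> R}.
Hypothesis gc : gaussian_couplings G J.
Local Notation N01 := (normal_prob (0 : R) 1).

Lemma integral_couplings (g : graph n) (f : edge n -> R -> R) (phi : edge n -> R) :
  (forall e, measurable_fun setT (f e)) -> (forall e x, 0 <= f e x) ->
  (forall e, (\int[N01]_x (f e x)%:E = (phi e)%:E)%E) ->
  (\int[P]_w (\1_[set w | G w = g] w * \prod_(e in g) f e (J e w))%:E =
    (graph_weight g * \prod_(e in g) phi e)%:E)%E.
Proof.
move=> mf f0 fphi.
have phi0 e : 0 <= phi e.
  by rewrite -lee_fin -fphi integral_ge0// => x _; rewrite lee_fin.
pose nu (B : set R) := fine (N01 B).
have nuE (B : set R) : measurable (B : set (Real.sort R)) -> N01 B = (nu B)%:E.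
  by move=> mB; rewrite fineK//; apply: (fin_num_measure N01); exact: mB.
have nu0 B : 0 <= nu B by rewrite fine_ge0.
(* [gaussian_couplings] speaks of product sets only. The list [l] holds the edges whose indicator
   has been replaced by the function [f e]; each replacement is one [integral_transfer] with all
   other factors put into the weight. *)
have key (l : seq (edge n)) (A : edge n -> set R) : (forall e, measurable (A e)) ->
    uniq l -> {subset l <= g} ->
    (\int[P]_w (\1_[set w | G w = g] w *
       (\prod_(e in g | e \notin l) \1_(A e) (J e w)) * \prod_(e <- l) f e (J e w))%:E =
    (graph_weight g * (\prod_(e in g | e \notin l) nu (A e)) * \prod_(e <- l) phi e)%:E)%E.
  elim: l A => [|e0 l IH] A mA /=.
    move=> _ _; under eq_integral do rewrite big_nil mulr1.
    rewrite big_nil mulr1.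
    rewrite (eq_bigl (fun e => e \in g)); last by move=> e; rewrite andbT.
    transitivity (P ([set w | G w = g] `&` \bigcap_(e in [set e | e \in g]) (J e @^-1` A e))).
      rewrite -[in RHS](setIT (_ `&` _)) -integral_indic//; last first.
        apply: measurableI; first exact: measurable_graph_eq.
        apply: fin_bigcap_measurable => [|e _]; first exact: finite_finset.
        by rewrite -[X in measurable X]setTI; exact: measurable_funP.
      apply: eq_integral => w _; congr EFin.
      rewrite (eq_bigl (fun e => e \in g)); last by move=> e; rewrite andbT.
      rewrite indicI /=; congr (_ * _).
      have [h|h] := pselect ((\bigcap_(e in [set e | e \in g]) (J e @^-1` A e)) w).
        rewrite [RHS]indicE mem_set//= big1// => e eg.
        by rewrite indicE mem_set//; exact: h.
      rewrite [RHS]indicE memNset//=.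
      have [e [eg nA]] : exists e, e \in g /\ ~ A e (J e w).
        apply: contrapT => no; apply: h => e /= eg.
        by apply: contrapT => nA; apply: no; exists e.
      by rewrite (bigD1 e)//= indicE memNset// mul0r.
    rewrite gc// graph_weightE (eq_bigr (fun e => (nu (A e))%:E)); last by move=> e _; rewrite nuE.
    by rewrite prodEFin -EFinM.
  case/andP=> e0l ul sl.
  have e0g : e0 \in g by apply: sl; rewrite mem_head.
  have sl' : {subset l <= g} by move=> e el; apply: sl; rewrite inE el orbT.
  pose H w := \1_[set w | G w = g] w *
    (\prod_(e in g | e \notin e0 :: l) \1_(A e) (J e w)) * \prod_(e <- l) f e (J e w).
  transitivity (\int[P]_w (H w * f e0 (J e0 w))%:E)%E.
    by apply: eq_integral => w _; rewrite big_cons /H; congr EFin; rewrite -!mulrA; congr (_ * (_ * _)); rewrite mulrC.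
  pose C := graph_weight g * (\prod_(e in g | e \notin e0 :: l) nu (A e)) * \prod_(e <- l) phi e.
  have -> : (\int[P]_w (H w * f e0 (J e0 w))%:E = C%:E * \int[N01]_x (f e0 x)%:E)%E; last first.
    rewrite fphi -EFinM; congr EFin; rewrite /C big_cons -!mulrA; congr (_ * (_ * _)).
    by rewrite mulrC.
  apply: integral_transfer => //.
  - apply: measurable_funM; last first.
      by apply: measurable_bigprod => e _; apply: measurableT_comp => //; exact: measurable_funP.
    apply: measurable_funM.
      by apply: measurable_indic; exact: measurable_graph_eq.
    apply: measurable_bigprod => e _.
    have -> : (fun w => \1_(A e) (J e w)) = \1_(J e @^-1` A e) :> (T -> R).
      apply/funext => w; rewrite !indicE; congr (_ %:R); congr nat_of_bool.
    apply: measurable_indic; rewrite -[X in measurable X]setTI.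
    exact: measurable_funP.
  - move=> w; rewrite /H mulr_ge0 ?prodr_ge0// mulr_ge0// ?prodr_ge0//.
  - exact: (measurable_funP (J e0)).
  - by rewrite mulr_ge0 ?prodr_ge0// mulr_ge0// ?graph_weight_ge0 ?prodr_ge0.
  (* The transfer hypothesis for a test set [B] is the induction hypothesis with [B] placed at
     [e0]. *)
  - move=> B mB; pose A' (e : edge n) : set R := if e == e0 then B else A e.
    have mA' (e : edge n) : measurable (A' e : set (Real.sort R)).
      by rewrite /A'; case: ifP => _; [exact: mB|exact: mA].
    have split_e0 (F F' : edge n -> R) : (forall e, e != e0 -> F e = F' e) ->
        \prod_(e in g | e \notin l) F e =
        F e0 * \prod_(e in g | e \notin e0 :: l) F' e.
      move=> FF'; rewrite (bigD1 e0) ?e0g//=; congr (_ * _).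
      rewrite (eq_bigl (fun e => (e \in g) && (e \notin e0 :: l))).
        by apply: eq_bigr => e /andP[_]; rewrite inE negb_or => /andP[/FF'].
      by move=> e; rewrite inE negb_or andbA andbAC.
    transitivity (\int[P]_w (\1_[set w | G w = g] w *
       (\prod_(e in g | e \notin l) \1_(A' e) (J e w)) * \prod_(e <- l) f e (J e w))%:E)%E.
      apply: eq_integral => w _; congr EFin; rewrite /H.
      rewrite (split_e0 _ (fun e => \1_(A e) (J e w))); last by move=> e /negbTE ee; rewrite /A' ee.
      have -> : A' e0 = B by rewrite /A' eqxx.
      by rewrite mulrAC; congr (_ * _); rewrite -mulrA; congr (_ * _); exact: mulrC.
    rewrite IH// (split_e0 _ (fun e => nu (A e))); last by move=> e /negbTE ee; rewrite /A' ee.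
    have -> : A' e0 = B by rewrite /A' eqxx.
    transitivity (C%:E * (nu B)%:E)%E; last by congr (_ * _)%E; apply/esym/nuE; exact: mB.
    rewrite -EFinM; congr EFin.
    by rewrite /C [RHS]mulrAC; congr (_ * _); rewrite -[RHS]mulrA; congr (_ * _); exact: mulrC.
  - exact: (mf e0).
have sg : {subset enum g <= g} by move=> e; rewrite mem_enum.
have := key (enum g) (fun=> setT) (fun=> measurableT) (enum_uniq _) sg.
have noe (F : edge n -> R) : \prod_(e in g | e \notin enum g) F e = 1.
  by rewrite big_pred0// => e; rewrite mem_enum andbN.
rewrite noe mulr1 -big_enum /= => <-; apply: eq_integral => w _.
by rewrite noe mulr1 -big_enum.
Qed.

End RandomGraph.

Section MeasurableComparison.
Context (d : measure_display) (T : measurableType d) (R : realType).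

Lemma measurable_ge_cst (F : T -> R) (t : R) : measurable_fun setT F ->
  measurable [set w | t <= F w].
Proof.
move=> mF; have -> : [set w | t <= F w] = setT `&` F @^-1` `[t, +oo[%classic.
  by apply/seteqP; split=> w /=; rewrite in_itv /= andbT; [split|case].
by apply: mF => //; exact: measurable_itv.
Qed.

Lemma measurable_le (F1 F2 : T -> R) : measurable_fun setT F1 -> measurable_fun setT F2 ->
  measurable [set w | F1 w <= F2 w].
Proof.
move=> m1 m2; have -> : [set w | F1 w <= F2 w] = [set w | 0 <= F2 w - F1 w].
  by apply/seteqP; split=> w /=; rewrite subr_ge0.
by apply: measurable_ge_cst; exact: measurable_funB.
Qed.

Lemma measurable_lt (F1 F2 : T -> R) : measurable_fun setT F1 -> measurable_fun setT F2 ->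
  measurable [set w | F1 w < F2 w].
Proof.
move=> m1 m2; have -> : [set w | F1 w < F2 w] = ~` [set w | F2 w <= F1 w].
  by apply/seteqP; split=> w /=; rewrite ltNge => /negP.
by apply: measurableC; exact: measurable_le.
Qed.

End MeasurableComparison.

Section Tails.
Context (R : realType) (disp : measure_display) (T : measurableType disp).
Variables (P : probability T R) (n : nat) (p : R) (G : T -> graph n).
Hypothesis er : erdos_renyi P p G.
Variable J : edge n -> {RV P >-> R}.
Hypothesis gc : gaussian_couplings G J.
Local Notation N01 := (normal_prob (0 : R) 1).
Variables (psi : R -> R).
Hypothesis mpsi : measurable_fun setT psi.

Lemma measurable_psi_sum (A : pred (edge n)) (c : edge n -> nat) :
  measurable_fun setT (fun w => \sum_(e | A e) (c e)%:R * psi (J e w)).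
Proof.
apply: measurable_bigsum => e _; apply: measurable_funM => //.
by apply: measurableT_comp => //; exact: measurable_funP.
Qed.

(** Exponential Markov inequality on each event [G w = g], summed over [g] by
    [sum_graph_weight_prod]: with [1 + x e] the moment of one coupling, an edge outside [h]
    contributes [1 + p * x e], averaging over its presence. *)
Lemma coupling_tail (h : graph n) (c : edge n -> nat) (a t : R) (x : edge n -> R) :
  (forall e, (\int[N01]_y (expR (a * (c e)%:R * psi y))%:E = (1 + x e)%:E)%E) ->
  let S := [set w | h \subset G w /\
    t <= a * \sum_(e in G w) (c e)%:R * psi (J e w)] in
  measurable S /\
  (P S <= (expR (- t) * (p ^+ #|h| * \prod_(e in h) (1 + x e) *
    \prod_(e | e \notin h) (1 + p * x e)))%:E)%E.
Proof.
move=> xE S.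
pose F (g : graph n) := [set w | G w = g /\ t <= a * \sum_(e in g) (c e)%:R * psi (J e w)].
have SE : S = \big[setU/set0]_(g : graph n | h \subset g) F g.
  apply/seteqP; split=> w; last by move/bigsetUP => [g /andP[_ hg] [Gw tg]]; rewrite /S /= Gw.
  by move=> [hG tG]; apply/bigsetUP; exists (G w) => //; rewrite hG mem_index_enum.
have mge (g : graph n) : measurable [set w | t <= a * \sum_(e in g) (c e)%:R * psi (J e w)].
  apply: measurable_ge_cst; apply: measurable_funM => //; exact: measurable_psi_sum.
have mF g : measurable (F g).
  by apply: (measurableI [set w | G w = g]); [exact: measurable_graph_eq er _|exact: mge].
rewrite -(sum_graph_weight_prod er) mulr_sumr SE.
apply: union_bound => // g hg.
have := @integral_couplings _ _ _ P n p G er J gc g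
  (fun e y => expR (a * (c e)%:R * psi y)) (fun e => 1 + x e).
move=> IC.
have mexp e : measurable_fun setT (fun y : R => expR (a * (c e)%:R * psi y)).
  by apply: measurableT_comp => //; exact: measurable_funM.
have {}IC := IC mexp (fun e y => expR_ge0 _) xE.
rewrite EFinM -IC -ge0_integralZl//; last 2 first.
- apply/measurable_EFinP; apply: measurable_funM.
    by apply: measurable_indic; exact: measurable_graph_eq er _.
  apply: measurable_bigprod => e _; apply: (measurableT_comp (mexp e)).
  exact: measurable_funP.
- by move=> w _; rewrite lee_fin mulr_ge0// prodr_ge0// => e _; exact: expR_ge0.
apply: (@le_trans _ _ (\int[P]_w (\1_(F g) w)%:E)%E); first by rewrite integral_indic// setIT.
apply: ge0_le_integral => //.
- by apply/measurable_EFinP; apply: measurable_indic.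
- apply: measurable_funeM; apply/measurable_EFinP; apply: measurable_funM.
    by apply: measurable_indic; exact: measurable_graph_eq er _.
  apply: measurable_bigprod => e _; apply: (measurableT_comp (mexp e)).
  exact: measurable_funP.
move=> w _; rewrite -EFinM lee_fin indicE.
have [[Gw tw]|nF] := pselect (F g w); last first.
  by rewrite memNset// mulr_ge0 ?expR_ge0// mulr_ge0// prodr_ge0// => e _; exact: expR_ge0.
rewrite mem_set// indicE mem_set//= mul1r -expR_sum -expRD -[leLHS]expR0 ler_expR.
rewrite addrC subr_ge0; apply: le_trans tw _; rewrite mulr_sumr.
by under eq_bigr do rewrite mulrA.
Qed.

End Tails.

(** * Estimates for one Gaussian coupling *)

Section Gaussian.
Context (R : realType).
Local Notation N01 := (normal_prob (0 : R) 1).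
Local Notation leb := (@lebesgue_measure R).

Lemma expR_le1Du (u : R) : 0 <= u -> expR u <= 1 + u * expR u.
Proof.
move=> u0; have h := expR_ge1Dx (- u); have e0 := expR_gt0 u.
have : expR u * (1 - u) <= 1.
  rewrite -[leRHS](expRxMexpNx_1 u) ler_pM2l//.
by rewrite mulrBr mulr1 mulrC; lra.
Qed.

Lemma expR_le2 (u : R) : 0 <= u -> expR u <= 1 + u + u ^+ 2 * expR u.
Proof.
move=> u0; have h := expR_le1Du u0; apply: le_trans h _.
have := ler_wpM2l u0 (expR_le1Du u0); rewrite mulrDr mulr1 expr2 -mulrA; lra.
Qed.

(** The remainder after the linear term is at most [s ^+ 2 * expR (3 * y)] with [y] the absolute
    value of [x], and [(y / 2 - 3) ^+ 2 >= 0] turns [3 * y] into [9 + y ^+ 2 / 4], whose exponential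
    is still integrable. *)
Lemma expR_abs_bound (s x : R) : 0 <= s <= 1 ->
  expR (s * `|x|) <= 1 + s * `|x| + s ^+ 2 * (expR 9 * expR (x ^+ 2 / 4)).
Proof.
case/andP=> s0 s1; have y0 := normr_ge0 x; set y := `|x| in y0 *.
have yx : x ^+ 2 = y ^+ 2 by rewrite real_normK ?num_real.
apply: le_trans (expR_le2 (mulr_ge0 s0 y0)) _; rewrite lerD2l exprMn -mulrA.
rewrite ler_wpM2l ?sqr_ge0// yx -expRD.
have yy : y <= expR y by apply: le_trans (expR_ge1Dx y); lra.
apply: (@le_trans _ _ (expR y ^+ 2 * expR y)).
  apply: ler_pM; rewrite ?sqr_ge0 ?expR_ge0//; first by rewrite !expr2 ler_pM.
  by rewrite ler_expR ler_piMl.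
rewrite -exprSr -expRM_natl ler_expR; have := sqr_ge0 (y / 2 - 3); rewrite sqrrB.
by rewrite expr_div_n; lra.
Qed.

Lemma integral_N01 (f : R -> R) : measurable_fun setT f -> (forall x, 0 <= f x) ->
  (\int[N01]_x (f x)%:E = \int[leb]_x (normal_pdf 0 1 x * f x)%:E)%E.
Proof.
move=> mf f0; rewrite -[LHS]mul1e; apply/esym.
apply: (@integral_transfer _ _ _ _ _ leb (normal_pdf 0 1) id N01 1) => //.
- exact: measurable_normal_pdf.
- by move=> x; exact: normal_pdf_ge0.
- move=> A mA; rewrite mul1e /normal_prob [RHS]integral_mkcond.
  apply: eq_integral => x _; rewrite patchE indicE.
  by case: ifPn => xA; rewrite ?mulr1 ?mulr0.
Qed.

Lemma normal_peak2 : normal_peak (Num.sqrt 2 : R) * Num.sqrt 2 = normal_peak 1.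
Proof.
rewrite /normal_peak sqr_sqrtr// expr1n mul1r -mulrnAr sqrtrM// invfM.
by rewrite mulrAC mulVf ?mul1r// gt_eqF ?sqrtr_gt0.
Qed.

Lemma measurable_expR_sqr : measurable_fun setT (fun x : R => expR (x ^+ 2 / 4)).
Proof.
apply: continuous_measurable_fun => x.
apply: (@continuous_comp _ _ _ (fun x : R => x ^+ 2 / 4) expR); last exact: continuous_expR.
by apply: cvgM; [exact: exprn_continuous|exact: cvg_cst].
Qed.

(** The tilted density is [Num.sqrt 2] times the centred Gaussian density of variance 2. *)
Lemma N01_expR_sqr : (\int[N01]_x (expR (x ^+ 2 / 4))%:E = (Num.sqrt 2)%:E)%E.
Proof.
rewrite (integral_N01 measurable_expR_sqr (fun x => expR_ge0 _)).
have s2 : Num.sqrt (2 : R) != 0 by rewrite gt_eqF ?sqrtr_gt0.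
transitivity (\int[leb]_x ((Num.sqrt 2)%:E * (normal_pdf 0 (Num.sqrt 2) x)%:E))%E; last first.
  rewrite ge0_integralZl//; first by rewrite integral_normal_pdf mule1.
  - by apply/measurable_EFinP; exact: measurable_normal_pdf.
  - by move=> x _; rewrite lee_fin normal_pdf_ge0.
apply: eq_integral => x _; rewrite -EFinM; congr EFin.
rewrite !normal_pdfE ?oner_neq0// /normal_fun subr0 -normal_peak2 sqr_sqrtr// expr1n.
rewrite -!mulrA [RHS]mulrCA; congr (_ * _); congr (_ * _).
rewrite -expRD; congr expR; rewrite (_ : 2 *+ 2 = 4 :> R); last by rewrite mulr2n; lra.
have gen (y : R) : - y ^+ 2 / 2 + y * (y / 4) = - y ^+ 2 / 4 by field.
exact: gen.
Qed.

Let F (x : R) : R := - expR (- (x ^+ 2 / 2)).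

Let derive_F (x : R) : is_derive x (1 : R) F (x * expR (- (x ^+ 2 / 2))).
Proof.
rewrite /F; apply: is_derive_eq.
by rewrite /GRing.scale /=; field.
Qed.

Let cont_exp2 : continuous (fun x : R => expR (- (x ^+ 2 / 2))).
Proof.
move=> x; apply: (@continuous_comp _ _ _ (fun x : R => - (x ^+ 2 / 2)) expR).
  by apply: cvgN; apply: cvgM; [exact: exprn_continuous|exact: cvg_cst].
exact: continuous_expR.
Qed.

Let cvgF : F x @[x --> +oo] --> (0 : R).
Proof.
rewrite -oppr0; apply: cvgN.
apply: (cvg_comp (fun x : R => x ^+ 2 / 2) (fun x => expR (- x))); last exact: cvgr_expR.
by apply/gt0_cvgMly => //; exact: cvgr_expr2.
Qed.

Lemma integral_abs_gauss :
  (\int[leb]_x (`|x| * expR (- (x ^+ 2 / 2)))%:E = 2%:E)%E.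
Proof.
have cabs : continuous (fun x : R => `|x| * expR (- (x ^+ 2 / 2))).
  by move=> x; apply: cvgM; [exact: norm_continuous|exact: cont_exp2].
have pos (x : R) : 0 <= `|x| * expR (- (x ^+ 2 / 2)) by rewrite mulr_ge0 ?expR_ge0.
rewrite (ge0_symfun_integralT pos cabs); last by move=> x /=; rewrite normrN sqrrN.
rewrite -set_itvcy.
transitivity (2%:E * \int[leb]_(x in `[0%R, +oo[) (x * expR (- (x ^+ 2 / 2)))%:E)%E.
  congr (_ * _)%E; apply: eq_integral => x; rewrite inE /= in_itv /= andbT => x0.
  by rewrite ger0_norm.
rewrite (@ge0_continuous_FTC2y R _ F 0 0).
- by rewrite -EFinB -EFinM /F expr0n /= mul0r oppr0 expR0 sub0r opprK mulr1.
- by move=> x x0; rewrite mulr_ge0 ?expR_ge0.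
- apply: continuous_subspaceT => x; apply: cvgM; first exact: cvg_id.
  exact: cont_exp2.
- exact: cvgF.
- by move=> x _; have [] := derive_F x.
- apply: cvg_at_right_filter; apply: cvgN; exact: cont_exp2.
- by move=> x _; rewrite derive1E; have [_ ->] := derive_F x.
Qed.

Lemma normal_peak1 : normal_peak (1 : R) * 2 = Num.sqrt (2 / pi).
Proof.
have p0 := pi_gt0 R; rewrite /normal_peak expr1n mul1r -mulr_natr.
have s0 : 0 < Num.sqrt (pi * 2 : R) by rewrite sqrtr_gt0 mulr_gt0.
apply/eqP; rewrite -(eqrXn2 (n := 2)) ?mulr_ge0 ?invr_ge0 ?sqrtr_ge0//.
rewrite exprMn exprVn !sqr_sqrtr ?mulr_ge0 ?invr_ge0 ?ltW//; apply/eqP.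
by rewrite invfM expr2 mulrA -[_ * 2^-1 * 2]mulrA mulVf ?mulr1 1?mulrC.
Qed.

Lemma measurable_abs : measurable_fun setT (fun x : R => `|x|).
Proof. exact: normr_measurable. Qed.

Lemma N01_abs : (\int[N01]_x (`|x|)%:E = (Num.sqrt (2 / pi))%:E)%E.
Proof.
rewrite (integral_N01 measurable_abs (@normr_ge0 _ _)).
transitivity (\int[leb]_x ((normal_peak 1)%:E * (`|x| * expR (- (x ^+ 2 / 2)))%:E))%E.
  apply: eq_integral => x _; rewrite -EFinM; congr EFin.
  rewrite normal_pdfE ?oner_neq0// /normal_fun subr0 expr1n -mulrA; congr (_ * _).
  by rewrite mulrC mulNr.
rewrite ge0_integralZl//.
- by rewrite integral_abs_gauss -EFinM normal_peak1.
- apply/measurable_EFinP; apply: measurable_funM; first exact: measurable_abs.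
  exact: continuous_measurable_fun.
- by rewrite lee_fin normal_peak_ge0.
Qed.

Lemma measurable_exp_abs (s : R) : measurable_fun setT (fun x : R => expR (s * `|x|)).
Proof.
apply: continuous_measurable_fun => x.
apply: (@continuous_comp _ _ _ (fun x : R => s * `|x|) expR); last exact: continuous_expR.
by apply: cvgM; [exact: cvg_cst|exact: norm_continuous].
Qed.

Lemma N01_one : (\int[N01]_x (1 : R)%:E = 1)%E.
Proof. by rewrite integral_cst// mul1e; exact: (@probability_setT _ _ _ N01). Qed.

(** The linear coefficient is the exact mean of the absolute value, so the loss is of second order
    in [s]; the critical constant survives. The lower bound 1 later makes the excess moments [x e]
    nonnegative. *)
Lemma N01_exp_abs (s : R) : 0 <= s <= 1 -> exists M : R,
  (\int[N01]_x (expR (s * `|x|))%:E = M%:E)%E /\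
  1 <= M <= 1 + s * Num.sqrt (2 / pi) + s ^+ 2 * (expR 9 * Num.sqrt 2).
Proof.
move=> s01; have /andP[s0 s1] := s01.
have mE := measurable_exp_abs s.
have lo : (1 <= \int[N01]_x (expR (s * `|x|))%:E)%E.
  apply: (@le_trans _ _ (\int[N01]_x (1 : R)%:E)%E).
    by rewrite N01_one.
  apply: ge0_le_integral => //.
  - exact/measurable_EFinP.
  - by move=> x _; rewrite lee_fin -expR0 ler_expR mulr_ge0.
have hi : (\int[N01]_x (expR (s * `|x|))%:E <=
    (1 + s * Num.sqrt (2 / pi) + s ^+ 2 * (expR 9 * Num.sqrt 2))%:E)%E.
  apply: (@le_trans _ _ (\int[N01]_x ((1 : R)%:E + s%:E * (`|x|)%:E +
     (s ^+ 2 * expR 9)%:E * (expR (x ^+ 2 / 4))%:E))%E).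
    apply: ge0_le_integral => //.
    - exact/measurable_EFinP.
    - apply/measurable_EFinP; apply: measurable_funD.
        apply: measurable_funD => //; apply: measurable_funM => //; exact: measurable_abs.
      apply: measurable_funM => //; exact: measurable_expR_sqr.
    - move=> x _; rewrite -!EFinM -!EFinD lee_fin; apply: le_trans (expR_abs_bound x s01) _.
      by rewrite !mulrA.
  rewrite ge0_integralD//; last 4 first.
  - by move=> x _; rewrite -EFinM -EFinD lee_fin addr_ge0// mulr_ge0.
  - apply/measurable_EFinP; apply: measurable_funD => //.
    apply: measurable_funM => //; exact: measurable_abs.
  - by move=> x _; rewrite -EFinM lee_fin mulr_ge0 ?mulr_ge0 ?sqr_ge0 ?expR_ge0.
  - by apply/measurable_EFinP; apply: measurable_funM => //; exact: measurable_expR_sqr.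
  rewrite ge0_integralD//; last 2 first.
  - by move=> x _; rewrite -EFinM lee_fin mulr_ge0.
  - by apply/measurable_EFinP; apply: measurable_funM => //; exact: measurable_abs.
  rewrite ge0_integralZl//; last first.
    by apply/measurable_EFinP; exact: measurable_abs.
  rewrite ge0_integralZl//; try (by apply/measurable_EFinP; exact: measurable_expR_sqr); try (by move=> *; rewrite lee_fin ?mulr_ge0 ?sqr_ge0 ?expR_ge0).
  rewrite N01_abs N01_expR_sqr N01_one.
  by rewrite -!EFinM -!EFinD lee_fin !mulrA.
have fin : (\int[N01]_x (expR (s * `|x|))%:E)%E \is a fin_num.
  rewrite fin_numE; apply/andP; split; apply/eqP => E; first by rewrite E in lo.
  by rewrite E in hi.
exists (fine (\int[N01]_x (expR (s * `|x|))%:E)%E); rewrite fineK//; split=> //.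
by rewrite -!lee_fin fineK// lo hi.
Qed.

(** The peak of the density times the length [2 * r] is [Num.sqrt (2 / pi) * r], and [2 <= pi]. *)
Lemma N01_small (r : R) : 0 <= r -> (N01 [set x | (`|x| < r)%R] <= r%:E)%E.
Proof.
move=> r0; rewrite /normal_prob.
have -> : [set x : R | (`|x| < r)%R] = `](- r)%R, r[%classic.
  by apply/seteqP; split=> x /=; rewrite in_itv /= ltr_norml.
apply: (@le_trans _ _ (\int[leb]_(x in `](- r)%R, r[) (normal_peak 1)%:E)%E).
  apply: ge0_le_integral => //.
  - by move=> x _; rewrite lee_fin normal_pdf_ge0.
  - by apply/measurable_EFinP; apply: measurable_funTS; exact: measurable_normal_pdf.
  - by move=> x _; rewrite lee_fin normal_pdf_ub ?oner_neq0.
rewrite integral_cst// [X in (_ * X)%E]lebesgue_measure_itv /= lte_fin.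
case: ifPn => _; last by rewrite mule0 lee_fin.
rewrite -EFinD -EFinM lee_fin opprK -mulr2n -mulr_natr mulrCA normal_peak1.
rewrite ler_piMr// -[leRHS]sqrtr1 ler_wsqrtr// ler_pdivrMr ?pi_gt0// mul1r.
exact: pi_ge2.
Qed.

(** Markov inequality for [expR (x ^+ 2 / 4)]. *)
Lemma N01_large (r : R) : 0 <= r ->
  (N01 [set x | (r < `|x|)%R] <= (Num.sqrt 2 * expR (- (r ^+ 2 / 4)))%:E)%E.
Proof.
move=> r0; have mA : measurable [set x : R | (r < `|x|)%R].
  have -> : [set x : R | (r < `|x|)%R] = setT `&` (fun x : R => `|x|) @^-1` `]r, +oo[%classic.
    by apply/seteqP; split=> x /=; rewrite in_itv /= andbT; [split|case].
  by apply: measurable_abs => //; exact: measurable_itv.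
have -> : N01 [set x | (r < `|x|)%R] = (\int[N01]_x (\1_[set x : R | (r < `|x|)%R] x)%:E)%E.
  by rewrite integral_indic// setIT.
rewrite mulrC EFinM -N01_expR_sqr -ge0_integralZl//; try (by apply/measurable_EFinP; exact: measurable_expR_sqr); try (by move=> *; rewrite lee_fin ?mulr_ge0 ?sqr_ge0 ?expR_ge0).
apply: ge0_le_integral => //.
- by apply/measurable_EFinP; exact: measurable_indic.
- apply/measurable_EFinP; apply: measurable_funM => //; exact: measurable_expR_sqr.
move=> x _; rewrite -EFinM lee_fin indicE; case: (boolP (x \in _)); last first.
  by move=> _; rewrite mulr_ge0 ?expR_ge0.
move/set_mem => /= rx; rewrite -expRD -[leLHS]expR0 ler_expR addrC subr_ge0.
rewrite ler_pM2r ?invr_gt0// -(real_normK (num_real x)).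
by rewrite !expr2 ler_pM// ltW.
Qed.

End Gaussian.

(** An edge inside [U] is counted at both ends. These multiplicities 0, 1, 2 are the [j] of the
    moment hypotheses further on. *)
Lemma sum_star_edges (R : realType) (n : nat) (g : graph n) (f : edge n -> R) (U : {set 'I_n}) :
  \sum_(v in U) \sum_(e in g | v \in val e) f e =
  \sum_(e in g) #|(val e :&: U)%SET|%:R * f e.
Proof.
rewrite (exchange_big_dep (fun e => e \in g)) /=; last by move=> v e _ /andP[].
apply: eq_bigr => e eG; rewrite (eq_bigl (mem (val e :&: U)%SET)).
  by rewrite sumr_const mulr_natl.
by move=> v; rewrite !inE eG andbC.
Qed.

(** * First-moment bounds for the bad events *)

Section Counting.
Variable n : nat.

Definition inner (A : {set 'I_n}) : graph n := [set e : edge n | val e \subset A]%SET.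

Lemma card_inner (A : {set 'I_n}) : (#|inner A| <= #|A| ^ 2)%N.
Proof.
rewrite -(card_imset _ val_inj).
apply: (@leq_trans #|[set B : {set 'I_n} | (B \subset A) && (#|B| == 2%N)]%SET|).
  apply: subset_leq_card; apply/fintype.subsetP => B /imsetP[e eA ->].
  rewrite inE; apply/andP; split; last exact: (valP e).
  by move: eA; rewrite /inner finset.in_set.
rewrite cards_draws bin2 (leq_trans (half_leq (leq_mul (leqnn _) (leq_pred _))))//.
by rewrite -divn2 (leq_trans (leq_div _ _))// mulnn.
Qed.

Lemma exists_subset (I : finType) (A : {set I}) k : (k <= #|A|)%N ->
  exists B : {set I}, B \subset A /\ #|B| = k.
Proof.
move=> kA; exists [set x in take k (enum A)]%SET; split.
  by apply/fintype.subsetP => x; rewrite inE => /mem_take; rewrite mem_enum.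
by rewrite cardsE (card_uniqP _) ?take_uniq ?enum_uniq// size_takel// -cardE.
Qed.

End Counting.

Section BinomialBounds.
Variable R : realType.

Lemma ffact_le_exp m r : (m ^_ r <= m ^ r)%N.
Proof.
elim: r m => // r IH [|m]; first by rewrite ffact0n.
rewrite ffactSS expnS leq_mul//; apply: leq_trans (IH _) _.
by case: r {IH} => // r; rewrite leq_exp2r.
Qed.

Lemma bin_le m M r : (m <= M)%N -> 'C(m, r)%:R <= M%:R ^+ r / r`!%:R :> R.
Proof.
move=> mM; rewrite ler_pdivlMr ?ltr0n ?fact_gt0// -natrM bin_ffact -natrX ler_nat.
apply: leq_trans (ffact_le_exp _ _) _; case: r => // r.
by rewrite leq_exp2r.
Qed.

Lemma expn_fact k : k%:R ^+ k / k`!%:R <= expR k%:R :> R.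
Proof.
case: k => [|k]; first by rewrite expr0 fact0 divr1 expR0.
by apply: le_trans (expR_ge1Dxn k _) => //; rewrite lerDr.
Qed.

End BinomialBounds.

Section Bounds.
Context (R : realType) (disp : measure_display) (T : measurableType disp).
Variables (P : probability T R) (n : nat) (d : R) (G : T -> graph n).
Hypothesis d_ge1 : 1 <= d.
Hypothesis n_gt0 : (0 < n)%N.
Local Notation p := (d / n%:R).
Hypothesis er : erdos_renyi P p G.
Variable J : edge n -> {RV P >-> R}.
Hypothesis gc : gaussian_couplings G J.
Local Notation N01 := (normal_prob (0 : R) 1).

Lemma union_bound_card (I : finType) (A : {set I}) (F : I -> set T) (b N : R) :
  (forall i, i \in A -> measurable (F i) /\ (P (F i) <= b%:E)%E) ->
  #|A|%:R <= N -> 0 <= b ->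
  measurable (\big[setU/set0]_(i in A) F i) /\
  (P (\big[setU/set0]_(i in A) F i) <= (N * b)%:E)%E.
Proof.
move=> Fb AN b0.
have [|//|mU PU] := @union_bound _ _ _ P I F (mem A) (fun=> b); first by move=> i /Fb[].
  by move=> i /Fb[].
split=> //; apply: le_trans PU _; rewrite lee_fin sumr_const -mulr_natl.
exact: ler_wpM2r.
Qed.

Definition pairs_event k r (F : {set 'I_n} -> graph n -> set T) : set T :=
  \big[setU/set0]_(A in [set A : {set 'I_n} | #|A| == k]%SET)
    \big[setU/set0]_(h in [set h : graph n | (h \subset inner A) && (#|h| == r)]%SET) F A h.

Lemma pairs_eventP k r F w : pairs_event k r F w <->
  exists (A : {set 'I_n}) (h : graph n), [/\ #|A| = k, h \subset inner A, #|h| = r & F A h w].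
Proof.
split=> [/bigsetUP[A /andP[_]]|[A [h [Ak hA hr Fw]]]].
  rewrite inE => /eqP Ak /bigsetUP[h /andP[_]]; rewrite inE => /andP[hA /eqP hr] Fw.
  by exists A, h.
apply/bigsetUP; exists A; first by rewrite mem_index_enum inE Ak eqxx.
by apply/bigsetUP; exists h => //; rewrite mem_index_enum inE hA hr eqxx.
Qed.

Lemma pairs_bound k r F (b : R) : 0 <= b ->
  (forall (A : {set 'I_n}) (h : graph n), #|A| = k -> h \subset inner A -> #|h| = r ->
     measurable (F A h) /\ (P (F A h) <= b%:E)%E) ->
  measurable (pairs_event k r F) /\
  (P (pairs_event k r F) <=
    (n%:R ^+ k / k`!%:R * ((k ^ 2)%:R ^+ r / r`!%:R * b))%:E)%E.
Proof.
move=> b0 Fb; apply: union_bound_card; last 2 first.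
- have -> : #|[set A : {set 'I_n} | #|A| == k]%SET| = 'C(n, k).
    by rewrite card_draws card_ord.
  exact: bin_le.
- by rewrite mulr_ge0// divr_ge0// exprn_ge0.
move=> A; rewrite inE => /eqP Ak; apply: union_bound_card => //; last first.
  by rewrite cards_draws; apply: bin_le; rewrite -Ak; exact: card_inner.
by move=> h; rewrite inE => /andP[hA /eqP hr]; exact: Fb.
Qed.

Lemma measurable_subgraph (h : graph n) : measurable [set w | h \subset G w].
Proof.
have -> : [set w | h \subset G w] = \big[setU/set0]_(g : graph n | h \subset g) [set w | G w = g].
  apply/seteqP; split=> w; last by move/bigsetUP => [g /andP[_ hg] Gw]; rewrite /= Gw.
  by move=> hG; apply/bigsetUP; exists (G w) => //; rewrite hG mem_index_enum.
by apply: bigsetU_measurable => g _; exact: measurable_graph_eq er _.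
Qed.

Let nR : 0 < n%:R :> R. Proof. by rewrite ltr0n. Qed.
Let d_gt0 : 0 < d. Proof. exact: lt_le_trans d_ge1. Qed.
Let d_ge0 : 0 <= d. Proof. exact: ltW. Qed.
Let p_ge0 : 0 <= p. Proof. exact: divr_ge0. Qed.

Definition excess_event K : set T :=
  \big[setU/set0]_(k : 'I_K.+1)
    pairs_event k k.+1 (fun _ h => [set w | h \subset G w]).

(** The powers of [k] from choosing vertices and edges are balanced by the two factorials, at the
    price of [expR k%:R] each; one edge more than vertices leaves the factor [n%:R^-1]. *)
Lemma excess_term k :
  n%:R ^+ k / k`!%:R * ((k ^ 2)%:R ^+ k.+1 / k.+1`!%:R * p ^+ k.+1) <=
  n%:R^-1 * (d ^+ k.+1 * (k%:R ^+ 2 * expR k%:R ^+ 2)).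
Proof.
have -> : n%:R ^+ k / k`!%:R * ((k ^ 2)%:R ^+ k.+1 / k.+1`!%:R * p ^+ k.+1) =
    n%:R^-1 * (d ^+ k.+1 * (k%:R ^+ 2 * (k%:R ^+ k / k`!%:R) ^+ 2 / k.+1%:R)).
  have -> : (k ^ 2)%:R ^+ k.+1 = (k%:R ^+ k) ^+ 2 * k%:R ^+ 2 :> R.
    by rewrite natrX -!exprM -exprD; congr (_ ^+ _); rewrite mulnSr mulnC.
  rewrite factS natrM [p ^+ _]expr_div_n [n%:R ^+ k.+1]exprSr.
  have h1 : k`!%:R != 0 :> R by rewrite pnatr_eq0 -lt0n fact_gt0.
  have h2 : k.+1%:R != 0 :> R by rewrite pnatr_eq0.
  have h3 : n%:R ^+ k != 0 :> R by rewrite expf_neq0// gt_eqF.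
  have h4 : n%:R != 0 :> R by rewrite gt_eqF.
  move: (k%:R ^+ k : R) (k%:R ^+ 2 : R) (d ^+ k.+1) => KK K2 D.
  move: (n%:R ^+ k : R) (k`!%:R : R) (k.+1%:R : R) (n%:R : R) h1 h2 h3 h4 => N f k1 m h1 h2 h3 h4.
  by field; rewrite h1 h2 h3 h4.
rewrite ler_wpM2l ?invr_ge0// ler_wpM2l ?exprn_ge0//.
rewrite -mulrA ler_wpM2l ?exprn_ge0//.
apply: (@le_trans _ _ ((k%:R ^+ k / k`!%:R) ^+ 2)).
  by rewrite ler_piMr ?sqr_ge0// invf_le1 ?ltr0Sn// ler1n.
by rewrite !expr2 ler_pM ?divr_ge0 ?exprn_ge0//; exact: expn_fact.
Qed.

(** Of the five factors [expR K%:R], two come from [excess_term], two bound [k%:R ^+ 2], and one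
    bounds the number [K.+1] of terms. *)
Lemma excess_bound K : measurable (excess_event K) /\
  (P (excess_event K) <= (n%:R^-1 * (d ^+ K.+1 * expR (K%:R *+ 5)))%:E)%E.
Proof.
have term (k : 'I_K.+1) : true ->
    measurable (pairs_event k k.+1 (fun _ h => [set w | h \subset G w])) /\
    (P (pairs_event k k.+1 (fun _ h => [set w | h \subset G w])) <=
      (n%:R^-1 * (d ^+ K.+1 * expR (K%:R *+ 4)))%:E)%E.
  move=> _.
  have [||mE PE] := @pairs_bound k k.+1 (fun _ h => [set w | h \subset G w]) (p ^+ k.+1).
  - exact: exprn_ge0.
  - by move=> A h _ _ hk; split; [exact: measurable_subgraph|rewrite (prob_subgraph er) hk].
  split=> //; apply: le_trans PE _; rewrite lee_fin; apply: le_trans (excess_term k) _.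
  rewrite ler_wpM2l ?invr_ge0//; have kK : (k <= K)%N by rewrite -ltnS.
  apply: ler_pM; rewrite ?exprn_ge0 ?mulr_ge0 ?exprn_ge0 ?expR_ge0//.
    by apply: ler_weXn2l.
  have -> : expR (K%:R *+ 4) = expR K%:R ^+ 2 * expR K%:R ^+ 2 :> R.
    by rewrite -!exprD -mulr_natl expRM_natl.
  have kle : k%:R <= K%:R :> R by rewrite ler_nat.
  apply: ler_pM; rewrite ?exprn_ge0 ?expR_ge0//.
    rewrite lerXn2r ?nnegrE ?expR_ge0//; apply: le_trans (expR_ge1Dx _).
    by apply: le_trans kle _; rewrite lerDr.
  by rewrite lerXn2r ?nnegrE ?expR_ge0// ler_expR.
have [||mE PE] := @union_bound _ _ _ P 'I_K.+1
  (fun k => pairs_event k k.+1 (fun _ h => [set w | h \subset G w])) xpredT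
  (fun=> n%:R^-1 * (d ^+ K.+1 * expR (K%:R *+ 4))).
- by move=> k kt; have [] := term k kt.
- by move=> k kt; have [_] := term k kt.
split=> //; apply: le_trans PE _; rewrite lee_fin sumr_const card_ord -[leLHS]mulr_natl.
rewrite [leRHS](_ : _ = expR K%:R * (n%:R^-1 * (d ^+ K.+1 * expR (K%:R *+ 4)))).
  rewrite ler_wpM2r ?mulr_ge0 ?invr_ge0 ?exprn_ge0 ?expR_ge0//.
  by rewrite -natr1 addrC expR_ge1Dx.
by rewrite mulrS expRD; ring.
Qed.

Lemma excess_eventP K w : ~ excess_event K w ->
  forall A : {set 'I_n}, (#|A| <= K)%N -> (#|induced_edges (G w) A| <= #|A|)%N.
Proof.
move=> nE A AK; rewrite leqNgt; apply/negP => /exists_subset[h [hi hA]]; apply: nE.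
apply/bigsetUP; exists (inord #|A|); first by rewrite mem_index_enum.
apply/pairs_eventP; exists A, h; rewrite inordK ?ltnS//; split=> //.
  by apply: fintype.subset_trans hi _; apply/fintype.subsetP => e; rewrite !inE => /andP[].
by apply: fintype.subset_trans hi _; apply/fintype.subsetP => e; rewrite !inE => /andP[].
Qed.

Section Stars.
Variables (psi : R -> R) (a mu : R).
Hypotheses (mpsi : measurable_fun setT psi) (a_ge0 : 0 <= a) (mu_ge0 : 0 <= mu).
Hypothesis moments : forall j : nat, (j <= 2)%N -> exists M : R,
  (\int[N01]_y (expR (a * j%:R * psi y))%:E = M%:E)%E /\ 1 <= M <= 1 + j%:R * a * mu.

Definition star_sum (U : {set 'I_n}) w : R :=
  \sum_(v in U) \sum_(e in G w | v \in val e) psi (J e w).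

Lemma card_star v : (#|[set e : edge n | v \in val e]%SET| <= n)%N.
Proof.
rewrite -(card_imset _ val_inj) -[leqRHS]card_ord -cardsT.
apply: leq_trans (leq_imset_card (fun w => [set v; w]%SET) _).
apply: subset_leq_card; apply/fintype.subsetP => B /imsetP[e ve ->].
have {}ve : v \in val e by move: ve; rewrite finset.in_set.
have /cards2P[x [y [_ exy]]] := valP e; rewrite /= in exy ve.
apply/imsetP; move: ve; rewrite exy !inE => /orP[/eqP->|/eqP->]; first by exists y; rewrite ?inE.
by exists x; rewrite ?inE// finset.setUC.
Qed.

Lemma sum_card_star (U : {set 'I_n}) :
  \sum_(e : edge n) #|(val e :&: U)%SET|%:R <= (#|U| * n)%:R :> R.
Proof.
rewrite -natr_sum ler_nat.
rewrite (eq_bigr (fun e : edge n => \sum_(v in U | v \in val e) 1)%N); last first.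
  by move=> e _; rewrite sum1_card; apply: eq_card => v; rewrite !inE andbC.
rewrite (exchange_big_dep (mem U)) /=; last by move=> e v _ /andP[].
rewrite -sum_nat_const; apply: leq_sum => v vU.
rewrite (eq_bigl (mem [set e : edge n | v \in val e]%SET)).
  by rewrite sum1_card; exact: card_star.
by move=> e; rewrite /= finset.in_set vU.
Qed.

(** The forced edges in [h] cost at most [expR (2 * a * mu)] each, wherever they lie. For the others
    [1 + p * x e] is at most an exponential linear in the multiplicity, and the multiplicities sum
    to at most [#|U| * n], where [p * n%:R = d]. *)
Lemma star_tail (h : graph n) (U : {set 'I_n}) (t : R) :
  let S := [set w | h \subset G w /\ t <= a * star_sum U w] in
  measurable S /\
  (P S <= (p ^+ #|h| * expR (2 * a * mu * #|h|%:R + a * mu * d * #|U|%:R - t))%:E)%E.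
Proof.
pose Mom j := fine (\int[N01]_y (expR (a * j%:R * psi y))%:E)%E.
have MomE j : (j <= 2)%N -> (\int[N01]_y (expR (a * j%:R * psi y))%:E = (Mom j)%:E)%E /\
    1 <= Mom j <= 1 + j%:R * a * mu.
  by move=> /moments[M [ME M1]]; rewrite /Mom ME.
pose c (e : edge n) := #|(val e :&: U)%SET|.
have c2 e : (c e <= 2)%N.
  rewrite -(eqP (valP e)); apply: subset_leq_card; exact: finset.subsetIl.
pose x e := Mom (c e) - 1.
have x0 e : 0 <= x e by rewrite subr_ge0; have [_ /andP[]] := MomE _ (c2 e).
have xle e : x e <= (c e)%:R * a * mu.
  by have [_ /andP[_]] := MomE _ (c2 e); rewrite /x lerBlDl.
have [|mS PS] := @coupling_tail _ _ _ P n p G er J gc psi mpsi h c a t x.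
  by move=> e; have [-> _] := MomE _ (c2 e); rewrite /x addrC subrK.
have SE : [set w | h \subset G w /\ t <= a * star_sum U w] =
    [set w | h \subset G w /\ t <= a * \sum_(e in G w) (c e)%:R * psi (J e w)].
  by apply/seteqP; split=> w /= []; rewrite /star_sum sum_star_edges.
rewrite SE; split=> //; apply: le_trans PS _; rewrite lee_fin.
rewrite mulrC -!mulrA ler_wpM2l ?exprn_ge0// !expRD !mulrA; apply: ler_wpM2r; first exact: expR_ge0.
apply: ler_pM.
- by rewrite prodr_ge0// => e _; rewrite addr_ge0.
- by rewrite prodr_ge0// => e _; rewrite addr_ge0 ?mulr_ge0.
- apply: (@le_trans _ _ (\prod_(e in h) expR (2 * a * mu))).
    apply: ler_prod => e _; rewrite addr_ge0//=.
    apply: le_trans (expR_ge1Dx _); rewrite lerD2l; apply: le_trans (xle e) _.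
    by rewrite -!mulrA ler_wpM2r ?mulr_ge0// ler_nat.
  by rewrite prodr_const -expRM_natr.
- apply: (@le_trans _ _ (\prod_(e : edge n | e \notin h) expR (p * (a * mu) * (c e)%:R))).
    apply: ler_prod => e _; rewrite addr_ge0 ?mulr_ge0//=.
    apply: le_trans (expR_ge1Dx _); rewrite lerD2l -[leRHS]mulrA ler_wpM2l//.
    by apply: le_trans (xle e) _; rewrite -mulrA mulrC.
  rewrite -expR_sum ler_expR -mulr_sumr.
  apply: (@le_trans _ _ (p * (a * mu) * (#|U| * n)%:R)).
    rewrite ler_wpM2l ?mulr_ge0//; apply: le_trans (sum_card_star U).
    by rewrite [leRHS](bigID (fun e => e \notin h)) /= lerDl sumr_ge0.
  rewrite natrM [leLHS](_ : _ = a * mu * d * #|U|%:R * (n%:R / n%:R)); last by ring.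
  by rewrite divff ?mulr1// gt_eqF.
Qed.

(** For a set of size [k] this pays for [d ^+ k] (tree edges), [expR (2 * k%:R)] (choice of vertices
    and edges), [expR k%:R] (the [2 ^ k] choices of [U]) and [expR (2 * a * mu * k%:R)] (forced
    edges). The union bound has one spare factor [n], so [3 * ln n%:R] leaves [n%:R^-1 ^+ 2], enough
    to sum over the sizes. *)
Definition star_rate (k : nat) : R := k%:R * (ln d + 3 + 2 * a * mu) + 3 * ln n%:R.

(* The edge set h with #|A| - 1 edges stands for a spanning tree of A. *)
Definition star_part (k : nat) : set T :=
  pairs_event k.+1 k (fun A h =>
    \big[setU/set0]_(U in powerset A) [set w | h \subset G w /\
       a * mu * d * #|U|%:R + star_rate k.+1 <= a * star_sum U w]).

Definition star_event : set T := \big[setU/set0]_(k : 'I_n) star_part k.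

Lemma star_term k :
  n%:R ^+ k.+1 / k.+1`!%:R * ((k.+1 ^ 2)%:R ^+ k / k`!%:R *
     (expR k.+1%:R * (p ^+ k * expR (2 * a * mu * k%:R - star_rate k.+1)))) <= n%:R^-1 ^+ 2.
Proof.
have -> : n%:R ^+ k.+1 / k.+1`!%:R * ((k.+1 ^ 2)%:R ^+ k / k`!%:R *
     (expR k.+1%:R * (p ^+ k * expR (2 * a * mu * k%:R - star_rate k.+1)))) =
  (k.+1%:R ^+ k.+1 / k.+1`!%:R) ^+ 2 / k.+1%:R * n%:R * d ^+ k *
     (expR k.+1%:R * expR (2 * a * mu * k%:R - star_rate k.+1)).
  have -> : (k.+1 ^ 2)%:R ^+ k = (k.+1%:R ^+ k) ^+ 2 :> R by rewrite natrX -!exprM mulnC.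
  rewrite factS natrM [p ^+ _]expr_div_n ![_ ^+ k.+1]exprS.
  have h1 : k`!%:R != 0 :> R by rewrite pnatr_eq0 -lt0n fact_gt0.
  have h2 : k.+1%:R != 0 :> R by rewrite pnatr_eq0.
  have h3 : n%:R ^+ k != 0 :> R by rewrite expf_neq0// gt_eqF.
  move: (expR _) (expR _) => E1 E2.
  move: (k.+1%:R ^+ k : R) (d ^+ k) => KK D.
  move: (n%:R ^+ k : R) (k`!%:R : R) (k.+1%:R : R) (n%:R : R) h1 h2 h3 => N f k1 m h1 h2 h3.
  by field; rewrite h1 h2 h3.
have e1 : (k.+1%:R ^+ k.+1 / k.+1`!%:R) ^+ 2 / k.+1%:R <= expR (2 * k.+1%:R) :> R.
  apply: (@le_trans _ _ ((k.+1%:R ^+ k.+1 / k.+1`!%:R) ^+ 2)).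
    by rewrite ler_piMr ?sqr_ge0// invf_le1 ?ltr0Sn// ler1n.
  by rewrite expRM_natl !expr2 ler_pM ?divr_ge0 ?exprn_ge0//; exact: expn_fact.
have nE : n%:R = expR (ln n%:R) :> R by rewrite lnK// posrE.
have dE : d ^+ k <= expR (k.+1%:R * ln d).
  rewrite expRM_natl lnK ?posrE//; exact: ler_weXn2l.
apply: (@le_trans _ _ (expR (2 * k.+1%:R) * expR (ln n%:R) * expR (k.+1%:R * ln d) *
   (expR k.+1%:R * expR (2 * a * mu * k%:R - star_rate k.+1)))).
  rewrite ler_wpM2r ?mulr_ge0 ?expR_ge0//; apply: ler_pM => //.
  - exact: exprn_ge0.
  - by rewrite -nE ler_wpM2r.
rewrite [in leRHS]nE -expRN -expRM_natl -!expRD ler_expR /star_rate.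
have am : 0 <= a * mu by exact: mulr_ge0.
have : k%:R <= k.+1%:R :> R by rewrite ler_nat.
move=> /(ler_wpM2l am).
move: (k.+1%:R : R) (k%:R : R) (ln n%:R) (ln d) => K1 K0 L D h.
have -> : 2 * a * mu * K0 = 2 * (a * mu * K0) by ring.
have -> : K1 * (D + 3 + 2 * a * mu) = K1 * D + 3 * K1 + 2 * (a * mu * K1) by ring.
lra.
Qed.

Lemma star_bound : measurable star_event /\ (P star_event <= (n%:R^-1)%:E)%E.
Proof.
have term (k : 'I_n) : true ->
    measurable (star_part k) /\
    (P (star_part k) <= (n%:R^-1 ^+ 2)%:E)%E.
  move=> _; have [||mE PE] := @pairs_bound k.+1 k (fun A h =>
    \big[setU/set0]_(U in powerset A) [set w | h \subset G w /\
       a * mu * d * #|U|%:R + star_rate k.+1 <= a * star_sum U w])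
    (expR k.+1%:R * (p ^+ k * expR (2 * a * mu * k%:R - star_rate k.+1))).
  - by rewrite mulr_ge0 ?mulr_ge0 ?exprn_ge0 ?expR_ge0.
  - move=> A h Ak hA hk; apply: union_bound_card.
    + move=> U _; have [mS PS] := star_tail h U (a * mu * d * #|U|%:R + star_rate k.+1).
      split=> //; apply: le_trans PS _; rewrite lee_fin hk le_eqVlt; apply/orP; left; apply/eqP.
      by congr (_ * expR _); ring.
    + rewrite card_powerset Ak natrX -[X in expR X]mulr1 expRM_natl lerXn2r ?nnegrE ?expR_ge0//.
      exact: le_trans (expR_ge1Dx 1).
    + by rewrite mulr_ge0 ?exprn_ge0 ?expR_ge0.
  by split=> //; apply: le_trans PE _; rewrite lee_fin; exact: star_term.
have [||mE PE] := @union_bound _ _ _ P 'I_n (fun k : 'I_n => star_part k) xpredT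
  (fun=> n%:R^-1 ^+ 2).
- by move=> k kt; have [] := term k kt.
- by move=> k kt; have [_] := term k kt.
split=> //; apply: le_trans PE _; rewrite lee_fin sumr_const card_ord -[leLHS]mulr_natl.
by rewrite expr2 mulrA divff ?mul1r// gt_eqF.
Qed.

Lemma star_eventP w : ~ star_event w -> forall A U : {set 'I_n}, (0 < #|A|)%N ->
  (#|A| <= #|induced_edges (G w) A|.+1)%N -> U \subset A ->
  a * star_sum U w < a * mu * d * #|U|%:R + star_rate #|A|.
Proof.
move=> nE A U A0 Ae UA; rewrite ltNge; apply/negP => le; apply: nE.
have Ap : (#|A|.-1 < n)%N.
  by rewrite prednK// -[leqRHS]card_ord max_card.
have [h [hi hA]] : exists h : graph n, h \subset induced_edges (G w) A /\ #|h| = #|A|.-1.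
  by apply: exists_subset; rewrite -ltnS prednK.
apply/bigsetUP; exists (Ordinal Ap); first by rewrite mem_index_enum.
apply/pairs_eventP; exists A, h; rewrite /= prednK//; split=> //.
  by apply: fintype.subset_trans hi _; apply/fintype.subsetP => e; rewrite !inE => /andP[].
apply/bigsetUP; exists U; first by rewrite mem_index_enum powersetE.
split=> //.
by apply: fintype.subset_trans hi _; apply/fintype.subsetP => e; rewrite !inE => /andP[].
Qed.

End Stars.

Definition range_event (delta r : R) : set T :=
  \big[setU/set0]_(e : edge n) [set w | e \in G w /\ ~ (delta <= `|J e w| <= r)].

(** The law of the couplings is applied to each graph containing [e], testing all other edges
    against the whole line; the graph weights then sum to [p]. *)
Lemma edge_coupling_prob (e : edge n) (A : set R) (b : R) : measurable A -> (N01 A <= b%:E)%E ->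
  let S := [set w | e \in G w /\ A (J e w)] in
  measurable S /\ (P S <= (p * b)%:E)%E.
Proof.
move=> mA Ab S.
pose A' (e' : edge n) : set R := if e' == e then A else setT.
have mA' (e' : edge n) : measurable (A' e') by rewrite /A'; case: ifP.
pose F (g : graph n) := [set w | G w = g] `&` \bigcap_(e in [set e | e \in g]) (J e @^-1` A' e).
have SE : S = \big[setU/set0]_(g : graph n | [set e]%SET \subset g) F g.
  apply/seteqP; split=> w.
    move=> [eG Aw]; apply/bigsetUP; exists (G w); first by rewrite mem_index_enum finset.sub1set.
    split=> // e' _; rewrite /A' /preimage /=; case: eqP => // ->.
    exact: Aw.
  move/bigsetUP => [g /andP[_]]; rewrite finset.sub1set => eg [Gw /(_ e eg)].
  by rewrite /A' /preimage /= eqxx /S /= Gw.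
have mF g : measurable (F g).
  apply: measurableI; first exact: measurable_graph_eq er _.
  apply: fin_bigcap_measurable => [|e' _]; first exact: finite_finset.
  by rewrite -[X in measurable X]setTI; exact: measurable_funP.
have [||mS PS] := @union_bound _ _ _ P _ F (fun g : graph n => [set e]%SET \subset g)
  (fun g => graph_weight P G g * b).
- by move=> g _; exact: mF.
- move=> g eg.
  apply: (@le_trans _ _ (P [set w | G w = g] * \prod_(e in g) N01 (A' e))%E).
    by rewrite -(gc g mA').
  rewrite (graph_weightE er) EFinM lee_wpmul2l//.
    by rewrite lee_fin graph_weight_ge0.
  rewrite (bigD1 e) /=; last by rewrite -finset.sub1set.
  rewrite big1 ?mule1; first by rewrite /A' eqxx.
  by move=> e' /andP[_ /negbTE ee]; rewrite /A' ee; exact: (@probability_setT _ _ _ N01).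
rewrite SE; split=> //; apply: le_trans PS _.
by rewrite -mulr_suml (sum_graph_weight er) cards1 expr1.
Qed.

Lemma range_bound (delta r : R) : 0 <= delta -> 0 <= r ->
  measurable (range_event delta r) /\
  (P (range_event delta r) <=
    (n%:R * d * (delta + Num.sqrt 2 * expR (- (r ^+ 2 / 4))))%:E)%E.
Proof.
move=> d0 r0; set b := delta + _.
have b0 : 0 <= b by rewrite addr_ge0// mulr_ge0 ?expR_ge0.
have E1 : [set x : R | ~ (delta <= `|x| <= r)] =
    [set x : R | `|x| < delta] `|` [set x : R | r < `|x|].
  apply/seteqP; split=> x /=.
    by move/negP; rewrite negb_and -!ltNge => /orP.
  by move=> h; apply/negP; rewrite negb_and -!ltNge; apply/orP.
have m1 : measurable [set x : R | `|x| < delta].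
  apply: measurable_lt => //; exact: measurable_abs.
have m2 : measurable [set x : R | r < `|x|].
  apply: measurable_lt => //; exact: measurable_abs.
pose A := [set x : R | ~ (delta <= `|x| <= r)].
have Nb : (N01 A <= b%:E)%E.
  rewrite /A E1 /b EFinD.
  pose A1 := [set x : R | `|x| < delta]; pose A2 := [set x : R | r < `|x|].
  apply: (@le_trans _ _ (N01 A1 + N01 A2)%E).
    by apply: measureU2; [exact: m1|exact: m2].
  by apply: leeD; [exact: N01_small|exact: N01_large].
have mA : measurable (A : set (Real.sort R)) by rewrite /A E1; exact: measurableU.
have [||mU PU] := @union_bound _ _ _ P _ (fun e : edge n =>
    [set w | e \in G w /\ ~ (delta <= `|J e w| <= r)]) xpredT (fun=> p * b).
- by move=> e _; have [] := edge_coupling_prob e mA Nb.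
- by move=> e _; have [_] := edge_coupling_prob e mA Nb.
split=> //; apply: le_trans PU _; rewrite lee_fin sumr_const -[leLHS]mulr_natl.
apply: (@le_trans _ _ ((n ^ 2)%:R * (p * b))).
  rewrite ler_wpM2r ?mulr_ge0// ler_nat.
  apply: leq_trans (_ : #|inner [set: 'I_n]%SET| <= _)%N.
    by apply: subset_leq_card; apply/fintype.subsetP => e _; rewrite finset.in_set finset.subsetT.
  by apply: leq_trans (card_inner _) _; rewrite cardsT card_ord.
rewrite natrX le_eqVlt; apply/orP; left; apply/eqP.
by field; rewrite gt_eqF.
Qed.

Lemma range_eventP delta r w : ~ range_event delta r w ->
  forall e, e \in G w -> delta <= `|J e w| <= r.
Proof.
move=> nE e eG; apply: contrapT => h; apply: nE; apply/bigsetUP; exists e => //.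
by rewrite mem_index_enum.
Qed.

End Bounds.

(** * Measurability of the good event *)

Section MeasurableProps.
Context (disp : measure_display) (T : measurableType disp).
Implicit Types (A B C D : T -> Prop).

Lemma measurable_propP (Q : Prop) : measurable [set w : T | Q].
Proof.
have [q|q] := pselect Q; last first.
  by rewrite (_ : [set w | Q] = set0)//; apply/seteqP; split.
by rewrite (_ : [set w | Q] = setT)//; apply/seteqP; split.
Qed.

Lemma measurable_and A B : measurable [set w | A w] -> measurable [set w | B w] ->
  measurable [set w | A w /\ B w].
Proof. exact: measurableI. Qed.

Lemma measurable_and3 A B C : measurable [set w | A w] -> measurable [set w | B w] ->
  measurable [set w | C w] -> measurable [set w | [/\ A w, B w & C w]].
Proof.
move=> mA mB mC; rewrite (_ : mkset _ = [set w | A w /\ (B w /\ C w)]).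
  by do 2 apply: measurable_and => //.
by apply/seteqP; split=> w /=; [case|case=> ? []].
Qed.

Lemma measurable_and4 A B C D : measurable [set w | A w] -> measurable [set w | B w] ->
  measurable [set w | C w] -> measurable [set w | D w] ->
  measurable [set w | [/\ A w, B w, C w & D w]].
Proof.
move=> mA mB mC mD; rewrite (_ : mkset _ = [set w | A w /\ [/\ B w, C w & D w]]).
  by apply: measurable_and => //; exact: measurable_and3.
by apply/seteqP; split=> w /=; [case|case=> ? []].
Qed.

Lemma measurable_imp (Q : Prop) A : measurable [set w | A w] ->
  measurable [set w | Q -> A w].
Proof.
move=> mA; have [q|q] := pselect Q.
  rewrite (_ : mkset _ = [set w | A w])//; apply/seteqP; split=> w /=; first exact.
  by move=> Aw _.
rewrite (_ : mkset _ = setT)//; apply/seteqP; split=> // w _ /= h.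
by case: q.
Qed.

Lemma measurable_forall (I : countType) (A : I -> T -> Prop) :
  (forall i, measurable [set w | A i w]) -> measurable [set w | forall i, A i w].
Proof.
move=> mA; rewrite (_ : mkset _ = \bigcap_k (if unpickle k is Some i then [set w | A i w] else setT)).
  by apply: bigcapT_measurable => k; case: unpickle.
apply/seteqP; split=> w /= h; first by move=> k _; case: unpickle => // i; exact: h.
by move=> i; have := h (pickle i) Logic.I; rewrite pickleK.
Qed.

Lemma measurable_exists (I : countType) (A : I -> T -> Prop) :
  (forall i, measurable [set w | A i w]) -> measurable [set w | exists i, A i w].
Proof.
move=> mA; rewrite (_ : mkset _ = ~` [set w | forall i, ~ A i w]).
  apply: measurableC; apply: measurable_forall => i; exact: (measurableC (mA i)).
apply/seteqP; split=> w /=; first by move=> [i Ai] /(_ i).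
by move=> h; apply: contrapT => no; apply: h => i Ai; apply: no; exists i.
Qed.

End MeasurableProps.

Section MeasurableGood.
Context (R : realType) (disp : measure_display) (T : measurableType disp).
Variables (n : nat) (J : edge n -> T -> R) (beta d eps : R).
Hypothesis mJ : forall e, measurable_fun setT (J e).

Lemma measurable_influence e :
  measurable_fun setT (fun w => influence (fun e => J e w) beta e).
Proof.
pose phi (x : R) := `|1 - expR (beta * x)| / (1 + expR (beta * x)).
have cE : continuous (fun x : R => expR (beta * x)).
  move=> x; apply: (@continuous_comp _ _ _ (fun x : R => beta * x) expR).
    by apply: cvgM; [exact: cvg_cst|exact: cvg_id].
  exact: continuous_expR.
have cphi : continuous phi.
  move=> x; apply: cvgM.
    apply: (@continuous_comp _ _ _ (fun x : R => 1 - expR (beta * x)) (fun y : R => `|y|)).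
      by apply: cvgB; [exact: cvg_cst|exact: cE].
    exact: norm_continuous.
  apply: cvgV; first by rewrite gt_eqF// ltr_wpDl// expR_gt0.
  by apply: cvgD; [exact: cvg_cst|exact: cE].
exact: (measurableT_comp (continuous_measurable_fun cphi) (mJ e)).
Qed.

Variable g : graph n.
Local Notation Jw w := (fun e => J e w).

Lemma measurable_agg u : measurable_fun setT (fun w => agg_influence g (Jw w) beta u).
Proof. by apply: measurable_bigsum => e _; exact: measurable_influence. Qed.

Lemma measurable_vertex_weight u :
  measurable_fun setT (fun w => vertex_weight g (Jw w) beta d eps u).
Proof.
have mA := measurable_le (measurable_agg u) (measurable_cst (1 - eps / 2)).
rewrite (_ : (fun w => _) = fun w =>
    \1_[set w | agg_influence g (Jw w) beta u <= 1 - eps / 2] w * (1 - eps / 4) +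
    (1 - \1_[set w | agg_influence g (Jw w) beta u <= 1 - eps / 2] w) *
      (d * agg_influence g (Jw w) beta u)).
  have mI : measurable_fun setT (\1_[set w | agg_influence g (Jw w) beta u <= 1 - eps / 2] : T -> R).
    exact: measurable_indic.
  apply: measurable_funD; apply: measurable_funM => //.
    exact: measurable_funB.
  by apply: measurable_funM => //; exact: measurable_agg.
apply/funext => w; rewrite /vertex_weight indicE; case: ifPn => h.
  by rewrite mem_set//= mul1r subrr mul0r addr0.
by rewrite memNset ?mul0r ?subr0 ?mul1r ?add0r//; exact/negP.
Qed.

Lemma measurable_path_weight u p :
  measurable_fun setT (fun w => path_weight g (Jw w) beta d eps u p).
Proof. by apply: measurable_bigprod => v _; exact: measurable_vertex_weight. Qed.

Lemma measurable_block_vertex u :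
  measurable [set w | block_vertex g (Jw w) beta d eps u].
Proof.
apply: measurable_forall => p; do 2 apply: measurable_imp.
by apply: measurable_lt => //; exact: measurable_path_weight.
Qed.

Lemma measurable_upsilon u p : measurable_fun setT (fun w => upsilon g (Jw w) beta u p).
Proof.
apply: measurable_funD => //; apply: measurable_funM => //.
by apply: measurable_bigsum => e _; apply: measurableT_comp.
Qed.

Lemma measurable_block_partition Bs :
  measurable [set w | block_partition g (Jw w) beta d eps Bs].
Proof.
apply: measurable_and; first exact: measurable_propP.
apply: measurable_forall => B; apply: measurable_imp; apply: measurable_and3.
- exact: measurable_propP.
- apply: measurable_imp; apply: measurable_and4; try exact: measurable_propP.
  by apply: measurable_forall => v; apply: measurable_imp; exact: measurable_block_vertex.
- apply: measurable_imp; apply: measurable_forall => u; apply: measurable_imp.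
  exact: measurable_block_vertex.
Qed.

Lemma measurable_good_fixed :
  measurable [set w | good_instance g (Jw w) beta d eps].
Proof.
apply: measurable_and4.
- exact: measurable_propP.
- by apply: measurable_exists => Bs; exact: measurable_block_partition.
- apply: measurable_forall => u; apply: measurable_forall => p.
  do 2 apply: measurable_imp.
  by apply: measurable_le => //; exact: measurable_upsilon.
- apply: measurable_forall => e; apply: measurable_imp.
  have mN : measurable_fun setT (fun w => `|J e w|).
    exact: measurableT_comp.
  rewrite (_ : mkset _ = [set w | n%:R `^ (- (7 / 3)) <= `|J e w| /\
      `|J e w| <= 10 * Num.sqrt (ln n%:R)]).
    by apply: measurable_and; exact: measurable_le.
  by apply/seteqP; split=> w /andP.
Qed.

End MeasurableGood.

(** Once the graph is frozen to one of finitely many values, each condition is a countable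
    combination of comparisons between measurable functions of the couplings. *)
Lemma measurable_good (R : realType) (disp : measure_display) (T : measurableType disp)
    (n : nat) (G : T -> graph n) (J : edge n -> T -> R) (beta d eps : R) :
  (forall g, measurable [set w | G w = g]) -> (forall e, measurable_fun setT (J e)) ->
  measurable [set w | good_instance (G w) (fun e => J e w) beta d eps].
Proof.
move=> mG mJ; rewrite (_ : mkset _ = \big[setU/set0]_(g : graph n)
    ([set w | G w = g] `&` [set w | good_instance g (fun e => J e w) beta d eps])).
  by apply: bigsetU_measurable => g _; apply: measurableI => //; exact: measurable_good_fixed.
apply/seteqP; split=> w; last by move/bigsetUP => [g _ [/= -> ]].
by move=> h; apply/bigsetUP; exists (G w); rewrite ?mem_index_enum.
Qed.

(** * Vertex weights and the good event *)

Section Elementary.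
Variable R : realType.
Implicit Types x y : R.

Lemma ln_leB1 x : 0 < x -> ln x <= x - 1.
Proof. by move=> x0; have := expR_ge1Dx (ln x); rewrite lnK ?posrE//; lra. Qed.

(** Mean value theorem for the difference of the two sides: its derivative [c * expR c + 1 - expR c]
    is nonnegative since [expR (- c) >= 1 - c]. *)
Lemma expR_sub1_le x : 0 <= x -> 2 * (expR x - 1) <= x * (expR x + 1).
Proof.
rewrite le_eqVlt => /predU1P[<-|x0]; first by rewrite expR0 subrr mulr0 mul0r.
pose f (y : R) : R := y * (expR y + 1) - 2 * (expR y - 1).
have df (y : R) : is_derive y (1 : R) f (y * expR y + (expR y + 1) - 2 * expR y).
  by apply: is_derive_eq; rewrite /GRing.scale /=; ring.
have cf : {within `[0, x], continuous f}.
  by apply: derivable_within_continuous => y _; have [] := df y.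
have [c cx E] := MVT x0 (fun y _ => df y) cf.
have f0 : f 0 = 0 by rewrite /f expR0; ring.
move: E; rewrite f0 !subr0 /f => E.
suff : 0 <= c * expR c + (expR c + 1) - 2 * expR c.
  by move=> h; have := mulr_ge0 h (ltW x0); rewrite -E subr_ge0.
have h := expR_ge1Dx (- c); have : expR c * (1 - c) <= 1.
  by rewrite -[leRHS](expRxMexpNx_1 c) ler_pM2l ?expR_gt0.
by rewrite mulrBr mulr1 mulrC; lra.
Qed.

(* The influence is |tanh (x / 2)|. *)
Lemma influence_le_half x : `|1 - expR x| / (1 + expR x) <= `|x| / 2.
Proof.
wlog x0 : x / 0 <= x => [H|].
  have [/H//|x0] := leP 0 x.
  have := H (- x); rewrite oppr_ge0 normrN => /(_ (ltW x0)); congr (_ <= _).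
  have e0 := expR_gt0 x; rewrite expRN -(mulfK (lt0r_neq0 e0) (`|1 - _|)).
  have -> : `|1 - (expR x)^-1| * expR x = `|1 - expR x|.
    by rewrite -{2}(gtr0_norm e0) -normrM mulrBl mul1r mulVf ?lt0r_neq0// distrC.
  have h : expR x + 1 != 0 by rewrite lt0r_neq0// addr_gt0.
  set X := `|_|; rewrite -[X / _ / _]mulrA -invfM mulrDr mulr1 mulfV ?lt0r_neq0//.
  by rewrite [expR x + 1]addrC.
have e1 : 1 <= expR x by rewrite -expR0 ler_expR.
rewrite (ger0_norm x0) distrC ger0_norm ?subr_ge0//.
rewrite ler_pdivrMr ?ltr_wpDr ?expR_ge0//; have := expR_sub1_le x0.
by rewrite addrC; lra.
Qed.

(** The identity [rho * sg = 2] is the criticality of [beta_c]: at [beta = sg / d] the bound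
    [beta * rho / 2] on the mean influence of an edge equals [1 / d]. *)
Lemma sqrt_2pi_bounds (rho := Num.sqrt (2 / pi) : R) (sg := Num.sqrt (2 * pi) : R) :
  [/\ 0 < rho, rho <= 1, 0 < sg & rho * sg = 2].
Proof.
have p2 := pi_ge2 R; have p0 := pi_gt0 R.
rewrite /rho /sg; split; rewrite ?sqrtr_gt0 ?divr_gt0 ?mulr_gt0//.
  by rewrite -[leRHS]sqrtr1 ler_wsqrtr// ler_pdivrMr// mul1r.
rewrite -sqrtrM ?divr_ge0 ?pi_ge0// mulrACA (mulrC _ pi) mulfV ?mulr1 ?lt0r_neq0//.
by rewrite -expr2 sqrtr_sqr ger0_norm.
Qed.

(** The function [ln t / t] decreases beyond [expR 1]. *)
Lemma ln_ratio x y : expR 1 <= y -> y <= x -> y * ln x <= x * ln y.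
Proof.
move=> ey yx; have y0 : 0 < y by apply: lt_le_trans ey; exact: expR_gt0.
have ly : 1 <= ln y by rewrite -[leLHS]expRK ler_ln ?posrE ?expR_gt0.
have xy : 0 < x / y by rewrite divr_gt0// (lt_le_trans y0).
have -> : ln x = ln y + ln (x / y).
  by rewrite -lnM ?posrE// mulrCA divff ?mulr1// lt0r_neq0.
have h := ler_wpM2l (ltW y0) (ln_leB1 xy).
have E : y * (x / y - 1) = x - y by rewrite mulrBr mulr1 mulrCA divff ?mulr1// lt0r_neq0.
have := mulr_ge0 (_ : 0 <= x - y) (_ : 0 <= ln y - 1); rewrite !subr_ge0 => /(_ yx ly).
rewrite E in h; rewrite mulrDr; nra.
Qed.

End Elementary.

(** * Good instances from the complement of the bad events *)

Section Deterministic.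
Context (R : realType) (n : nat) (g : graph n) (J : edge n -> R).
Variables (eps d beta a : R) (m r : nat).
Let L := ln d.
Let lam : R := ln n%:R.
Let rho : R := Num.sqrt (2 / pi).
Let sg : R := Num.sqrt (2 * pi).
Let mu := rho * (1 + eps / 4).
Let kap := eps ^+ 2 * d / (64 * L).
Let c1 := L + 3 + 2 * a * mu.
Let c2 := L + 3 + expR 1.
Hypotheses (eps_gt0 : 0 < eps) (eps_lt1 : eps < 1) (a_gt0 : 0 < a).
Hypotheses (beta_gt0 : 0 < beta) (beta_le : beta <= (1 - eps) * beta_c d).
Hypotheses (L16 : 16 <= L) (d8 : 2 * expR 1 <= d).
Hypotheses (C1 : 4 * c1 <= a * rho * kap) (C2 : 24 * L ^+ 4 <= a * rho * kap).
Hypotheses (C3 : 16 * sg * mu <= L ^+ 2) (C4 : 16 * sg * c1 <= a * d * L ^+ 2).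
Hypotheses (C5 : 24 * sg * L ^+ 2 <= a * d) (C6 : 16 * expR 1 <= L ^+ 2).
Hypotheses (C7 : 32 * c2 <= d * L ^+ 2) (C8 : 48 * L ^+ 2 <= d).
Hypotheses (m_le : m%:R <= lam / L ^+ 4) (m_ge : lam / L ^+ 4 <= 2 * m%:R).
Hypotheses (lam_ge : 1 <= lam / L ^+ 4) (lam_ge1 : 1 <= lam).
Hypotheses (r_lt : (r < m)%N) (r_ge : L ^+ 5 <= r.+1%:R).

Let star (f : edge n -> R) (U : {set 'I_n}) : R :=
  \sum_(v in U) \sum_(e in g | v \in val e) f e.

Hypothesis H1 : forall A : {set 'I_n}, (#|A| <= 36 * m)%N ->
  (#|induced_edges g A| <= #|A|)%N.
Hypothesis H2 : forall A U : {set 'I_n}, (0 < #|A|)%N ->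
  (#|A| <= #|induced_edges g A|.+1)%N -> U \subset A ->
  a * star (fun e => `|J e|) U < a * mu * d * #|U|%:R + (#|A|%:R * c1 + 3 * lam).
Hypothesis H3 : forall A : {set 'I_n}, (0 < #|A|)%N ->
  (#|A| <= #|induced_edges g A|.+1)%N ->
  2^-1 * star (fun=> 1) A < 2^-1 * expR 1 * d * #|A|%:R + (#|A|%:R * c2 + 3 * lam).
Hypothesis H4 : forall e, e \in g ->
  n%:R `^ (- (7 / 3)) <= `|J e| <= 10 * Num.sqrt (ln n%:R).

Local Notation agg := (agg_influence g J beta).
Local Notation wt := (vertex_weight g J beta d eps).

Let d_gt0 : 0 < d. Proof. by apply: lt_le_trans d8; rewrite mulr_gt0 ?expR_gt0. Qed.
Let rho_gt0 : 0 < rho. Proof. by have [] := sqrt_2pi_bounds R. Qed.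
Let sg_gt0 : 0 < sg. Proof. by have [] := sqrt_2pi_bounds R. Qed.
Let rho_sg : rho * sg = 2. Proof. by have [] := sqrt_2pi_bounds R. Qed.
Let L_gt0 : 0 < L. Proof. by apply: lt_le_trans L16. Qed.
Let d_ge4 : 4 <= d.
Proof. by apply: le_trans d8; have := expR_ge1Dx (1 : R); lra. Qed.
Let kap_gt0 : 0 < kap.
Proof. by rewrite divr_gt0// mulr_gt0// exprn_gt0. Qed.

Let agg_ge0 v : 0 <= agg v.
Proof. by apply: sumr_ge0 => e _; rewrite divr_ge0// addr_ge0// expR_ge0. Qed.

Lemma rho_agg_le v : rho * (d * agg v) <=
  (1 - eps) * \sum_(e in g | v \in val e) `|J e|.
Proof.
apply: (@le_trans _ _ (rho * (d * (\sum_(e in g | v \in val e) beta / 2 * `|J e|)))).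
  rewrite ler_wpM2l ?(ltW rho_gt0)// ler_wpM2l ?(ltW d_gt0)//; apply: ler_sum => e _.
  apply: le_trans (influence_le_half _) _.
  by rewrite normrM (gtr0_norm beta_gt0) mulrAC.
rewrite -mulr_sumr; set S := \sum_(e in g | _) _.
have S0 : 0 <= S by exact: sumr_ge0.
rewrite !mulrA ler_wpM2r//.
have -> : 1 - eps = rho * d * ((1 - eps) * beta_c d) / 2.
  rewrite /beta_c -/sg.
  have -> : rho * d * ((1 - eps) * (sg / d)) / 2 = (1 - eps) * (rho * sg) / 2 * (d / d) by ring.
  by rewrite rho_sg divff ?lt0r_neq0// mulr1 mulfK.
by rewrite ler_wpM2r ?invr_ge0// ler_wpM2l// mulr_ge0 ?(ltW rho_gt0) ?(ltW d_gt0).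
Qed.

Definition heavy v := 1 - eps / 2 < agg v.
(* By mass_ln the mass dominates an affine function of the logarithm of the
   vertex weight, while being affine in the aggregate influence: a path of weight
   at least 1 has large mass, and the star bounds limit the mass of large sets. *)
Definition mass v : R := if heavy v then d * agg v - d * (1 - 3 * eps / 4) else 0.

Lemma wt_heavy v : heavy v -> wt v = d * agg v.
Proof. by rewrite /heavy /vertex_weight ltNge => /negbTE ->. Qed.

Lemma wt_light v : ~~ heavy v -> wt v = 1 - eps / 4.
Proof. by rewrite /heavy /vertex_weight -leNgt => ->. Qed.

Lemma heavy_ge v : heavy v -> d / 2 <= d * agg v.
Proof.
by move=> h; rewrite ler_wpM2l ?(ltW d_gt0)//; apply: le_trans (ltW h); move: eps_lt1; lra.
Qed.

(** Above the threshold [1 - eps / 2] the subtracted [1 - 3 * eps / 4] is at most the share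
    [1 - eps / 4] of the influence. *)
Lemma mass_ge v : heavy v -> eps / 4 * (d * agg v) <= mass v.
Proof.
move=> h; rewrite /mass h; have hv := ltW h.
have : (1 - eps / 2) * (1 - eps / 4) * d <= agg v * (1 - eps / 4) * d.
  by rewrite ler_wpM2r ?(ltW d_gt0)// ler_wpM2r//; move: eps_lt1; lra.
have : 0 <= eps ^+ 2 / 8 * d by rewrite mulr_ge0 ?(ltW d_gt0)// divr_ge0 ?sqr_ge0.
rewrite expr2; nra.
Qed.

Lemma mass_ge0 v : 0 <= mass v.
Proof.
have [h|h] := boolP (heavy v); last by rewrite /mass (negbTE h).
by apply: le_trans (mass_ge h); rewrite !mulr_ge0 ?(ltW d_gt0) ?(ltW eps_gt0).
Qed.

Lemma wt_gt0 v : 0 < wt v.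
Proof.
have [h|h] := boolP (heavy v).
  by rewrite wt_heavy// (lt_le_trans _ (heavy_ge h))// divr_gt0.
by rewrite wt_light//; move: eps_lt1; lra.
Qed.

(** The slope [4 * kap / eps] makes the left side nonpositive at the light weight [1 - eps / 4]. For
    a heavy vertex the weight is at least [d / 2], and by [ln_ratio] its logarithm is at most a
    multiple [2 * L / d] of it; [kap] is small enough for [mass_ge] to absorb this. *)
Lemma mass_ln v : kap + 4 * kap / eps * ln (wt v) <= mass v.
Proof.
have [h|h] := boolP (heavy v); last first.
  rewrite /mass (negbTE h) wt_light//.
  have l : ln (1 - eps / 4) <= - (eps / 4).
    by apply: le_trans (ln_leB1 _) _; move: eps_lt1; lra.
  have k4 : 0 <= 4 * kap / eps.
    by rewrite mulr_ge0 ?invr_ge0 ?(ltW eps_gt0)// mulr_ge0 ?(ltW kap_gt0).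
  have := ler_wpM2l k4 l.
  have -> : 4 * kap / eps * - (eps / 4) = - kap * (eps / eps) by field; rewrite lt0r_neq0.
  by rewrite divff ?lt0r_neq0// mulr1; lra.
apply: le_trans (mass_ge h); rewrite wt_heavy//; set x := d * agg v.
have xd : d / 2 <= x by exact: heavy_ge.
have ed : expR 1 <= d / 2 by rewrite ler_pdivlMr// mulrC.
have l1 : 1 <= ln x.
  rewrite -[leLHS]expRK ler_ln ?posrE ?expR_gt0//; first exact: le_trans xd.
  by apply: lt_le_trans xd; rewrite divr_gt0.
have lr := ln_ratio ed xd.
have lL : ln (d / 2) <= L by rewrite ler_ln ?posrE ?divr_gt0// ler_pdivrMr//; move: d_gt0; lra.
have x0 : 0 <= x by apply: le_trans xd; rewrite divr_ge0 ?(ltW d_gt0).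
have dlx : d * ln x <= 2 * (x * L).
  have := ler_wpM2l x0 lL; rewrite [d / 2 * _]mulrAC in lr; move: lr; lra.
have kE : kap * L * 64 = eps ^+ 2 * d by rewrite /kap; field; rewrite lt0r_neq0.
rewrite -(ler_pM2r L_gt0) -(ler_pM2r (_ : 0 < 64 * eps)); last by rewrite mulr_gt0.
have -> : (kap + 4 * kap / eps * ln x) * L * (64 * eps) = (kap * L * 64) * (eps + 4 * ln x).
  by field; rewrite lt0r_neq0.
rewrite kE.
have -> : eps / 4 * x * L * (64 * eps) = eps ^+ 2 * (16 * (x * L)) by field.
rewrite -mulrA ler_wpM2l ?sqr_ge0//.
have : d * eps <= d * ln x by rewrite ler_wpM2l ?(ltW d_gt0)//; move: eps_lt1; lra.
have := mulr_ge0 x0 (ltW L_gt0); rewrite mulrDr; nra.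
Qed.

Local Notation weight := (path_weight g J beta d eps).

(** Paths of length 0 are left out so that every set has two vertices; [not_heavy_block] recovers
    them. *)
Definition heavy_paths : {set {set 'I_n}} :=
  [set P | `[< exists u p, [/\ is_path g u p, (0 < size p)%N, (size p)%:R <= lam,
     1 <= weight u p & P = [set x in u :: p]%SET] >]]%SET.

Lemma heavy_pathsP P : P \in heavy_paths -> exists u p,
  [/\ is_path g u p, (0 < size p)%N, (size p)%:R <= lam,
     1 <= weight u p & P = [set x in u :: p]%SET].
Proof. by rewrite finset.in_set => /asboolP. Qed.

Lemma sum_path_set (f : 'I_n -> R) (s : seq 'I_n) : uniq s ->
  \sum_(v in [set x in s]%SET) f v = \sum_(v <- s) f v.
Proof. by move=> us; rewrite [RHS]big_uniq//; apply: eq_bigl => v; rewrite inE. Qed.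

Lemma card_path_set (s : seq 'I_n) : uniq s -> #|[set x in s]%SET| = size s.
Proof. by move=> us; rewrite cardsE; apply/card_uniqP. Qed.

(** Summing [mass_ln] along the path, the logarithms add up to that of the path weight, which is
    nonnegative. *)
Lemma heavy_paths_mass P : P \in heavy_paths -> kap * #|P|%:R <= \sum_(v in P) mass v.
Proof.
move=> /heavy_pathsP[u [p [/andP[up uq] _ _ w1 ->]]].
rewrite sum_path_set// card_path_set//.
apply: (@le_trans _ _ (\sum_(v <- u :: p) (kap + 4 * kap / eps * ln (wt v)))); last first.
  by apply: ler_sum => v _; exact: mass_ln.
have -> : kap * (size (u :: p))%:R = \sum_(v <- u :: p) kap.
  by rewrite big_const_seq count_predT iter_addr_0 mulr_natr.
rewrite big_split lerDl -mulr_sumr.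
have k4 : 0 <= 4 * kap / eps.
  by rewrite mulr_ge0 ?invr_ge0 ?(ltW eps_gt0)// mulr_ge0 ?(ltW kap_gt0).
apply: mulr_ge0 => //.
rewrite -ler_expR expR0 expR_sum; apply: le_trans w1 _.
rewrite le_eqVlt; apply/orP; left; apply/eqP; apply: eq_bigr => v _.
by rewrite lnK// posrE; exact: wt_gt0.
Qed.

(** [H2] is applied with [U] the heavy vertices of [T]. Since [(1 - eps) * (1 + eps / 4) <= 1 - 3 *
    eps / 4], the terms in [#|U|] cancel and only the entropy cost of [T] remains. *)
Lemma conn_mass_small T : conn g T -> T != finset.set0 ->
  kap * #|T|%:R <= 2 * \sum_(v in T) mass v -> (#|T| <= m)%N.
Proof.
move=> cT T0 hT; have Tgt : (0 < #|T|)%N by rewrite card_gt0.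
pose U := [set v in T | heavy v]%SET.
have UT : U \subset T by apply/fintype.subsetP => v; rewrite finset.in_set => /andP[].
have h2 := H2 Tgt (conn_edges cT) UT.
have ME : rho * \sum_(v in T) mass v <=
    (1 - eps) * star (fun e => `|J e|) U - rho * d * (1 - 3 * eps / 4) * #|U|%:R.
  have -> : \sum_(v in T) mass v = \sum_(v in U) (d * agg v - d * (1 - 3 * eps / 4)).
    rewrite (bigID heavy) /= [X in _ + X]big1 ?addr0.
      by apply: eq_big => [v|v /andP[_ hv]]; rewrite ?finset.in_set// /mass hv.
    by move=> v /andP[_ /negbTE hv]; rewrite /mass hv.
  rewrite big_split /= sumr_const mulrDr; apply: lerD.
    rewrite /star !mulr_sumr; apply: ler_sum => v _; exact: rho_agg_le.
  by rewrite -[_ *+ #|U|]mulr_natr le_eqVlt; apply/orP; left; apply/eqP; ring.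
have e1 : 0 <= 1 - eps by move: eps_lt1; lra.
have h3 : a * rho * \sum_(v in T) mass v <= #|T|%:R * c1 + 3 * lam.
  have := ler_wpM2l (ltW a_gt0) ME.
  have := ler_wpM2l e1 (ltW h2).
  have c10 : 0 <= c1.
    by rewrite /c1 !addr_ge0 ?(ltW L_gt0)// !mulr_ge0 ?(ltW a_gt0) ?(ltW rho_gt0)// addr_ge0// divr_ge0// ltW.
  have K0 : 0 <= #|T|%:R * c1 + 3 * lam.
    by rewrite addr_ge0 ?mulr_ge0//; move: lam_ge1; lra.
  move: (star _ U) (\sum_(v in T) mass v) (#|T|%:R * c1 + 3 * lam) K0 => Z S K K0.
  have ug : 0 <= a * rho * d * #|U|%:R * eps ^+ 2.
    by rewrite mulr_ge0 ?sqr_ge0// !mulr_ge0 ?(ltW a_gt0) ?(ltW rho_gt0) ?(ltW d_gt0).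
  have eK : 0 <= eps * K by rewrite mulr_ge0 ?(ltW eps_gt0).
  move: ug; rewrite /mu; set W := a * rho * d * #|U|%:R => ug h4 h5.
  have q1 : a * (rho * (1 + eps / 4)) * d * #|U|%:R = W * (1 + eps / 4) by rewrite /W; ring.
  have q2 : a * ((1 - eps) * Z - rho * d * (1 - 3 * eps / 4) * #|U|%:R) =
     (1 - eps) * (a * Z) - W * (1 - 3 * eps / 4) by rewrite /W; ring.
  rewrite q1 in h4; rewrite q2 mulrA in h5; rewrite expr2 in ug; nra.
have kpos : 0 < a * rho by rewrite mulr_gt0.
have h5 : a * rho * kap * #|T|%:R <= 2 * (#|T|%:R * c1 + 3 * lam).
  have := ler_wpM2l (ltW kpos) hT; move: h3; rewrite !mulrA; lra.
(* By [C1] the part of the cost linear in [#|T|] is at most half of the left side; the remaining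
   [6 * lam] doubles. *)
have h6 : a * rho * kap * #|T|%:R <= 12 * lam.
  have := ler_wpM2r (ler0n R #|T|) C1; move: h5; rewrite mulrDr; nra.
have h7 : 24 * L ^+ 4 * #|T|%:R <= 12 * lam.
  by apply: le_trans h6; rewrite ler_wpM2r.
rewrite -(ler_nat R); have L4 : 0 < L ^+ 4 by rewrite exprn_gt0.
have : 2 * #|T|%:R <= lam / L ^+ 4.
  by rewrite ler_pdivlMr//; move: h7; lra.
by move: m_ge; lra.
Qed.

(** A single vertex of weight at least 1 is heavy and so has a neighbour; the path to it has weight
    at least [d / 2 * (3 / 4) >= 1], hence is a heavy path of length 1. *)
Lemma not_heavy_block u : (forall P, P \in heavy_paths -> u \notin P) ->
  block_vertex g J beta d eps u.
Proof.
move=> nP p pp pl; rewrite ltNge; apply/negP => w1.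
have inP q : is_path g u q -> (0 < size q)%N -> (size q)%:R <= lam -> 1 <= weight u q -> False.
  move=> h1 h2 h3 h4; have /nP : [set x in u :: q]%SET \in heavy_paths.
    by rewrite finset.in_set; apply/asboolP; exists u, q.
  by rewrite inE mem_head.
case: p pp pl w1 => [|v p] pp pl w1; last exact: inP pp _ pl w1.
move: w1; rewrite /path_weight big_seq1 => w1.
have hu : heavy u.
  apply: contraT => hu; move: w1; rewrite wt_light//; move: eps_gt0; lra.
have [e eg ue] : exists2 e, e \in g & u \in val e.
  apply: contrapT => no; move: hu; rewrite /heavy /agg_influence big_pred0.
    by move: eps_lt1; lra.
  by move=> e; apply/negP => /andP[eg ue]; apply: no; exists e.
have [v uv] : exists v, adj g u v.
  have [x [y [xy ev]]] := edge_ends e; move: ue; rewrite ev !inE => /orP[]/eqP->.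
    by exists y; apply/adjP; exists e.
  by exists x; apply/adjP; exists e; rewrite // ev finset.setUC.
apply: (inP [:: v]) => //.
- rewrite /is_path /= uv !inE !andbT /=; apply/negP => /eqP E.
  by rewrite E adj_irr in uv.
rewrite /path_weight big_cons big_seq1 (wt_heavy hu).
have wv : 3 / 4 <= wt v.
  have [hv|hv] := boolP (heavy v); last by rewrite wt_light//; move: eps_lt1; lra.
  by rewrite wt_heavy//; apply: le_trans (heavy_ge hv); move: d_ge4; lra.
have h := heavy_ge hu.
apply: (@le_trans _ _ (d / 2 * (3 / 4))); first by move: d_ge4; lra.
by apply: ler_pM => //; rewrite divr_ge0// ltW.
Qed.

Lemma deg_le_star v : (deg g v)%:R <= \sum_(e in g | v \in val e) 1 :> R.
Proof.
rewrite sumr_const ler_nat /deg.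
pose f (w : 'I_n) : {set 'I_n} := [set v; w]%SET.
have inj : {in [set w | adj g v w]%SET &, injective f}.
  move=> x y; rewrite !finset.in_set => vx vy /finset.setP/(_ x); rewrite !inE eqxx orbT.
  move/esym/orP => [/eqP E|/eqP//]; by rewrite E adj_irr in vx.
rewrite -(card_in_imset inj) -[leqRHS](card_imset _ val_inj).
apply: subset_leq_card; apply/fintype.subsetP => B /imsetP[w]; rewrite finset.in_set.
move=> /adjP[e eg ev] ->; apply/imsetP; exists e; last by rewrite ev.
by rewrite unfold_in /= eg ev !inE eqxx.
Qed.

(** The path has at most [2 * Q] vertices. The target is split into eight shares [Y]; the conditions
    on [L] and [d] keep each of the seven terms [t1] to [t7] within one share, up to the common
    factor [a * d] or [d]. *)
Lemma upsilon_le u p : is_path g u p -> (size p)%:R <= lam / L ^+ 4 ->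
  upsilon g J beta u p <= lam / L ^+ 2.
Proof.
move=> /andP[up uq] pl; pose A := [set x in u :: p]%SET.
have cA : #|A| = (size p).+1 by rewrite card_path_set.
have A0 : (0 < #|A|)%N by rewrite cA.
have kle : #|A|%:R <= 2 * (lam / L ^+ 4) by rewrite cA -natr1; move: pl lam_ge; lra.
have edA := conn_edges (conn_path up).
have h2 := H2 A0 edA (fintype.subxx _); have h3 := H3 A0 edA.
pose Q := lam / L ^+ 4; pose Y := Q * L ^+ 2 / 8.
have L2 : 0 < L ^+ 2 by rewrite exprn_gt0.
have L4 : 0 < L ^+ 4 by rewrite exprn_gt0.
have Q0 : 0 <= Q by apply: le_trans lam_ge.
have lamE : lam = Q * L ^+ 4 by rewrite /Q divfK// lt0r_neq0.
have YE : lam / L ^+ 2 = 8 * Y.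
  by rewrite lamE /Y; field; rewrite lt0r_neq0.
have ad : 0 < a * d by rewrite mulr_gt0.
set K := #|A|%:R in kle h2 h3; have K0 : 0 <= K by [].
have KQ : K <= 2 * Q by [].
have s1 : beta * (\sum_(e in g | has (mem (val e)) (u :: p)) `|J e|) <= 3 * Y.
  rewrite -(ler_pM2l ad).
  have S1 : \sum_(e in g | has (mem (val e)) (u :: p)) `|J e| <= star (fun e => `|J e|) A.
    rewrite /star sum_star_edges big_mkcondr; apply: ler_sum => e eg.
    case: ifPn => [/hasP[x xp xe]|_]; last by rewrite mulr_ge0.
    rewrite ler_peMl// ler1n card_gt0; apply/finset.set0Pn; exists x.
    by rewrite !inE -in_cons xp andbT.
  have db : d * beta <= sg.
    have := ler_wpM2l (ltW d_gt0) beta_le; rewrite /beta_c -/sg => h; apply: le_trans h _.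
    rewrite (_ : d * _ = (1 - eps) * sg * (d / d)); last by ring.
    rewrite divff ?lt0r_neq0// mulr1 ler_piMl ?(ltW sg_gt0)//.
    by move: eps_gt0; lra.
  have z0 : 0 <= a * star (fun e => `|J e|) A.
    by rewrite mulr_ge0 ?(ltW a_gt0)// sumr_ge0// => v _; rewrite sumr_ge0.
  apply: (@le_trans _ _ (sg * (a * star (fun e => `|J e|) A))).
    apply: (@le_trans _ _ (d * beta * (a * star (fun e => `|J e|) A))); last exact: ler_wpM2r.
    rewrite [leLHS](_ : _ = d * beta * (a * \sum_(e in g | has (mem (val e)) (u :: p)) `|J e|)).
      by rewrite ler_wpM2l ?mulr_ge0 ?(ltW d_gt0) ?(ltW beta_gt0)// ler_wpM2l ?(ltW a_gt0).
    by ring.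
  apply: (@le_trans _ _ (sg * (a * mu * d * K + (K * c1 + 3 * lam)))).
    by rewrite ler_wpM2l ?(ltW sg_gt0)// ltW.
  have c10 : 0 <= c1.
    by rewrite /c1 !addr_ge0 ?(ltW L_gt0)// !mulr_ge0 ?(ltW a_gt0) ?(ltW rho_gt0)// addr_ge0// divr_ge0// ltW.
  have mu0 : 0 <= mu by rewrite mulr_ge0 ?(ltW rho_gt0)// addr_ge0// divr_ge0// ltW.
  have t1 : sg * (a * mu * d * K) <= a * d * Y.
    rewrite (_ : sg * _ = a * d * (sg * mu * K)); last by ring.
    rewrite ler_wpM2l ?(ltW ad)//.
    have := ler_wpM2l (mulr_ge0 (ltW sg_gt0) mu0) KQ; have := ler_wpM2r Q0 C3.
    by rewrite /Y; lra.
  have t2 : sg * (K * c1) <= a * d * Y.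
    have := ler_wpM2l (mulr_ge0 (ltW sg_gt0) c10) KQ; have := ler_wpM2r Q0 C4.
    by rewrite /Y; lra.
  have t3 : sg * (3 * lam) <= a * d * Y.
    have := ler_wpM2r (mulr_ge0 Q0 (ltW L2)) C5; rewrite /Y lamE.
    rewrite (_ : L ^+ 4 = L ^+ 2 * L ^+ 2); last by rewrite -exprD.
    by lra.
  by move: t1 t2 t3; rewrite !mulrDr; lra.
have s2 : \sum_(v <- u :: p) ln (deg g v)%:R <= 4 * Y.
  rewrite -(ler_pM2l d_gt0) mulr_sumr.
  apply: (@le_trans _ _ (\sum_(v <- u :: p) (d * L + \sum_(e in g | v \in val e) 1))).
    apply: ler_sum => v _; apply: (@le_trans _ _ (d * L + (deg g v)%:R)); last first.
      by rewrite lerD2l deg_le_star.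
    have [E|E] := posnP (deg g v).
      by rewrite E ln0// mulr0 addr0 mulr_ge0 ?(ltW d_gt0) ?(ltW L_gt0).
    have D0 : 0 < (deg g v)%:R :> R by rewrite ltr0n.
    (* Writing the degree relative to [d] and using [ln x <= x - 1] turns the sum of logarithms into
       a sum of degrees, which [H3] controls. *)
    have -> : ln (deg g v)%:R = L + ln ((deg g v)%:R / d).
      by rewrite -lnM ?posrE ?divr_gt0// mulrCA divff ?mulr1// lt0r_neq0.
    rewrite mulrDr lerD2l.
    have := ler_wpM2l (ltW d_gt0) (ln_leB1 (divr_gt0 D0 d_gt0)).
    rewrite mulrBr mulr1 mulrCA divff ?lt0r_neq0// mulr1 => h; apply: le_trans h _.
    by rewrite gerBl ltW.
  rewrite big_split /= big_const_seq count_predT iter_addr_0 -[_ *+ _]mulr_natr.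
  rewrite -(sum_path_set (fun v => \sum_(e in g | v \in val e) 1)) //.
  have -> : (size (u :: p))%:R = K by rewrite /K cA.
  have h4 : star (fun=> 1) A <= expR 1 * d * K + 2 * (K * c2 + 3 * lam).
    by move: h3; lra.
  apply: (@le_trans _ _ (d * L * K + (expR 1 * d * K + 2 * (K * c2 + 3 * lam)))).
    by rewrite lerD2l.
  have e0 := expR_gt0 (1 : R).
  have c20 : 0 <= c2 by rewrite /c2 !addr_ge0 ?(ltW L_gt0) ?(ltW e0).
  have t4 : d * L * K <= d * Y.
    rewrite -mulrA ler_wpM2l ?(ltW d_gt0)//.
    have := ler_wpM2l (ltW L_gt0) KQ; have := ler_wpM2r (mulr_ge0 (ltW L_gt0) Q0) L16.
    by rewrite /Y expr2; lra.
  have t5 : expR 1 * d * K <= d * Y.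
    rewrite mulrAC mulrC ler_wpM2l ?(ltW d_gt0)//.
    have := ler_wpM2l (ltW e0) KQ; have := ler_wpM2r Q0 C6.
    by rewrite /Y; lra.
  have t6 : 2 * (K * c2) <= d * Y.
    have := ler_wpM2l c20 KQ; have := ler_wpM2r Q0 C7.
    by rewrite /Y; lra.
  have t7 : 2 * (3 * lam) <= d * Y.
    have := ler_wpM2r (mulr_ge0 Q0 (ltW L2)) C8; rewrite /Y lamE.
    rewrite (_ : L ^+ 4 = L ^+ 2 * L ^+ 2); last by rewrite -exprD.
    by lra.
  by move: t4 t5 t6 t7; rewrite mulrDr; lra.
have Y0 : 0 <= Y by rewrite /Y divr_ge0// mulr_ge0// ltW.
by rewrite /upsilon YE; move: s1 s2 Y0; lra.
Qed.

Lemma deterministic_good : good_instance g J beta d eps.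
Proof.
have := @block_structure R n g mass kap m r heavy_paths mass_ge0 (ltW kap_gt0) r_lt _ _
  heavy_paths_mass conn_mass_small H1.
case.
- by move=> P /heavy_pathsP[u [p [/andP[up _] _ _ _ ->]]]; exact: conn_path.
- by move=> P /heavy_pathsP[u [p [/andP[_ uq] p0 _ _ ->]]]; rewrite card_path_set.
move=> Bs [part hB]; split; [by rewrite beta_gt0|exists Bs|exact: upsilon_le|exact: H4].
split=> // B /hB[tp large single]; split=> //.
  move=> /large[b1 b2 b3 b4]; split=> //.
  - by move=> w wB; apply: not_heavy_block => P; exact: b1.
  - move=> c /b3 cm; rewrite -mulrA; apply: le_trans (_ : (4 * m)%:R <= _); first by rewrite ler_nat.
    by rewrite natrM ler_wpM2l.
  - move=> c cc x p xc xp xl; apply: le_trans r_ge _; rewrite ler_nat.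
    exact: b4 cc _ _ xc xp xl.
by move=> /single h u uB; apply: not_heavy_block => P; exact: h.
Qed.

End Deterministic.

(** * Choice of constants *)

Section Numerics.
Variable R : realType.

Lemma expR1_le4 : expR 1 <= 4 :> R.
Proof.
have h := @expR_le1Du R 2^-1; have e2 : expR 2^-1 * expR 2^-1 = expR 1 :> R.
  by rewrite -expRD; congr expR; lra.
have e0 := expR_gt0 (2^-1 : R).
have h2 : expR 2^-1 <= 2 :> R by have := h ltac:(lra); lra.
rewrite -e2; nra.
Qed.

(* [ln d ^+ 6 / 6`! <= d] beats any multiple of [ln d ^+ 5] once [ln d] is large. *)
Lemma ln_pow5_le (C d : R) : 0 < d -> 0 <= ln d -> 6`!%:R * C <= ln d -> C * ln d ^+ 5 <= d.
Proof.
move=> d0 L0; have f0 : 0 < 6`!%:R :> R by rewrite ltr0n fact_gt0.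
have := @expR_ge1Dxn R (ln d) 5 L0; rewrite lnK ?posrE//.
move: (6`!%:R : R) f0 => f f0 h LC; apply: le_trans h.
apply: (@le_trans _ _ (ln d ^+ 6 / f)); last by rewrite lerDr.
by rewrite ler_pdivlMr// mulrAC [C * _]mulrC (exprS _ 5) ler_wpM2r// exprn_ge0.
Qed.

Lemma large_degree (eps a : R) (rho := Num.sqrt (2 / pi) : R) (sg := Num.sqrt (2 * pi) : R)
    (mu := rho * (1 + eps / 4)) : 0 < eps -> eps < 1 -> 0 < a -> a <= 8^-1 ->
  exists L0 : R, 16 <= L0 /\ forall d, 0 < d -> L0 <= ln d ->
  [/\ 2 * expR 1 <= d,
      4 * (ln d + 3 + 2 * a * mu) <= a * rho * (eps ^+ 2 * d / (64 * ln d)),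
      24 * ln d ^+ 4 <= a * rho * (eps ^+ 2 * d / (64 * ln d)),
      16 * sg * mu <= ln d ^+ 2 & 16 * sg * (ln d + 3 + 2 * a * mu) <= a * d * ln d ^+ 2] /\
  [/\ 24 * sg * ln d ^+ 2 <= a * d, 16 * expR 1 <= ln d ^+ 2,
      32 * (ln d + 3 + expR 1) <= d * ln d ^+ 2 & 48 * ln d ^+ 2 <= d].
Proof.
move=> e0 e1 a0 a8; have [rho0 rho1 sg0 rs] := sqrt_2pi_bounds R; rewrite -/rho -/sg in rho0 rho1 sg0 rs.
have ex4 := expR1_le4.
pose k0 := a * rho * eps ^+ 2 / 64.
have k00 : 0 < k0 by rewrite divr_gt0// mulr_gt0 ?exprn_gt0// mulr_gt0.
(* All conditions reduce to three lower bounds on [d] by multiples of [ln d ^+ 5]; each summand of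
   [C] provides one of them. *)
pose C := 48 + 24 / k0 + 32 * sg / a.
have t1 : 0 < 24 / k0 by rewrite divr_gt0.
have t2 : 0 < 32 * sg / a by rewrite divr_gt0// mulr_gt0.
have C0 : 0 <= 6`!%:R * C by rewrite mulr_ge0 ?ler0n// /C; lra.
exists (16 + 6`!%:R * C); split; first by rewrite lerDl.
move=> d d0 dL; have L16 : 16 <= ln d by apply: le_trans dL; rewrite lerDl.
have L0 : 0 < ln d by lra.
have hC : C * ln d ^+ 5 <= d by apply: ln_pow5_le => //; [exact: ltW|apply: le_trans dL; rewrite lerDr].
clear dL C0; set L := ln d in L16 L0 hC *.
have P2 : 16 * L <= L ^+ 2 by rewrite expr2 ler_wpM2r//; lra.
have P4 : L ^+ 2 * 256 <= L ^+ 4.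
  rewrite (_ : L ^+ 4 = L ^+ 2 * L ^+ 2); last by ring.
  by rewrite ler_wpM2l ?exprn_ge0 ?(ltW L0)//; nra.
have P5 : 16 * L ^+ 4 <= L ^+ 5 by rewrite (exprS _ 4) ler_wpM2r ?exprn_ge0 ?(ltW L0).
have L5 : 0 < L ^+ 5 by rewrite exprn_gt0.
have h48 : 48 * L ^+ 5 <= d by apply: le_trans hC; rewrite ler_pM2r// /C; lra.
have hk : 24 * L ^+ 5 <= k0 * d.
  rewrite -(ler_pdivrMl _ _ k00); apply: le_trans hC.
  by rewrite mulrA (mulrC _ 24) ler_pM2r// /C; lra.
have hs : 32 * sg * L ^+ 5 <= a * d.
  rewrite -(ler_pdivrMl _ _ a0); apply: le_trans hC.
  by rewrite mulrA (mulrC _ (32 * sg)) ler_pM2r// /C; lra.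
have mu54 : mu <= 5 / 4 by rewrite /mu; nra.
have mu0 : 0 < mu by rewrite mulr_gt0//; lra.
have am : 2 * a * mu <= 1 by nra.
have smu : sg * mu <= 5 / 2 by rewrite /mu mulrA (mulrC sg) rs; lra.
have kE : a * rho * (eps ^+ 2 * d / (64 * L)) = k0 * d / L.
  by rewrite /k0; field; rewrite gt_eqF.
have C2 : 24 * L ^+ 4 <= k0 * d / L.
  by rewrite ler_pdivlMr// -mulrA -exprSr.
have ad : 0 <= a * d by rewrite mulr_ge0 ?(ltW a0) ?(ltW d0).
have sL : sg * L <= sg * L ^+ 5 by rewrite ler_pM2l//; nra.
have sL2 : sg * L ^+ 2 <= sg * L ^+ 5 by rewrite ler_pM2l//; nra.
rewrite kE; do 2 split=> //.
- by lra.
- by apply: le_trans C2; lra.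
- by rewrite -mulrA; nra.
- apply: (@le_trans _ _ (a * d * 1)); last by rewrite ler_wpM2l//; nra.
  apply: le_trans (_ : 16 * sg * (2 * L) <= _); last by lra.
  by rewrite ler_wpM2l ?mulr_ge0 ?(ltW sg0)//; lra.
- by lra.
- by lra.
- apply: (@le_trans _ _ (d * 1)); last by rewrite ler_pM2l//; nra.
  by lra.
- by lra.
Qed.

(** The terms add up to at most six times [expR (- (lam / 2))], and [lam >= 20] gives
    [expR (lam / 4) >= 6]. The excess term stays small because [36 * m * (ln d + 5)] is at most a
    quarter of [lam]. *)
Lemma failure_probability (d : R) (n m : nat) :
  0 < d -> 16 <= ln d -> 20 + 4 * ln d <= ln n%:R :> R -> (0 < n)%N ->
  m%:R <= ln n%:R / ln d ^+ 4 ->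
  n%:R^-1 * (d ^+ (36 * m).+1 * expR ((36 * m)%:R *+ 5)) + n%:R^-1 + n%:R^-1 +
  n%:R * d * (n%:R `^ (- (7 / 3)) +
    Num.sqrt 2 * expR (- ((10 * Num.sqrt (ln n%:R)) ^+ 2 / 4))) <= n%:R `^ (- (1 / 4)).
Proof.
move=> d0 L16 hlam n0 hm.
have n0R : 0 < n%:R :> R by rewrite ltr0n.
rewrite /powR !gt_eqF//; set lam : R := ln n%:R in hlam hm *.
have nE : n%:R = expR lam by rewrite lnK ?posrE.
have dE : d = expR (ln d) by rewrite lnK ?posrE.
rewrite nE {1 2}dE; set L := ln d in L16 hlam hm *.
rewrite exprMn sqr_sqrtr; last by lra.
set K : R := (36 * m)%:R.
have P4 : 256 * L ^+ 2 <= L ^+ 4.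
  rewrite (_ : L ^+ 4 = L ^+ 2 * L ^+ 2); last by ring.
  by rewrite ler_wpM2r ?sqr_ge0//; nra.
have L40 : 0 < L ^+ 4 by rewrite exprn_gt0//; lra.
have m0 : 0 <= m%:R :> R by [].
have mL : m%:R * L ^+ 4 <= lam by rewrite -ler_pdivlMr.
have KL : K * (L + 5) <= lam / 4.
  rewrite /K natrM; have : m%:R * (288 * L) <= m%:R * L ^+ 4 by rewrite ler_wpM2l//; nra.
  by nra.
have e2 : Num.sqrt 2 <= 2 :> R.
  by rewrite -[leRHS]ger0_norm// -sqrtr_sqr ler_wsqrtr// expr2 ler_pMr// ler1n.
have E1 : (expR lam)^-1 * (expR L ^+ (36 * m).+1 * expR (K *+ 5)) <= expR (- (lam / 2)).
  rewrite -expRM_natl -expRN -!expRD ler_expR -natr1 -/K; lra.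
have E2 : (expR lam)^-1 <= expR (- (lam / 2)) by rewrite -expRN ler_expR; lra.
have E3 : expR lam * expR L * expR (- (7 / 3) * lam) <= expR (- (lam / 2)).
  by rewrite -!expRD ler_expR; lra.
have E4 : expR lam * expR L * (Num.sqrt 2 * expR (- (10 ^+ 2 * lam / 4))) <=
    2 * expR (- (lam / 2)).
  rewrite mulrCA; apply: ler_pM => //; rewrite ?(mulr_ge0, expR_ge0)//.
  by rewrite -!expRD ler_expR; lra.
have E5 : 6 * expR (- (lam / 2)) <= expR (- (1 / 4) * lam).
  rewrite (_ : - (1 / 4) * lam = lam / 4 - lam / 2); last by lra.
  rewrite expRD ler_wpM2r ?expR_ge0//; have := expR_ge1Dx (lam / 4); lra.
rewrite mulrDr; lra.
Qed.

(** The witness [rho * eps / (8 * (K + 1))] keeps the second-order term of [N01_exp_abs] below a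
    fraction [eps / 4] of the linear one, for [j] up to 2. *)
Lemma abs_moments (eps : R) (rho := Num.sqrt (2 / pi) : R) : 0 < eps -> eps < 1 ->
  exists a : R, [/\ 0 < a, a <= 8^-1 & forall j : nat, (j <= 2)%N -> exists M : R,
    (\int[normal_prob (0 : R) 1]_y (expR (a * j%:R * `|y|))%:E)%E = M%:E /\
    1 <= M <= 1 + j%:R * a * (rho * (1 + eps / 4))].
Proof.
move=> e0 e1; have [rho0 rho1 _ _] := sqrt_2pi_bounds R; rewrite -/rho in rho0 rho1.
pose K : R := expR 9 * Num.sqrt 2; have K0 : 0 <= K by rewrite mulr_ge0 ?expR_ge0.
have a0 : 0 < rho * eps / (8 * (K + 1)) by rewrite divr_gt0 ?mulr_gt0//; lra.
have aK : rho * eps / (8 * (K + 1)) * (8 * (K + 1)) = rho * eps by field; rewrite gt_eqF//; lra.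
move: (rho * eps / _) a0 aK => a a0 aK.
have re : rho * eps <= 1 by nra.
have aK0 : 0 <= a * K by rewrite mulr_ge0// ltW.
have a8 : a <= 8^-1 by nra.
exists a; split=> // j j2.
have j0 : 0 <= j%:R :> R by [].
have j2R : j%:R <= 2 :> R by rewrite ler_nat.
have aj0 : 0 <= a * j%:R by rewrite mulr_ge0// ltW.
have aj1 : a * j%:R <= 1 by nra.
have [|M [ME /andP[M1 M2]]] := @N01_exp_abs R (a * j%:R); first by rewrite aj0.
exists M; split=> //; rewrite M1 /=; apply: le_trans M2 _; rewrite -/K -/rho.
have : (a * j%:R) * (a * j%:R * K) <= (a * j%:R) * (rho * (eps / 4)).
  by rewrite ler_wpM2l//; nra.
by nra.
Qed.

(** Taking the constant 1 in place of the coupling turns star sums into edge counts, so the same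
    tail bound controls degrees. *)
Lemma cst_moments (j : nat) : (j <= 2)%N -> exists M : R,
  (\int[normal_prob (0 : R) 1]_y (expR (2^-1 * j%:R * 1))%:E)%E = M%:E /\
  1 <= M <= 1 + j%:R * 2^-1 * expR 1.
Proof.
move=> j2; exists (expR (2^-1 * j%:R * 1)).
have j0 : 0 <= j%:R :> R by [].
have j2R : j%:R <= 2 :> R by rewrite ler_nat.
split.
  rewrite integral_cst// -[RHS]mule1; congr (_ * _)%E.
  exact: (@probability_setT _ _ _ (normal_prob (0 : R) 1)).
rewrite mulr1 (mulrC _ j%:R); set u := j%:R / 2.
have u0 : 0 <= u by rewrite /u; lra.
rewrite -expR0 ler_expR u0 /=; apply: le_trans (expR_le1Du u0) _.
by rewrite expR0 lerD2l ler_wpM2l// ler_expR /u; lra.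
Qed.

End Numerics.

(** * Union of the bad events and conclusion *)

Section GoodProbability.
Context (R : realType) (disp : measure_display) (T : measurableType disp).
Variables (P : probability T R) (n : nat) (G : T -> graph n) (J : edge n -> {RV P >-> R}).
Variables (eps d beta a : R) (m r : nat).
Let rho : R := Num.sqrt (2 / pi).
Let sg : R := Num.sqrt (2 * pi).
Let mu := rho * (1 + eps / 4).

Lemma good_probability :
  0 < eps -> eps < 1 -> 0 < a -> 0 < d -> 16 <= ln d ->
  (forall j : nat, (j <= 2)%N -> exists M : R,
    (\int[normal_prob (0 : R) 1]_y (expR (a * j%:R * `|y|))%:E)%E = M%:E /\
    1 <= M <= 1 + j%:R * a * mu) ->
  [/\ 2 * expR 1 <= d,
      4 * (ln d + 3 + 2 * a * mu) <= a * rho * (eps ^+ 2 * d / (64 * ln d)),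
      24 * ln d ^+ 4 <= a * rho * (eps ^+ 2 * d / (64 * ln d)),
      16 * sg * mu <= ln d ^+ 2 & 16 * sg * (ln d + 3 + 2 * a * mu) <= a * d * ln d ^+ 2] ->
  [/\ 24 * sg * ln d ^+ 2 <= a * d, 16 * expR 1 <= ln d ^+ 2,
      32 * (ln d + 3 + expR 1) <= d * ln d ^+ 2 & 48 * ln d ^+ 2 <= d] ->
  0 < beta -> beta <= (1 - eps) * beta_c d ->
  (0 < n)%N -> 20 + 4 * ln d <= ln n%:R :> R ->
  1 <= ln n%:R / ln d ^+ 4 :> R -> m%:R <= ln n%:R / ln d ^+ 4 ->
  ln n%:R / ln d ^+ 4 <= 2 * m%:R -> (r < m)%N -> ln d ^+ 5 <= r.+1%:R ->
  erdos_renyi P (d / n%:R) G -> gaussian_couplings G J ->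
  ((1 - n%:R `^ (- (1 / 4)))%:E <=
    P [set w | good_instance (G w) (fun e => J e w) beta d eps])%E.
Proof.
move=> e0 e1 a0 d0 L16 mom [d8 C1 C2 C3 C4] [C5 C6 C7 C8] b0 b1 n0 hlam lam4 m1 m2 rm r5 er gc.
have ex0 : 0 <= expR 1 :> R := expR_ge0 _.
have d1 : 1 <= d by apply: le_trans d8; have := expR_ge1Dx (1 : R); lra.
have rho0 : 0 <= rho := sqrtr_ge0 _.
have mu0 : 0 <= mu by rewrite mulr_ge0//; lra.
have [mE1 PE1] := excess_bound d1 n0 er (36 * m).
have [mE2 PE2] := star_bound d1 n0 er gc (@measurable_abs R) (ltW a0) mu0 mom.
have h2 : 0 <= 2^-1 :> R by [].
have [mE3 PE3] := star_bound d1 n0 er gc (@measurable_cst _ _ R R setT 1) h2 ex0 (@cst_moments R).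
have [mE4 PE4] := range_bound d1 n0 er gc (powR_ge0 n%:R (- (7 / 3) : R))
  (mulr_ge0 (ler0n _ 10) (sqrtr_ge0 (ln n%:R))).
have num := failure_probability d0 L16 hlam n0 m1.
set E1 := excess_event _ _ in mE1 PE1.
set E2 := star_event _ _ _ _ _ _ in mE2 PE2.
set E3 := star_event _ _ _ _ _ _ in mE3 PE3.
set E4 := range_event _ _ _ _ in mE4 PE4.
pose E := E1 `|` E2 `|` E3 `|` E4.
have mE : measurable E by do 3 apply: measurableU => //.
have PE : (P E <= (n%:R `^ (- (1 / 4)))%:E)%E.
  apply: (@le_trans _ _ (P E1 + P E2 + P E3 + P E4)%E).
    apply: (@le_trans _ _ (P (E1 `|` E2 `|` E3) + P E4)%E).
      by apply: measureU2 => //; do 2 apply: measurableU => //.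
    rewrite leeD2r//; apply: (@le_trans _ _ (P (E1 `|` E2) + P E3)%E).
      by apply: measureU2 => //; apply: measurableU.
    by rewrite leeD2r//; apply: measureU2.
  apply: (@le_trans _ _ _ _ _ (leeD (leeD (leeD PE1 PE2) PE3) PE4)).
  by rewrite -!EFinD lee_fin.
have good w : ~ E w -> good_instance (G w) (fun e => J e w) beta d eps.
  move=> nE; have nE1 : ~ E1 w by move=> h; apply: nE; do 3 left.
  have nE2 : ~ E2 w by move=> h; apply: nE; do 2 left; right.
  have nE3 : ~ E3 w by move=> h; apply: nE; left; right.
  have nE4 : ~ E4 w by move=> h; apply: nE; right.
  apply: (@deterministic_good _ _ _ _ eps d beta a m r) => //.
  - by lra.
  - exact: excess_eventP nE1.
  - exact: star_eventP nE2.
  - move=> A A0 Ac; have := star_eventP nE3 A0 Ac (fintype.subxx A).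
    by rewrite /star_rate mulfV// mul1r.
  - exact: range_eventP nE4.
have mgood : measurable [set w | good_instance (G w) (fun e => J e w) beta d eps].
  apply: (@measurable_good _ _ _ _ G (fun e w => J e w)) => [g|e].
    exact: measurable_graph_eq er g.
  exact: measurable_funP (J e).
apply: (@le_trans _ _ (P (~` E))); last first.
  apply: le_measure; last exact: good; rewrite inE//; exact: measurableC.
rewrite (probability_setC P mE) EFinB; apply: leeB => //.
Qed.

End GoodProbability.

Theorem theorem4p2 (R : realType) (eps : R) (eps_gt0 : 0 < eps) :
  exists d0 : R, 1 <= d0 /\
    forall d : R, d0 <= d ->
    exists n0 : nat,
    forall beta : R, 0 < beta -> beta <= (1 - eps) * beta_c d ->
    forall n : nat, (n0 <= n)%N ->
    forall (disp : measure_display) (T : measurableType disp)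
      (P : probability T R) (G : T -> graph n) (J : edge n -> {RV P >-> R}),
      erdos_renyi P (d / n%:R) G ->
      gaussian_couplings G J ->
      ((1 - n%:R `^ (- (1 / 4)))%:E <=
        P [set w | good_instance (G w) (fun e => J e w) beta d eps])%E.
Proof.
have [eps1|eps1] := leP 1 eps.
  (* For [eps >= 1] the range of [beta] is empty. *)
  exists 1; split=> // d d1; exists 0%N => beta b0 b1; exfalso.
  have : (1 - eps) * beta_c d <= 0.
    rewrite mulr_le0_ge0 ?subr_le0// divr_ge0 ?sqrtr_ge0//; lra.
  by lra.
have [a [a0 a8 mom]] := abs_moments eps_gt0 eps1.
have [L0 [L16 dC]] := large_degree eps_gt0 eps1 a0 a8.
exists (expR L0); split; first by rewrite -expR0 ler_expR; lra.
move=> d dL; have d0 : 0 < d := lt_le_trans (expR_gt0 _) dL.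
have Ld : L0 <= ln d by rewrite -ler_expR lnK ?posrE.
have [c1 c2] := dC d d0 Ld; have L16' := le_trans L16 Ld.
have L40 : 0 < ln d ^+ 4 by rewrite exprn_gt0//; lra.
pose r := Num.bound (ln d ^+ 5).
(* The first two summands serve [failure_probability]. The last makes [ln n%:R / ln d ^+ 4] at least
   [r.+2], so that its integer part [m] exceeds [r]; then [m] is at least 1 and the quotient is
   below [m + 1 <= 2 * m]. *)
pose lam0 := 20 + 4 * ln d + r.+2%:R * ln d ^+ 4.
exists (Num.bound (expR lam0)) => beta b0 b1 n nn disp T P G J er gc.
have en : expR lam0 <= n%:R.
  apply: (@le_trans _ _ (Num.bound (expR lam0))%:R); last by rewrite ler_nat.
  by apply: ltW; apply: archi_boundP; rewrite expR_ge0.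
have nR : 0 < n%:R :> R := lt_le_trans (expR_gt0 _) en.
have lamn : lam0 <= ln n%:R by rewrite -ler_expR lnK ?posrE.
have r2 : r.+2%:R <= ln n%:R / ln d ^+ 4 :> R.
  by rewrite ler_pdivlMr//; apply: le_trans lamn; rewrite /lam0 lerDr; lra.
have lam20 : 20 + 4 * ln d <= ln n%:R :> R.
  by apply: le_trans lamn; rewrite /lam0 lerDl mulr_ge0// ltW.
set x := ln n%:R / ln d ^+ 4 in r2.
have x1 : 1 <= x by apply: le_trans r2; rewrite ler1n.
have x0 : 0 <= x by apply: le_trans x1.
have /andP[m1 m2] := Num.Theory.truncn_itv x0.
have rm : (r < Num.truncn x)%N.
  by rewrite -ltnS -(ltr_nat R); apply: le_lt_trans m2; apply: le_trans r2; rewrite ler_nat.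
apply: (@good_probability _ _ _ _ _ _ _ eps d beta a (Num.truncn x) r) => //.
- by rewrite -(ltr0n R).
- apply: le_trans (ltW m2) _; rewrite -natr1.
  have : 1 <= (Num.truncn x)%:R :> R by rewrite ler1n; exact: leq_ltn_trans rm.
  by lra.
- apply: ltW; apply: lt_le_trans (_ : r%:R <= _); last by rewrite ler_nat.
  by apply: archi_boundP; rewrite exprn_ge0//; lra.
Qed.
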